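(* Let $N>4$ be an integer. For all $v\in C_c^\infty(\mathbb{R}^N_+)$ the following two inequalities hold: $$\text{(A)}\quad \int_{\mathbb{R}^{+}} \int_{\mathbb{R}^{N-1}} \left( y^2 (\Delta v)^2 + \frac{N^2 - 2N -1}{4} |\nabla v|^2 \right) dx \, dy \geq \frac{N(N-2)}{16} \int_{\mathbb{R}^{+}} \int_{\mathbb{R}^{N-1}} \frac{v^2}{y^2} \, dx \, dy$$ $$+ \frac{(N-1)^2}{16} \int_{\mathbb{R}^{+}} \int_{\mathbb{R}^{N-1}} \frac{v^2}{y^2 d^2} \, dx \, dy + \frac{9}{16} \int_{\mathbb{R}^{+}} \int_{\mathbb{R}^{N-1}} \frac{v^2}{y^2 d^4} \, dx \, dy$$ and $$\text{(B)}\quad \int_{\mathbb{R}^{+}} \int_{\mathbb{R}^{N-1}} \left( (\Delta v)^2 + \frac{N^2 - 2N -9}{4} \frac{|\nabla v|^2}{y^2} \right) dx \, dy \geq \frac{9}{16} (N+2)(N - 4) \int_{\mathbb{R}^{+}} \int_{\mathbb{R}^{N-1}} \frac{ v^2}{y^4} \, dx \, dy$$ $$+ \frac{(N-1)^2}{16} \int_{\mathbb{R}^{+}} \int_{\mathbb{R}^{N-1}} \frac{ v^2}{y^4 d^2} \, dx \, dy + \frac{9}{16} \int_{\mathbb{R}^{+}} \int_{\mathbb{R}^{N-1}} \frac{ v^2}{y^4 d^4} \, dx \, dy.$$ Furthermore, with all integrals over $\mathbb{R}^+\times\mathbb{R}^{N-1}$: (A1) no inequality of the form $\iint \left( y^2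 (\Delta v)^2 + c |\nabla v|^2 \right) dx \, dy \geq \frac{N(N-2)}{16} \iint \frac{v^2}{y^2} \, dx \, dy$ holds for all $v\in C_c^\infty(\mathbb{R}^N_+)$ when $c<\frac{N^2-2N-1}{4}$; (A2) no inequality of the form $\iint \left( y^2 (\Delta v)^2 + \frac{N^2-2N-1}{4} |\nabla v|^2 \right) dx \, dy \geq c \iint \frac{v^2}{y^2} \, dx \, dy$ holds for all $v\in C_c^\infty(\mathbb{R}^N_+)$ when $c>\frac{N(N-2)}{16}$; (A3) no inequality of the form $\iint \left( y^2 (\Delta v)^2 + \frac{N^2-2N-1}{4} |\nabla v|^2 \right) dx \, dy \geq \frac{N(N-2)}{16} \iint \frac{v^2}{y^2} \, dx \, dy + c\iint \frac{v^2}{y^2d^2}\,dx\,dy$ holds for all $v\in C_c^\infty(\mathbb{R}^N_+)$ when $c>\frac{(N-1)^2}{16}$. Similarly for (B): (B1) no inequality of the form $\iint \left( (\Delta v)^2 + c \frac{|\nabla v|^2}{y^2} \right) dx \, dy \geq \frac{9}{16}(N+2)(N-4) \iint \frac{v^2}{y^4} \, dx \, dy$ holds for all $v\in C_c^\infty(\mathbb{R}^N_+)$ when $c<\frac{N^2-2N-9}{4}$; (B2) no inequality of the form $\iint \left( (\Delta v)^2 + \frac{N^2-2N-9}{4} \frac{|\nabla v|^2}{y^2} \right) dx \, dy \geq c \iint \frac{v^2}{y^4} \, dx \, dy$ holds for all $v\in C_c^\infty(\mathbb{R}^N_+)$ when $c>\frac{9}{16}(N+2)(N-4)$; (B3) no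 inequality of the form $\iint \left( (\Delta v)^2 + \frac{N^2-2N-9}{4} \frac{|\nabla v|^2}{y^2} \right) dx \, dy \geq \frac{9}{16}(N+2)(N-4) \iint \frac{v^2}{y^4} \, dx \, dy + c\iint \frac{v^2}{y^4d^2}\,dx\,dy$ holds for all $v\in C_c^\infty(\mathbb{R}^N_+)$ when $c>\frac{(N-1)^2}{16}$.
   Context: $\mathbb{R}^N_+=\{(x,y)\in\mathbb{R}^{N-1}\times\mathbb{R}^+\}$ is the upper half space, with $\mathbb{R}^+=(0,\infty)$; $\nabla$ and $\Delta$ are the Euclidean gradient and Laplacian in the variables $(x,y)$, and $C_c^\infty(\mathbb{R}^N_+)$ denotes smooth functions with compact support in the open half space. The function $d$ is $$d=d((x,y),(0,1)):=\cosh^{-1}\left(1+\frac{(|y|-1)^2+|x|^2}{2|y|}\right),$$ i.e. the hyperbolic distance from $(x,y)$ to $(0,1)$ in the half-space model (metric $\delta_{ij}/y^2$). *)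

(* Defs.v *)
From HB Require Import structures.
From mathcomp Require Import all_boot all_order all_algebra.
From mathcomp Require Import all_classical all_reals all_analysis.
Set Implicit Arguments. Unset Strict Implicit. Unset Printing Implicit Defensive.
Import Order.TTheory GRing.Theory Num.Theory.
Import numFieldNormedType.Exports.
Local Open Scope classical_set_scope.
Local Open Scope ring_scope.

Lemma product_measure1_sigma_finite d1 d2 (T1 : measurableType d1)
    (T2 : measurableType d2) (R : realType)
    (m1 : {sigma_finite_measure set T1 -> \bar R})
    (m2 : {sigma_finite_measure set T2 -> \bar R}) :
  sigma_finite setT (m1 \x m2)%E.
Proof.
have /sigma_finiteP[F [TF ndF Foo]] := sigma_finiteT m1.
have /sigma_finiteP[G [TG ndG Goo]] := sigma_finiteT m2.
exists (fun k => F k `*` G k).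
  rewrite -setXTT TF TG predeqE => -[x y]; split.
    move=> [/= [k _ Fkx] [l _ Gly]]; exists (maxn k l) => //; split.
    - by move: x Fkx; exact/subsetPset/ndF/leq_maxl.
    - by move: y Gly; exact/subsetPset/ndG/leq_maxr.
  by move=> [k _ []/= ? ?]; split; exists k.
move=> k; have [? ?] := Foo k; have [? ?] := Goo k.
split; first exact: measurableX.
by rewrite product_measure1E// lte_mul_pinfty// ge0_fin_numE.
Qed.

Section tuple_measure.
Context {d : measure_display} {T : measurableType d} {R : realType} {n : nat}.
Variables (m1 : {sigma_finite_measure set T -> \bar R})
          (mn : {sigma_finite_measure set (n.-tuple T) -> \bar R}).

Definition tuple_cons (p : T * n.-tuple T) : n.+1.-tuple T :=
  [the n.+1.-tuple T of p.1 :: p.2].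

Lemma measurable_tuple_cons : measurable_fun setT tuple_cons.
Proof. exact: measurable_cons. Qed.

HB.instance Definition _ :=
  isMeasurableFun.Build _ _ _ _ tuple_cons measurable_tuple_cons.

Definition tuple_uncons (t : n.+1.-tuple T) : T * n.-tuple T :=
  (thead t, [tuple of behead t]).

Lemma measurable_tuple_uncons : measurable_fun setT tuple_uncons.
Proof.
apply/measurable_fun_pairP; split; last exact: measurable_behead.
exact: measurable_tnth.
Qed.

Lemma tuple_consK : cancel tuple_cons tuple_uncons.
Proof.
move=> [x t]; rewrite /tuple_uncons /tuple_cons /=; congr pair.
exact/val_inj.
Qed.

Definition measure_tuple_cons : set (n.+1.-tuple T) -> \bar R :=
  pushforward (m1 \x mn)%E tuple_cons.

Let measure_tuple_cons0 : measure_tuple_cons set0 = 0%E.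
Proof. by rewrite /measure_tuple_cons /pushforward preimage_set0 measure0. Qed.

Let measure_tuple_cons_ge0 A : (0 <= measure_tuple_cons A)%E.
Proof. exact: measure_ge0. Qed.

Let measure_tuple_cons_sigma_additive :
  semi_sigma_additive measure_tuple_cons.
Proof.
have mC (A : set (n.+1.-tuple T)) :
    measurable A -> measurable (tuple_cons @^-1` A).
  by move=> mA; rewrite -[X in measurable X]setTI; exact: measurable_tuple_cons.
move=> F mF tF mUF; rewrite /measure_tuple_cons /pushforward preimage_bigcup.
apply: measure_semi_sigma_additive.
- by move=> i; exact: mC.
- apply/trivIsetP => /= i j _ _ ij; rewrite -preimage_setI.
  by move/trivIsetP : tF => /(_ _ _ _ _ ij) ->//; rewrite preimage_set0.
- by rewrite -preimage_bigcup; exact: mC.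
Qed.

HB.instance Definition _ := isMeasure.Build _ _ _ measure_tuple_cons
  measure_tuple_cons0 measure_tuple_cons_ge0 measure_tuple_cons_sigma_additive.

Lemma measure_tuple_cons_sigma_finite : sigma_finite setT measure_tuple_cons.
Proof.
have [F UF Foo] := product_measure1_sigma_finite m1 mn.
exists (fun k => tuple_uncons @^-1` F k).
  by rewrite -preimage_bigcup -UF preimage_setT.
move=> k; have [mF Fk] := Foo k; split.
  by rewrite -[X in measurable X]setTI; exact: measurable_tuple_uncons.
rewrite /measure_tuple_cons /pushforward.
rewrite (_ : _ @^-1` _ = F k)//; apply/seteqP; split=> p /=;
  by rewrite tuple_consK.
Qed.

HB.instance Definition _ := Measure_isSigmaFinite.Build _ _ _
  measure_tuple_cons measure_tuple_cons_sigma_finite.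

End tuple_measure.

(* Lebesgue measure on the Borel sets of R^n, the points being n-tuples: the
   n-fold product of the one-dimensional Lebesgue measure. *)
Fixpoint lebesgue_tuple {R : realType} (n : nat) :
    {sigma_finite_measure set (n.-tuple (measurableTypeR R)) -> \bar R} :=
  match n with
  | 0 => \d_ ([tuple] : 0.-tuple (measurableTypeR R))
  | m.+1 => measure_tuple_cons lebesgue_measure (lebesgue_tuple m)
  end.

Lemma lebesgue_tuple0 {R : realType} :
  lebesgue_tuple 0 [set: 0.-tuple (measurableTypeR R)] = 1%E.
Proof. exact: diracT. Qed.

Lemma lebesgue_tupleS {R : realType} (n : nat) (A : set (measurableTypeR R))
    (B : set (n.-tuple (measurableTypeR R))) :
  measurable A -> measurable B ->
  lebesgue_tuple n.+1 (tuple_uncons @^-1` (A `*` B)) =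
  (lebesgue_measure A * lebesgue_tuple n B)%E.
Proof.
move=> mA mB; rewrite -product_measure1E//.
rewrite /= /measure_tuple_cons /pushforward -comp_preimage.
by rewrite (_ : tuple_uncons \o tuple_cons = id)//; exact/funext/tuple_consK.
Qed.

Section hyperbolic_cosine.
Context {R : realType}.
Implicit Types s t : R.

Definition cosh t : R := (expR t + expR (- t)) / 2.

Definition arcosh t : R := ln (t + Num.sqrt (t ^+ 2 - 1)).

(* arcosh is the inverse of the restriction of cosh to [0, +oo[. *)
Lemma arcosh_ge0 t : 1 <= t -> 0 <= arcosh t.
Proof.
by move=> t1; rewrite ln_ge0// -[leLHS]addr0 lerD// sqrtr_ge0.
Qed.

Lemma arcoshK t : 1 <= t -> cosh (arcosh t) = t.
Proof.
move=> t1; rewrite /cosh /arcosh expRN.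
have s0 : 0 <= t ^+ 2 - 1 by rewrite subr_ge0 exprn_ege1.
set s := Num.sqrt _; have s2 : s ^+ 2 = t ^+ 2 - 1 by rewrite sqr_sqrtr.
have ts0 : 0 < t + s by rewrite ltr_pwDl ?sqrtr_ge0// (lt_le_trans ltr01).
rewrite lnK ?posrE//.
have -> : (t + s)^-1 = t - s.
  apply: (mulfI (lt0r_neq0 ts0)); rewrite divff ?lt0r_neq0//.
  by rewrite mulrC -subr_sqr s2 subKr.
by rewrite addrACA subrr addr0 -mulr2n -[t *+ 2]mulr_natr mulfK.
Qed.

End hyperbolic_cosine.

(* With N = n + 1, points of R^N are pairs (x, y) with x : 'rV[R]_n and y : R.
   The norm `|x| of 'rV[R]_n is the sup norm, hence the explicit sums of squares
   for Euclidean lengths below. *)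
Section half_space.
Context {R : realType} {n : nat}.
Implicit Types (v : 'rV[R]_n * R -> R) (p : 'rV[R]_n * R).

Definition half_space : set ('rV[R]_n * R) := [set p | 0 < p.2].

(* Some i is the direction of the i-th coordinate of x, None that of y. *)
Definition basis_dir (i : option 'I_n) : 'rV[R]_n * R :=
  if i is Some j then (delta_mx ord0 j, 0) else (0, 1).

Definition partial (i : option 'I_n) v : 'rV[R]_n * R -> R :=
  fun p => 'D_(basis_dir i) v p.

(* |grad v|^2 *)
Definition grad_sq v p : R := \sum_i partial i v p ^+ 2.

Definition laplacian v p : R := \sum_i partial i (partial i v) p.

Fixpoint Ck (k : nat) v : Prop :=
  match k with
  | 0 => continuous v
  | k'.+1 => continuous v /\
      forall i : option 'I_n,
        (forall p, derivable v p (basis_dir i)) /\ Ck k' (partial i v)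
  end.

Definition tsupport v : set ('rV[R]_n * R) := closure [set p | v p != 0].

(* C_c^oo of the open half space, its elements being extended by zero to R^N. *)
Definition test_function v : Prop :=
  [/\ forall k, Ck k v, compact (tsupport v) & tsupport v `<=` half_space].

(* Hyperbolic distance from (x, y) to (0, 1). *)
Definition hyp_dist (x : 'rV[R]_n) (y : R) : R :=
  arcosh (1 + ((`|y| - 1) ^+ 2 + \sum_i x ord0 i ^+ 2) / (2 * `|y|)).

Definition half_space_integral (f : 'rV[R]_n -> R -> R) : \bar R :=
  (\int[lebesgue_measure]_(y in `]0%R, +oo[)
     \int[lebesgue_tuple n]_t (f (\row_i tnth t i) y)%:E)%E.

End half_space.

Notation "\iint_ ( x , y ) E" := (half_space_integral (fun x y => E%R))
  (at level 36, x name, y name, E at level 36,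
   format "\iint_ ( x ,  y )  E") : ereal_scope.

(* Main.v *)
(** Write nu = N - 1, c = cosh d = (1 + |x|^2 + y^2) / (2 y) and s = sinh d.

    For (A), a calibration works. Off the pole (0, 1), where d = 0, the difference
    of the two integrands is the divergence of an explicit field, quadratic in
    (v, grad v) with coefficients built from y, c and d, plus a sum of squares,
    plus v^2 / y^2 times a function of d that is nonnegative because d <= s and
    N > 4. Multiplying by a cutoff that vanishes near the pole and
    integrating leaves an error that vanishes in the limit, since the singularity
    is weak compared with the dimension. The substitution v = y w turns (B) into
    (A) after integrations by parts that use the symmetry of second derivatives.

    For the sharpness, take w = phi(|x|^2) sqrt(y t) psi(eps (ln t - ln M)) with
    t = - ln y, bumps phi and psi, eps = 1/M and M large. On its support d is
    t + O(1), and y^2 eta'' + eta / 4 is of order eta / t^2 for the profile eta,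
    so that all inequalities involved in (A) are nearly equalities, with
    the remainder nu^2 / 16 w^2 / (y^2 d^2) as leading term. As d is arbitrarily large on
    the support, that term is negligible against w^2 / y^2, whence the
    sharpness of the other constants; the one of |grad v|^2 also uses Hardy's
    inequality int w^2 / y^2 <= 4 int |grad w|^2. *)

Require Import Defs.
From HB Require Import structures.
From mathcomp Require Import all_boot all_order all_algebra.
From mathcomp Require Import all_classical all_reals all_analysis.
From mathcomp Require Import measurable_realfun ring lra.
Import Order.TTheory GRing.Theory Num.Theory.
Import numFieldNormedType.Exports.
Local Open Scope classical_set_scope.
Local Open Scope ring_scope.
Set Implicit Arguments.
Unset Strict Implicit.

(** * Integration over Euclidean space *)

(** The calibration combines a completed square with two ground-state substitutions. The square with
    base y L + v/(4y) + v/(2 s^2 y) has the cross term (1/2 + s^-2) v L; trading v L for a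
    divergence minus |grad v|^2 leaves the weight B = nu^2/4 + s^-2 in front of |grad v|^2. Split B
    as (B - r^-2) + r^-2, both parts being nonnegative because r^-2 <= c^2/s^2 = 1 + s^-2. For each
    part compare grad v with v grad(log Phi_q), where Phi_q = y^(-(nu-1)/2) r^q s^(-nu/2). On the
    first part q = 1/2, the Hardy exponent, yields nu^2/16 r^-2 - 5/4 r^-4 among its terms; on the
    second, q = 3/2 maximizes q (3 - q) and yields 9/4 r^-4. The total 1 of the coefficients of r^-4
    leaves room for 9/16.

    The obstacle is the pole. The field is of order r^-3 there, so a cutoff at distance 1/t costs
    t^4 pointwise on a set of volume t^-N, and N > 4 makes this vanish. Everything radial is written
    as a function of c, since c is smooth at the pole and d is not. *)

Definition rowt {R : realType} {m : nat} (t : m.-tuple R) : 'rV[R]_m :=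
  \row_i tnth t i.

Lemma integrable_indic_lty d (T : measurableType d) (R : realType)
    (mu : {measure set T -> \bar R}) (A : set T) :
  measurable A -> (mu A < +oo)%E -> mu.-integrable setT (EFin \o \1_A).
Proof.
move=> mA muA; apply/integrableP; split; first exact/measurable_EFinP/measurable_indic.
rewrite (eq_integral (fun x => (\1_A x)%:E)); last first.
  by move=> t _; rewrite gee0_abs// lee_fin.
by rewrite integral_indic// setIT.
Qed.

Section euclidean_integral.
Context {R : realType}.
Implicit Types m : nat.

Definition compact_box m (G : 'rV[R]_m -> R) :=
  continuous G /\ exists K, forall z, G z != 0 -> forall i, `|z ord0 i| <= K.

(** The sigma-algebra on tuples is the product one, whereas [open] refers to the sup norm of row
    vectors. The two are reconciled by countability: an open set is the union of the boxes [W q]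
    with rational centre and radius 1/(k+1) that it contains. *)
Lemma measurable_rowt m (U : set 'rV[R]_m) : open U ->
  measurable [set t : m.-tuple (measurableTypeR R) | U (rowt t)].
Proof.
move=> oU.
pose W (q : {ffun 'I_m -> rat} * nat) : set (m.-tuple (measurableTypeR R)) :=
  [set t | forall i, `|ratr (q.1 i) - tnth t i| < q.2.+1%:R^-1].
have mW q : measurable (W q).
  have -> : W q = \bigcap_(i in [set: 'I_m])
      ((fun t => tnth t i) @^-1` ball (ratr (q.1 i) : R) q.2.+1%:R^-1).
    by apply/seteqP; split=> [t /= Wt i _ | t /= Wt i]; [exact: Wt|exact: (Wt i)].
  apply: fin_bigcap_measurable => // i _.
  rewrite -[X in measurable X]setTI; apply: measurable_tnth => //.
  by rewrite ball_itv; exact: measurable_itv.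
have -> : [set t : m.-tuple (measurableTypeR R) | U (rowt t)] =
    \bigcup_q (if `[< W q `<=` [set t | U (rowt t)] >] then W q else set0).
  apply/seteqP; split=> [t /= Ut | t [q _]]; last by case: asboolP => // + Wt; exact.
  move: oU; rewrite openE => /(_ _ Ut); rewrite /interior -nbhs_ballE => -[e /= e0 eU].
  (* Two points of the same box are compared through its centre, hence half of e. *)
  have [k ke] : exists k : nat, k.+1%:R^-1 < e / 2.
    have [k _ /(_ k (leqnn k)) /= hk] :=
      near_infty_natSinv_lt (PosNum (divr_gt0 e0 (ltr0n R 2))).
    by exists k; exact: hk.
  have q_ex i : exists q : rat, `|ratr q - tnth t i| < k.+1%:R^-1.
    have k0 : (0 : R) < k.+1%:R^-1 by rewrite invr_gt0 ltr0n.
    have /rat_in_itvoo[q] : tnth t i - k.+1%:R^-1 < tnth t i + k.+1%:R^-1.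
      by rewrite ltrD2l (lt_trans _ k0)// oppr_lt0.
    rewrite in_itv/= => /andP[? ?]; exists q.
    by rewrite ltr_distl; apply/andP; split.
  exists ([ffun i => projT1 (cid (q_ex i))], k) => //.
  case: asboolP => [_ i|[]] /=.
    by rewrite ffunE; case: cid.
  move=> u Wu; apply: eU; split=> // i j; rewrite !mxE.
  have := Wu j; rewrite /= ffunE; case: cid => q /= qt uq.
  rewrite /ball/= (@le_lt_trans _ _ (`|tnth t j - ratr q| + `|ratr q - tnth u j|))//.
    by rewrite (le_trans _ (ler_normD _ _))// addrA subrK.
  by rewrite distrC (splitr e) ltrD// (lt_trans _ ke).
apply: countable_bigcupT_measurable => // q.
by case: asboolP.
Qed.

Lemma measurable_fun_rowt m (G : 'rV[R]_m -> R) : continuous G ->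
  measurable_fun [set: m.-tuple (measurableTypeR R)] (fun t => G (rowt t)).
Proof.
move=> /continuousP cG; apply: (measurability _ (RGenOInfty.measurableE R)).
move=> _ [_ [a ->] <-]; rewrite setTI.
apply: (@measurable_rowt m (G @^-1` `]a, +oo[%classic)).
by apply: cG; exact: interval_open.
Qed.

Lemma measurable_tuple_box m (a b : R) :
  measurable [set t : m.-tuple (measurableTypeR R) | forall i, a <= tnth t i <= b].
Proof.
have -> : [set t : m.-tuple (measurableTypeR R) | forall i, a <= tnth t i <= b] =
   \bigcap_(i in [set: 'I_m]) ((fun t : m.-tuple (measurableTypeR R) => tnth t i) @^-1` `[a, b]%classic).
  by apply/seteqP; split=> t /= h i; [move=> _ /=; rewrite in_itv/= | have := h i I; rewrite /= in_itv].
apply: fin_bigcap_measurable => // i _.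
by rewrite -[X in measurable X]setTI; exact: measurable_tnth.
Qed.

Lemma lebesgue_tuple_box m (a b : R) : a <= b ->
  lebesgue_tuple m [set t | forall i, a <= tnth t i <= b] = ((b - a) ^+ m)%:E.
Proof.
move=> ab; elim: m => [|m IH].
  rewrite expr0 -lebesgue_tuple0; congr (lebesgue_tuple 0 _).
  by apply/seteqP; split=> // t _ [].
have -> : [set t : m.+1.-tuple R | forall i, a <= tnth t i <= b] =
   tuple_uncons @^-1` (`[a, b]%classic `*` [set t | forall i, a <= tnth t i <= b]).
  apply/seteqP; split=> t /= ht.
    split=> [|i]; first by rewrite /= in_itv/= ht.
    by have := ht (lift ord0 i); rewrite !(tnth_nth 0) /= nth_behead.
  move=> i; case: ht => /=; rewrite in_itv/= => h0 h.
  have [j ->|->//] := unliftP ord0 i; have := h j.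
  by rewrite !(tnth_nth 0) /= nth_behead.
rewrite lebesgue_tupleS//; last exact: measurable_tuple_box.
rewrite IH [X in (X * _)%E](_ : _ = (b - a)%:E) ?exprS//.
have := lebesgue_measure_itv `[a, b]; rewrite /= lte_fin; case: ltP => //.
by move=> ba ->; rewrite (_ : b - a = 0)//; apply/eqP; rewrite subr_eq0 eq_le ba ab.
Qed.

Lemma compact_box_bounded m (G : 'rV[R]_m -> R) : compact_box G ->
  exists2 C, 0 <= C & forall z, `|G z| <= C.
Proof.
move=> [cG [K GK]].
have : compact (G @` [set z : 'rV[R]_m | forall i, `[-K, K]%classic (z ord0 i)]).
  apply: continuous_compact; first exact: continuous_subspaceT.
  by apply: (@rV_compact _ _ (fun=> `[-K, K]%classic)) => i; exact: segment_compact.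
move=> /compact_bounded[M [_ hM]]; exists (`|M| + 1) => // z.
have [->|Gz] := eqVneq (G z) 0; first by rewrite normr0.
apply: (hM (`|M| + 1)); first by rewrite (le_lt_trans (ler_norm M))// ltrDl.
by exists z => // i /=; rewrite in_itv/= -ler_norml; exact: GK.
Qed.

Lemma compact_box_integrable m (G : 'rV[R]_m -> R) : compact_box G ->
  (lebesgue_tuple m).-integrable setT (fun t => (G (rowt t))%:E).
Proof.
move=> cG; have [C C0 GC] := compact_box_bounded cG.
have [cont [K GK]] := cG.
pose B := [set t : m.-tuple (measurableTypeR R) | forall i, - `|K| <= tnth t i <= `|K|].
have mB : measurable B by exact: measurable_tuple_box.
have iB : (lebesgue_tuple m).-integrable setT (fun t => (C * \1_B t)%:E).
  apply: (@integrableZl _ _ _ _ setT measurableT C (EFin \o \1_B)).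
  apply: integrable_indic_lty => //; rewrite [X in (X < _)%E]lebesgue_tuple_box ?ltry//.
  by rewrite (le_trans _ (normr_ge0 K))// oppr_le0.
apply: le_integrable iB => //.
  by apply/measurable_EFinP; exact: measurable_fun_rowt.
move=> t _; rewrite lee_fin normrM (ger0_norm C0) indicE.
have [tB|tB] := boolP (t \in B); first by rewrite normr1 mulr1; exact: GC.
rewrite normr0 mulr0 normr_le0; apply: contraR tB => Gt; rewrite inE => i.
have := GK _ Gt i; rewrite mxE -ler_norml => /le_trans; apply; exact: ler_norm.
Qed.

End euclidean_integral.

(** The difference quotients of [f \o g] at z and of [f] at [g z] are the same function of h, so the
    derivative of [f] in the single direction [v] suffices. *)
Lemma is_derive_affine (R : realType) (U V W : normedModType R) (f : V -> W)
    (g : U -> V) (z u : U) (v : V) (df : W) :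
  (forall h : R, g (h *: u + z) = h *: v + g z) ->
  is_derive (g z) v f df -> is_derive z u (f \o g) df.
Proof.
move=> gE [fd fE].
have E : (fun h : R => h^-1 *: (((f \o g) \o shift z) (h *: u) - (f \o g) z)) =
    (fun h => h^-1 *: ((f \o shift (g z)) (h *: v) - f (g z))).
  by apply/funext => h /=; rewrite gE.
split; first by rewrite /derivable E.
by rewrite -fE /derive E.
Qed.

(** * Integrals of partial derivatives *)

Section integral_derivative.
Context {R : realType}.
Local Notation leb := (@lebesgue_measure R).

Lemma integral_derive1_eq0 (g dg : R -> R) (K : R) :
  (forall y : R, is_derive y 1 g (dg y)) -> continuous dg ->
  (forall y, g y != 0 \/ dg y != 0 -> `|y| <= K) ->
  (\int[leb]_y (dg y)%:E = 0)%E.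
Proof.
move=> gd dgc gK.
pose L := `|K| + 1.
have KL : K < L by rewrite (le_lt_trans (ler_norm K))// ltrDl.
have L0 : 0 < L by rewrite ltr_wpDl.
have gz y : L <= `|y| -> g y = 0.
  move=> Ly; apply/eqP; apply: contraTT Ly => gy; rewrite -ltNge.
  by rewrite (le_lt_trans _ KL)//; apply: gK; left.
have dgz y : L <= `|y| -> dg y = 0.
  move=> Ly; apply/eqP; apply: contraTT Ly => gy; rewrite -ltNge.
  by rewrite (le_lt_trans _ KL)//; apply: gK; right.
have -> : (\int[leb]_y (dg y)%:E = \int[leb]_(y in `[(- L)%R, L%R]) (dg y)%:E)%E.
  rewrite [RHS]integral_mkcond; apply: eq_integral => y _.
  rewrite /patch; case: ifPn => // ; rewrite notin_setE /= in_itv/= -ler_norml.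
  by move/negP; rewrite -ltNge => /ltW/dgz ->.
have gc : continuous g.
  by move=> y; apply: differentiable_continuous; apply/derivable1_diffP; case: (gd y).
rewrite (@continuous_FTC2 _ dg g); first by rewrite (gz L) ?(gz (- L)) ?normrN ?ger0_norm ?(ltW L0)// subee.
- by rewrite (lt_trans _ L0)// oppr_lt0.
- exact: continuous_subspaceT.
- split; first by move=> y _; case: (gd y).
  + by apply: cvg_at_right_filter; exact: gc.
  + by apply: cvg_at_left_filter; exact: gc.
- by move=> y _; rewrite derive1E; case: (gd y).
Qed.

Definition consrow m (y : R) (x : 'rV[R]_m) : 'rV[R]_m.+1 :=
  \row_k (if unlift ord0 k is Some j then x ord0 j else y).

Lemma rowt_cons m (y : R) (t : m.-tuple R) :
  rowt (tuple_cons (y, t)) = consrow y (rowt t).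
Proof.
apply/rowP => k; rewrite !mxE; case: unliftP => [j ->|->] //.
by rewrite mxE !(tnth_nth 0).
Qed.

Lemma continuous_consrow m :
  continuous (fun p : R * 'rV[R]_m => consrow p.1 p.2).
Proof.
move=> [y x]; apply/cvg_ballP => e e0.
have : \forall p \near (y, x), ball (y, x) e p by exact: nbhsx_ballx.
apply: filterS => -[y' x'] [/= hy hx]; split=> // i k; rewrite !mxE.
case: unliftP => [j _|_] //; case: hx => _; exact.
Qed.

Lemma continuous_consrowr m (y : R) : continuous (@consrow m y).
Proof.
move=> x; apply: (@continuous_comp _ _ _ (pair y) (fun p => consrow p.1 p.2)).
  by apply: (@cvg_pair _ _ _ (nbhs x) (nbhs y) (nbhs x)); [exact: cvg_cst|exact: cvg_id].
exact: continuous_consrow.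
Qed.

Lemma continuous_consrowl m (x : 'rV[R]_m) : continuous (fun y => consrow y x).
Proof.
move=> y; apply: (@continuous_comp _ _ _ (fun y => (y, x)) (fun p => consrow p.1 p.2)).
  by apply: (@cvg_pair _ _ _ (nbhs y) (nbhs y) (nbhs x)); [exact: cvg_id|exact: cvg_cst].
exact: continuous_consrow.
Qed.

Lemma compact_box_cons m (G : 'rV[R]_m.+1 -> R) (y : R) :
  compact_box G -> compact_box (fun x => G (consrow y x)).
Proof.
move=> [cG [K GK]]; split.
  by move=> x; apply: continuous_comp; [exact: continuous_consrowr|exact: cG].
by exists K => x /GK + j => /(_ (lift ord0 j)); rewrite mxE liftK.
Qed.

Lemma integrable_tuple_cons m (f : m.+1.-tuple (measurableTypeR R) -> \bar R) :
  (lebesgue_tuple m.+1).-integrable setT f ->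
  (leb \x lebesgue_tuple m)%E.-integrable setT (f \o tuple_cons).
Proof.
move=> /integrableP[mf foo]; apply/integrableP; split.
  by apply: measurableT_comp => //; exact: measurable_tuple_cons.
move: foo; have := @ge0_integral_pushforward _ _ _ _ R tuple_cons
  measurable_tuple_cons (leb \x lebesgue_tuple m)%E setT (abse \o f) measurableT.
rewrite preimage_setT => <- //; first exact: measurableT_comp.
by move=> ? _ /=.
Qed.

Lemma integral_tuple_cons m (f : m.+1.-tuple (measurableTypeR R) -> \bar R) :
  (lebesgue_tuple m.+1).-integrable setT f ->
  (\int[lebesgue_tuple m.+1]_t f t =
   \int[leb \x lebesgue_tuple m]_p f (tuple_cons p))%E.
Proof.
move=> fi; have /integrableP[mf _] := fi.
have := @integral_pushforward _ _ _ _ R tuple_cons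
  measurable_tuple_cons (leb \x lebesgue_tuple m)%E setT f mf.
rewrite preimage_setT; apply => //.
exact: integrable_tuple_cons.
Qed.

(** Induction on the dimension, splitting off the first coordinate by Fubini. If it is the direction
    of differentiation, it is integrated first and the fundamental theorem of calculus applies;
    otherwise the inner integral vanishes by induction. *)
Lemma integral_partial_eq0 m (i : 'I_m) (G dG : 'rV[R]_m -> R) :
  compact_box G -> compact_box dG ->
  (forall z, is_derive z (delta_mx ord0 i) G (dG z)) ->
  (\int[lebesgue_tuple m]_t (dG (rowt t))%:E = 0)%E.
Proof.
elim: m i G dG => [[//]|m IH] i G dG cG cdG Gd.
have dGi := compact_box_integrable cdG.
have pGi := integrable_tuple_cons dGi.
rewrite integral_tuple_cons//.
have [j ij|i0] := unliftP ord0 i; last first.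
  rewrite -integral21_prod_meas1// /fubini_G.
  rewrite (eq_integral (cst 0%E)) ?integral0// => t _ /=.
  have [[_ [K GK]] [cd [K' GK']]] := (cG, cdG).
  apply: (@integral_derive1_eq0 (fun y => G (consrow y (rowt t)))
           (fun y => dG (rowt (tuple_cons (y, t)))) (Num.max K K')).
  - move=> y; rewrite rowt_cons; apply: (is_derive_affine (g := fun y => consrow y (rowt t)) (v := delta_mx ord0 i)) => // h.
    apply/rowP => k; rewrite !mxE i0 eqxx/=; case: unliftP => [l ->|->].
      by rewrite -(inj_eq val_inj) /= mulr0 add0r.
    by rewrite eqxx.
  - move=> y; under eq_fun do rewrite rowt_cons.
    by apply: (@continuous_comp _ _ _ (fun y => consrow y (rowt t)) dG);
      [exact: continuous_consrowl|exact: cd].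
  - move=> y; rewrite le_max rowt_cons => -[/GK|/GK'] /(_ ord0);
      rewrite mxE unlift_none => ->//; exact: orbT.
rewrite -integral12_prod_meas1// /fubini_F.
rewrite (eq_integral (cst 0%E)) ?integral0// => y _ /=.
under eq_integral do rewrite rowt_cons.
apply: (IH j (fun x => G (consrow y x)) (fun x => dG (consrow y x))); try exact: compact_box_cons.
move=> z; apply: (is_derive_affine (v := delta_mx ord0 i)) => // h.
apply/rowP => k; rewrite !mxE ij eqxx /=; case: unliftP => [l ->|->].
  by rewrite !mxE eqxx/= (inj_eq lift_inj).
by rewrite (negbTE (neq_lift _ _)) mulr0 add0r.
Qed.

End integral_derivative.

(** * Integration over the half space *)

Section half_space_functions.
Context {R : realType} {n : nat}.
Implicit Types (F G : 'rV[R]_n * R -> R) (p : 'rV[R]_n * R).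
Local Notation leb := (@lebesgue_measure R).

(** The lower bound [K^-1] on the height keeps the support off the boundary, where negative powers
    of the height are singular. One constant serves for both variables. *)
Definition supported (K : R) F :=
  forall p, F p != 0 -> (forall i, `|p.1 ord0 i| <= K) /\ K^-1 <= p.2 <= K.

(** Continuity is asked inside the half space only, where quotients by powers of the height are
    continuous; F vanishes near every other point, so that continuity on R^N follows
    ([Cc_continuous]). *)
Definition Cc F := (exists2 K, 0 < K & supported K F) /\
  forall p, half_space p -> {for p, continuous F}.

Lemma supported_sub K F G : supported K F ->
  (forall p, G p != 0 -> F p != 0) -> supported K G.
Proof. by move=> hF GF p /GF/hF. Qed.

Lemma supported_near0 K F p : 0 < K -> supported K F ->
  ~ ((forall i, `|p.1 ord0 i| <= K) /\ K^-1 <= p.2 <= K) ->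
  \forall q \near p, F q = 0.
Proof.
move=> K0 hF hp.
have {}hp : (exists i, K < `|p.1 ord0 i|) \/ (p.2 < K^-1 \/ K < p.2).
  apply: contrapT => h; apply: hp; split.
    by move=> i; rewrite leNgt; apply/negP => Ki; apply: h; left; exists i.
  by rewrite !leNgt; apply/andP; split; apply/negP => ?; apply: h; right; [left|right].
have c2 : (fun q : 'rV[R]_n * R => q.2) @ p --> p.2 by exact: cvg_snd.
case: hp => [[i Ki]|[pK|Kp]].
- have ci : (fun q : 'rV[R]_n * R => `|q.1 ord0 i|) @ p --> `|p.1 ord0 i|.
    apply: cvg_norm; apply: (@continuous_comp _ _ _ fst (fun x : 'rV[R]_n => x ord0 i) p).
      exact: cvg_fst.
    exact: coord_continuous.
  near=> q; apply/eqP; apply: contraT => /hF[+ _] => /(_ i); rewrite leNgt.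
  suff -> : K < `|q.1 ord0 i| by [].
  by near: q; exact: (cvgr_gt _ ci).
- near=> q; apply/eqP; apply: contraT => /hF[_ /andP[+ _]]; rewrite leNgt.
  suff -> : q.2 < K^-1 by [].
  by near: q; exact: (cvgr_lt _ c2).
- near=> q; apply/eqP; apply: contraT => /hF[_ /andP[_]]; rewrite leNgt.
  suff -> : K < q.2 by [].
  by near: q; exact: (cvgr_gt _ c2).
Unshelve. all: by end_near. Qed.

Lemma supported_near0N K F p : 0 < K -> supported K F -> ~ half_space p ->
  \forall q \near p, F q = 0.
Proof.
move=> K0 hF /negP; rewrite -leNgt => p0; apply: supported_near0 hF _ => //.
move=> [_ /andP[Kp _]]; have := le_trans Kp p0.
by rewrite leNgt invr_gt0 K0.
Qed.

Lemma supported_partial K F i : 0 < K -> supported K F -> supported K (partial i F).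
Proof.
move=> K0 hF p Fp; apply: contrapT => hp; move: Fp => /negP; apply.
have : \forall q \near p, cst 0 q = F q.
  by apply: filterS (supported_near0 K0 hF hp) => q ->.
by move=> /near_eq_derive; rewrite /partial => <-; rewrite derive_cst.
Qed.

Lemma Cc_continuous F : Cc F -> continuous F.
Proof.
move=> [[K K0 hF] cF] p; have [/cF//|pN] := pselect (half_space p).
apply: (@near_cst_continuous _ _ (0 : R)).
exact: supported_near0N hF pN.
Qed.

Lemma Cc_sub F G : Cc F -> (forall p, G p != 0 -> F p != 0) ->
  (forall p, half_space p -> {for p, continuous G}) -> Cc G.
Proof. by move=> [[K K0 hF] _] GF cG; split=> //; exists K => //; exact: supported_sub hF GF. Qed.

(** The height is taken as the first coordinate, the one that [tuple_cons] splits off; the iterated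
    integral then has the order of [half_space_integral]. *)
Definition split_row (z : 'rV[R]_n.+1) : 'rV[R]_n * R :=
  (\row_j z ord0 (lift ord0 j), z ord0 ord0).

Lemma split_consrow y (x : 'rV[R]_n) : split_row (consrow y x) = (x, y).
Proof.
congr pair; last by rewrite mxE unlift_none.
by apply/rowP => j; rewrite !mxE liftK.
Qed.

Lemma continuous_split_row : continuous split_row.
Proof.
move=> z; apply: (@cvg_pair _ _ _ (nbhs z) (nbhs (split_row z).1) (nbhs (split_row z).2)).
  apply/cvg_ballP => e e0.
  have : \forall w \near z, ball z e w by exact: nbhsx_ballx.
  by apply: filterS => w [_ zw]; split=> // i j; rewrite !mxE; exact: zw.
exact: coord_continuous.
Qed.

Lemma Cc_compact_box F : Cc F -> compact_box (F \o split_row).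
Proof.
move=> cF; split.
  move=> z; apply: continuous_comp; first exact: continuous_split_row.
  exact: Cc_continuous.
have [[K K0 hF] _] := cF; exists K => z /hF[/= h1 /andP[Kz zK]] k.
have [j ->|->] := unliftP ord0 k; first by have := h1 j; rewrite mxE.
by rewrite ger0_norm// (le_trans _ Kz)// invr_ge0 ltW.
Qed.

(** Real valued on purpose: integrals of [Cc] functions are finite, and ordinary arithmetic applies
    to them. Only the integrals singular at the pole stay in the extended reals. *)
Definition hint F : R := Rintegral (lebesgue_tuple n.+1) setT
  (fun t => F (split_row (rowt t))).

Lemma Cc_integrable F : Cc F ->
  (lebesgue_tuple n.+1).-integrable setT (fun t => (F (split_row (rowt t)))%:E).
Proof. by move=> /Cc_compact_box/compact_box_integrable. Qed.

Lemma hint_iterated F : Cc F ->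
  (hint F)%:E = (\int[leb]_y \int[lebesgue_tuple n]_t (F (rowt t, y))%:E)%E.
Proof.
move=> cF; have Fi := Cc_integrable cF; rewrite fineK; last exact: integrable_fin_num.
have pFi := integrable_tuple_cons Fi.
rewrite integral_tuple_cons// -integral12_prod_meas1//.
apply: eq_integral => y _; apply: eq_integral => t _.
by rewrite rowt_cons split_consrow.
Qed.

Lemma half_space_integralE F : Cc F ->
  half_space_integral (fun x y => F (x, y)) = (hint F)%:E.
Proof.
move=> cF; rewrite hint_iterated// /half_space_integral [LHS]integral_mkcond.
apply: eq_integral => y _; rewrite /patch; case: ifPn => //.
rewrite notin_setE /= in_itv/= andbT => /negP; rewrite -leNgt => y0.
rewrite integral0_eq// => t _; congr EFin.
apply/eqP; apply: contraT; have [[K K0 hF] _] := cF => /hF[_ /= /andP[Ky _]].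
by have := le_trans Ky y0; rewrite leNgt invr_gt0 K0.
Qed.

Lemma hintD F G : Cc F -> Cc G -> hint (F \+ G) = hint F + hint G.
Proof. by move=> cF cG; rewrite /hint RintegralD//; exact: Cc_integrable. Qed.

Lemma hintZ (c : R) F : Cc F -> hint (fun p => c * F p) = c * hint F.
Proof. by move=> cF; rewrite /hint RintegralZl//; exact: Cc_integrable. Qed.

Lemma le_hint F G : Cc F -> Cc G -> (forall p, half_space p -> F p <= G p) ->
  hint F <= hint G.
Proof.
move=> cF cG FG; apply: le_Rintegral => //; [exact: Cc_integrable|exact: Cc_integrable|].
move=> t _; set p := split_row _.
have [/FG//|pN] := pselect (half_space p).
have [[[K K0 hF] _] [[L L0 hG] _]] := (cF, cG).
by rewrite (nbhs_singleton (supported_near0N K0 hF pN))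
  (nbhs_singleton (supported_near0N L0 hG pN)).
Qed.

Lemma hint_partial_eq0 i F dF : Cc F -> Cc dF ->
  (forall p, half_space p -> is_derive p (basis_dir i) F (dF p)) -> hint dF = 0.
Proof.
move=> cF cdF Fd; pose k := if i is Some j then lift ord0 j else ord0.
have Gd z : is_derive z (delta_mx ord0 k) (F \o split_row) ((dF \o split_row) z).
  apply: (is_derive_affine (v := basis_dir i)).
    move=> h; rewrite /split_row /basis_dir /k; case: (i) => [j|]; congr pair;
      try (apply/rowP => l); by rewrite !mxE ?eqxx/= ?(inj_eq lift_inj).
  have [/Fd//|pN] := pselect (half_space (split_row z)).
  have [[[K K0 hF] _] [[L L0 hdF] _]] := (cF, cdF).
  rewrite /= (nbhs_singleton (supported_near0N L0 hdF pN)).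
  apply: (@near_eq_is_derive _ _ _ (cst 0)).
  by apply: filterS (supported_near0N K0 hF pN) => q ->.
by rewrite /hint /Rintegral (integral_partial_eq0 (Cc_compact_box cF) (Cc_compact_box cdF) Gd).
Qed.

End half_space_functions.

(** * Comparison with boxes, monotone convergence *)

Section half_space_estimates.
Context {R : realType} {n : nat}.
Implicit Types (F : 'rV[R]_n * R -> R).
Local Notation leb := (@lebesgue_measure R).

(** The model for both box estimates: a function of y alone, cut off to a box, has an integral that
    is the volume in x times an increment of a primitive. *)
Let step_integral (p q a b : R) (g G : R -> R) : p <= q -> a < b ->
  (forall y, a <= y <= b -> is_derive y 1 G (g y) /\ {for y, continuous g}) ->
  let s := fun y => (\int[lebesgue_tuple n]_t
    (if `[< (forall i, (p <= tnth t i <= q)%R) /\ (a <= y <= b)%R >] then g y else 0%R)%:E)%E in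
  leb.-integrable setT s /\
  (\int[leb]_y s y = ((q - p) ^+ n * (G b - G a))%:E)%E /\
  forall y, (lebesgue_tuple n).-integrable setT (fun t =>
    (if `[< (forall i, (p <= tnth t i <= q)%R) /\ (a <= y <= b)%R >] then g y else 0%R)%:E).
Proof.
move=> pq ab gG; pose B := [set t : n.-tuple R | forall i, p <= tnth t i <= q].
have mB : measurable B by exact: measurable_tuple_box.
have BE : lebesgue_tuple n B = ((q - p) ^+ n)%:E by exact: lebesgue_tuple_box.
have iB : (lebesgue_tuple n).-integrable setT (EFin \o \1_B).
  by apply: integrable_indic_lty => //; rewrite [X in (X < _)%E]BE ltry.
have E y (t : n.-tuple R) : (if `[< (forall i, p <= tnth t i <= q) /\ a <= y <= b >] then g y else 0)%:E =
    (((g \_ `[a, b]) y)%:E * (EFin \o \1_B) t)%E.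
  rewrite /= /patch indicE -EFinM; congr EFin.
  have -> : (t \in B) = `[< forall i, p <= tnth t i <= q >].
    by apply/idP/asboolP; rewrite inE.
  have -> : (y \in [set` `[a, b]]) = (a <= y <= b) by rewrite mem_setE in_itv.
  rewrite asbool_and; case: asboolP => /=; rewrite ?mulr0 ?mulr1//.
  by rewrite asboolb; case: ifP.
have iy y : (lebesgue_tuple n).-integrable setT (fun t =>
    (if `[< (forall i, p <= tnth t i <= q) /\ a <= y <= b >] then g y else 0)%:E).
  by under eq_fun do rewrite E; exact: integrableZl.
have sE y : (\int[lebesgue_tuple n]_t
    (if `[< (forall i, (p <= tnth t i <= q)%R) /\ (a <= y <= b)%R >] then g y else 0%R)%:E)%E =
    (((q - p) ^+ n)%:E * (EFin \o (g \_ `[a, b])) y)%E.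
  under eq_integral do rewrite E.
  by rewrite integralZl// integral_indic// setIT [X in (_ * X)%E]BE muleC.
have gc : {within `[a, b], continuous g}.
  by apply: continuous_in_subspaceT => y; rewrite inE/= in_itv/= => /gG[].
have gi : leb.-integrable setT (EFin \o (g \_ `[a, b])).
  rewrite -restrict_EFin -integrable_mkcond//.
  by apply: continuous_compact_integrable => //; exact: segment_compact.
have Gc y : a <= y <= b -> {for y, continuous G}.
  by move=> /gG[[? _] _]; apply: differentiable_continuous; exact/derivable1_diffP.
move=> s; split; first by rewrite /s; under eq_fun do rewrite sE; exact: integrableZl.
split=> //; rewrite /s; under eq_integral do rewrite sE.
rewrite integralZl// EFinM; congr (_ * _)%E.
under eq_integral do rewrite -restrict_EFin.
rewrite -integral_mkcond (@continuous_FTC2 _ g G)//.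
- split.
  + by move=> y; rewrite in_itv/= => /andP[/ltW ay /ltW yb]; case: (gG y) => [|[]//]; rewrite ay.
  + by apply: cvg_at_right_filter; apply: Gc; rewrite lexx ltW.
  + by apply: cvg_at_left_filter; apply: Gc; rewrite lexx ltW.
- move=> y; rewrite in_itv/= => /andP[/ltW ay /ltW yb]; rewrite derive1E.
  by case: (gG y) => [|[]//]; rewrite ay.
Qed.

Let integrable_slice F y : Cc F ->
  (lebesgue_tuple n).-integrable setT (fun t => (F (rowt t, y))%:E).
Proof.
move=> /Cc_compact_box/compact_box_cons => /(_ y)/compact_box_integrable.
by apply: eq_integrable => // t _; rewrite /= split_consrow.
Qed.

Let integrable_iterated F : Cc F ->
  leb.-integrable setT (fun y => (\int[lebesgue_tuple n]_t (F (rowt t, y))%:E)%E).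
Proof.
move=> cF; have := integrable_fubini_F (integrable_tuple_cons (Cc_integrable cF)).
apply: eq_integrable => // y _; apply: eq_integral => t _.
by rewrite /= rowt_cons split_consrow.
Qed.

Lemma hint_le_box F (p q a b : R) (g G : R -> R) : Cc F -> p <= q -> a < b ->
  (forall y, a <= y <= b -> is_derive y 1 G (g y) /\ {for y, continuous g}) ->
  (forall (x : 'rV_n) y, F (x, y) <=
    if `[< (forall i, p <= x ord0 i <= q) /\ a <= y <= b >] then g y else 0) ->
  hint F <= (q - p) ^+ n * (G b - G a).
Proof.
move=> cF pq ab gG Fg; have [si [sE iy]] := step_integral pq ab gG.
rewrite -lee_fin hint_iterated// -sE; apply: le_integral => //.
  exact: integrable_iterated.
move=> y _; apply: le_integral => //; first exact: integrable_slice.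
move=> t _; rewrite lee_fin (le_trans (Fg _ _))//.
rewrite (_ : (forall i, p <= rowt t ord0 i <= q) = (forall i, p <= tnth t i <= q))//.
by apply/propext; split=> h i; have := h i; rewrite mxE.
Qed.

Lemma hint_ge_box F (p q a b : R) (g G : R -> R) : Cc F -> p <= q -> a < b ->
  (forall y, a <= y <= b -> is_derive y 1 G (g y) /\ {for y, continuous g}) ->
  (forall (x : 'rV_n) y,
    (if `[< (forall i, p <= x ord0 i <= q) /\ a <= y <= b >] then g y else 0) <= F (x, y)) ->
  (q - p) ^+ n * (G b - G a) <= hint F.
Proof.
move=> cF pq ab gG Fg; have [si [sE iy]] := step_integral pq ab gG.
rewrite -lee_fin hint_iterated// -sE; apply: le_integral => //.
  exact: integrable_iterated.
move=> y _; apply: le_integral => //; first exact: integrable_slice.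
move=> t _; rewrite lee_fin (le_trans _ (Fg _ _))//.
rewrite (_ : (forall i, p <= rowt t ord0 i <= q) = (forall i, p <= tnth t i <= q))//.
by apply/propext; split=> h i; have := h i; rewrite mxE.
Qed.

(** Monotone convergence is applied in x for fixed y, then in y. The limit may be discontinuous and
    its integral infinite, which is the situation of the weights d^-2 and d^-4. *)
Lemma hint_monotone_cvg (u : nat -> 'rV[R]_n * R -> R) (f : 'rV[R]_n -> R -> R) :
  (forall k, Cc (u k)) -> (forall k p, 0 <= u k p) ->
  (forall p, {homo u^~ p : k l / (k <= l)%N >-> k <= l}) ->
  (forall x y, 0 < y -> u k (x, y) @[k --> \oo] --> f x y) ->
  (hint (u k))%:E @[k --> \oo] --> half_space_integral f.
Proof.
move=> cu u0 und uf.
rewrite (_ : (fun k => (hint (u k))%:E) = fun k => half_space_integral (fun x y => u k (x, y))); last first.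
  by apply/funext => k; rewrite half_space_integralE.
pose h k y := (\int[lebesgue_tuple n]_t (u k (rowt t, y))%:E)%E.
have mu_ k y : measurable_fun [set: n.-tuple (measurableTypeR R)] (fun t => (u k (rowt t, y))%:E).
  exact: measurable_int (integrable_slice y (cu k)).
have und' y t : {homo (fun k => (u k (rowt t, y))%:E) : k l / (k <= l)%N >-> (k <= l)%E}.
  by move=> k l kl; rewrite lee_fin; exact: und.
have hc y : 0 < y -> h k y @[k --> \oo] --> (\int[lebesgue_tuple n]_t (f (rowt t) y)%:E)%E.
  move=> y0; have E t : (f (rowt t) y)%:E = limn (fun k => (u k (rowt t, y))%:E).
    by apply/esym/cvg_lim => //; apply: cvg_EFin; [exact: nearW|exact: uf].
  under eq_integral do rewrite E.
  apply: cvg_monotone_convergence => //.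
  by move=> k t _; rewrite lee_fin.
rewrite /half_space_integral.
rewrite [X in _ --> X](_ : _ = (\int[leb]_(y in `]0%R, +oo[) limn (h^~ y))%E); last first.
  apply: eq_integral => y; rewrite inE/= in_itv/= andbT => y0.
  by apply/esym/cvg_lim => //; exact: hc.
apply: cvg_monotone_convergence => //.
- by move=> k; apply: measurable_funTS; exact: measurable_int (integrable_iterated (cu k)).
- by move=> k y _; apply: integral_ge0 => t _; rewrite lee_fin.
- move=> y _ k l kl; apply: ge0_le_integral => //.
  - by move=> t _; rewrite lee_fin; exact: u0.
  - by move=> t _; rewrite lee_fin; exact: (und (rowt t, y)).
Qed.

End half_space_estimates.

(** * Calculus in finitely many directions *)

Section directional_derivatives.
Context {R : realType} {V : normedModType R}.
Implicit Types (f g : V -> R) (p v : V).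

Lemma is_derive_add f g p v (a b : R) : is_derive p v f a -> is_derive p v g b ->
  is_derive p v (fun q => f q + g q) (a + b).
Proof. by move=> fa gb; exact: is_deriveD. Qed.

Lemma is_derive_sub f g p v (a b : R) : is_derive p v f a -> is_derive p v g b ->
  is_derive p v (fun q => f q - g q) (a - b).
Proof. by move=> fa gb; exact: is_deriveB. Qed.

Lemma is_derive_opp f p v (a : R) : is_derive p v f a ->
  is_derive p v (fun q => - f q) (- a).
Proof. by move=> fa; exact: is_deriveN. Qed.

Lemma is_derive_mul f g p v (a b : R) : is_derive p v f a -> is_derive p v g b ->
  is_derive p v (fun q => f q * g q) (a * g p + f p * b).
Proof.
move=> fa gb; apply: (is_derive_eq (@is_deriveM R V f g p v a b fa gb)).
by rewrite addrC /GRing.scale/= [g p * a]mulrC.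
Qed.

Lemma is_derive_exp f p v (a : R) m : is_derive p v f a ->
  is_derive p v (fun q => f q ^+ m) (m%:R * f p ^+ m.-1 * a).
Proof.
move=> fa; have := @is_deriveX R V f m p v a fa.
by rewrite (_ : (fun q => f q ^+ m) = f ^+ m)//; apply/funext => q; rewrite fctE.
Qed.

Lemma is_derive_inv f p v (a : R) : f p != 0 -> is_derive p v f a ->
  is_derive p v (fun q => (f q)^-1) (- a / f p ^+ 2).
Proof.
move=> f0 [fa <-]; split; first exact: derivableV.
by rewrite deriveV// /GRing.scale/= mulrC mulrN mulNr.
Qed.

Lemma is_derive_const p v (a : R) : is_derive p v (fun=> a) 0.
Proof. exact: is_derive_cst. Qed.

Lemma is_derive_bigsum (I : finType) (f : I -> V -> R) p v (a : I -> R) :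
  (forall i, is_derive p v (f i) (a i)) ->
  is_derive p v (fun q => \sum_i f i q) (\sum_i a i).
Proof.
move=> fa; rewrite -[X in is_derive _ _ X](_ : \sum_i f i = _); last first.
  by apply/funext => q; rewrite fct_sumE.
elim/big_ind2: _ => [|? ? ? ? h1 h2|//]; first exact: is_derive_cst.
exact: is_deriveD.
Qed.

(** Only a directional derivative of [f] is available, so the composition is restricted to the line
    [l] through p with direction v, where the one-dimensional chain rule applies. *)
Lemma is_derive_chain (phi : R -> R) f p v (a b : R) :
  is_derive (f p) 1 phi a -> is_derive p v f b ->
  is_derive p v (fun q => phi (f q)) (a * b).
Proof.
move=> phia fb; pose l (h : R) := h *: v + p.
have l0 : l 0 = p by rewrite /l scale0r add0r.
have lb : is_derive (0 : R) 1 (f \o l) b.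
  apply: (is_derive_affine (v := v)); last by rewrite l0.
  by move=> h; rewrite l0 /l addr0 [h *: 1]mulr1.
have : is_derive (0 : R) 1 (phi \o (f \o l)) (a * b).
  by apply: is_derive1_comp => //; rewrite /= l0.
move=> [dpl plE].
have E : (fun h : R => h^-1 *: (((phi \o (f \o l)) \o shift 0) (h *: 1) - (phi \o (f \o l)) 0)) =
    (fun h => h^-1 *: (((fun q => phi (f q)) \o shift p) (h *: v) - phi (f p))).
  by apply/funext => h /=; rewrite l0 /l addr0 [h *: 1]mulr1.
split; first by move: dpl; rewrite /derivable E.
by rewrite -plE [RHS]/derive E.
Qed.

End directional_derivatives.

(** * Functions of class C^k on a set *)

Section Ck_on.
Context {R : realType} {V : normedModType R} {I : Type}.
Variable dir : I -> V.
Implicit Types (f g : V -> R) (U : set V).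

(** The local form of [Ck]: powers of the height are smooth in the half space only, the calibrating
    field off the pole only. The directions are a parameter, so that functions of one real variable,
    with the single direction 1, fall under the same lemmas. *)
Fixpoint Ck_on (k : nat) U f : Prop :=
  match k with
  | 0 => forall p, U p -> {for p, continuous f}
  | k'.+1 => (forall p, U p -> {for p, continuous f}) /\
      forall i, (forall p, U p -> derivable f p (dir i)) /\
        Ck_on k' U (fun p => 'D_(dir i) f p)
  end.

Lemma Ck_on_continuous k U f p : Ck_on k U f -> U p -> {for p, continuous f}.
Proof. by case: k => [|k]; [move=> /[apply]|move=> [+ _] => /[apply]]. Qed.

Lemma Ck_on_pred k U f : Ck_on k.+1 U f -> Ck_on k U f.
Proof.
elim: k f => [f [] //|k IH f [cf df]]; split=> // i; split; first exact: (df i).1.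
by apply: IH; exact: (df i).2.
Qed.

Lemma Ck_on_is_derive k U f i p : Ck_on k.+1 U f -> U p ->
  is_derive p (dir i) f ('D_(dir i) f p).
Proof. by move=> [_ /(_ i)[df _]] /df Up; split. Qed.

Lemma Ck_on_derive k U f i : Ck_on k.+1 U f -> Ck_on k U (fun p => 'D_(dir i) f p).
Proof. by move=> [_ /(_ i)[]]. Qed.

Lemma Ck_on_subset k U W f : W `<=` U -> Ck_on k U f -> Ck_on k W f.
Proof.
move=> WU; elim: k f => [f cf p /WU/cf//|k IH f [cf df]].
split=> [p /WU/cf//|i]; split=> [p /WU|]; first exact: (df i).1.
exact/IH/(df i).2.
Qed.

Lemma Ck_on_union k U W f : Ck_on k U f -> Ck_on k W f -> Ck_on k (U `|` W) f.
Proof.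
elim: k f => [f cU cW p []|k IH f [cU dU] [cW dW]]; [exact: cU|exact: cW|].
split=> [p []|i]; [exact: cU|exact: cW|].
split=> [p []|]; [exact: (dU i).1|exact: (dW i).1|].
by apply: IH; [exact: (dU i).2|exact: (dW i).2].
Qed.

Lemma Ck_on_eq k U f g : open U -> (forall p, U p -> f p = g p) ->
  Ck_on k U f -> Ck_on k U g.
Proof.
move=> oU; elim: k f g => [|k IH] f g fg.
  move=> cf p Up; have nfg : \forall q \near p, f q = g q.
    by apply: filterS (open_nbhs_nbhs (conj oU Up)) => q; exact: fg.
  rewrite /continuous_at/prop_for -(fg _ Up).
  exact: cvg_trans (near_eq_cvg nfg) (cf _ Up).
have nfg p : U p -> \forall q \near p, f q = g q.
  by move=> Up; apply: filterS (open_nbhs_nbhs (conj oU Up)) => q; exact: fg.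
move=> [cf df]; split.
  move=> p Up; rewrite /continuous_at/prop_for -(fg _ Up).
  exact: cvg_trans (near_eq_cvg (nfg _ Up)) (cf _ Up).
move=> i; split.
  by move=> p Up; apply: near_eq_derivable (nfg _ Up) _; exact: (df i).1.
apply: IH (df i).2 => p Up; exact: near_eq_derive (nfg _ Up).
Qed.

Lemma Ck_onS k U f (df : I -> V -> R) : open U ->
  (forall p, U p -> {for p, continuous f}) ->
  (forall i p, U p -> is_derive p (dir i) f (df i p)) ->
  (forall i, Ck_on k U (df i)) -> Ck_on k.+1 U f.
Proof.
move=> oU cf fd cdf; split=> // i; split; first by move=> p /(fd i)[].
by apply: Ck_on_eq (cdf i) => // p /(fd i)[_ ->].
Qed.

Lemma Ck_on_const k U (a : R) : open U -> Ck_on k U (fun=> a).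
Proof.
move=> oU; elim: k a => [|k IH] a; first by move=> p _; exact: cvg_cst.
apply: (@Ck_onS _ _ _ (fun _ => fun=> 0)) => // p _; exact: cvg_cst.
Qed.

Lemma Ck_on_add k U f g : open U -> Ck_on k U f -> Ck_on k U g ->
  Ck_on k U (fun p => f p + g p).
Proof.
move=> oU; elim: k f g => [|k IH] f g cf cg.
  by move=> p Up; apply: cvgD; [exact: cf|exact: cg].
apply: (@Ck_onS _ _ _ (fun i p => 'D_(dir i) f p + 'D_(dir i) g p)) => //.
- by move=> p Up; apply: cvgD; [exact: cf.1|exact: cg.1].
- by move=> i p Up; apply: is_derive_add; [exact: (Ck_on_is_derive i cf Up)|exact: (Ck_on_is_derive i cg Up)].
- by move=> i; apply: IH; exact: Ck_on_derive.
Qed.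

Lemma Ck_on_mul k U f g : open U -> Ck_on k U f -> Ck_on k U g ->
  Ck_on k U (fun p => f p * g p).
Proof.
move=> oU; elim: k f g => [|k IH] f g cf cg.
  by move=> p Up; apply: cvgM; [exact: cf|exact: cg].
apply: (@Ck_onS _ _ _ (fun i p => 'D_(dir i) f p * g p + f p * 'D_(dir i) g p)) => //.
- by move=> p Up; apply: cvgM; [exact: cf.1|exact: cg.1].
- by move=> i p Up; apply: is_derive_mul; [exact: (Ck_on_is_derive i cf Up)|exact: (Ck_on_is_derive i cg Up)].
- move=> i; apply: Ck_on_add => //; apply: IH; try exact: Ck_on_pred;
    exact: Ck_on_derive.
Qed.

Lemma Ck_on_exp k U f m : open U -> Ck_on k U f -> Ck_on k U (fun p => f p ^+ m).
Proof.
move=> oU cf; elim: m => [|m IH].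
  by under eq_fun do rewrite expr0; exact: Ck_on_const.
by under eq_fun do rewrite exprS; exact: Ck_on_mul.
Qed.

Lemma Ck_on_opp k U f : open U -> Ck_on k U f -> Ck_on k U (fun p => - f p).
Proof.
move=> oU cf; under eq_fun do rewrite -mulN1r.
by apply: Ck_on_mul => //; exact: Ck_on_const.
Qed.

Lemma Ck_on_sub k U f g : open U -> Ck_on k U f -> Ck_on k U g ->
  Ck_on k U (fun p => f p - g p).
Proof. by move=> oU cf cg; apply: Ck_on_add => //; exact: Ck_on_opp. Qed.

Lemma Ck_on_sum k U (J : finType) (f : J -> V -> R) : open U ->
  (forall j, Ck_on k U (f j)) -> Ck_on k U (fun p => \sum_j f j p).
Proof.
move=> oU cf; elim: (index_enum J) => [|j s IH].
  by under eq_fun do rewrite big_nil; exact: Ck_on_const.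
by under eq_fun do rewrite big_cons; exact: Ck_on_add.
Qed.

End Ck_on.


Section Ck_on_composition.
Context {R : realType} {V : normedModType R} {I : Type}.
Variable dir : I -> V.

Definition Ck1 (k : nat) (U : set R) (phi : R -> R) : Prop :=
  Ck_on (fun _ : unit => (1 : R)) k U phi.

Lemma Ck_on_comp k (U : set V) (W : set R) (phi : R -> R) (f : V -> R) :
  open U -> (forall p, U p -> W (f p)) ->
  Ck1 k W phi -> Ck_on dir k U f -> Ck_on dir k U (fun p => phi (f p)).
Proof.
move=> oU fW; elim: k phi => [|k IH] phi cphi cf.
  by move=> p Up; apply: continuous_comp; [exact: cf|exact/cphi/fW].
apply: (@Ck_onS _ _ _ _ _ _ _ (fun i p => 'D_1 phi (f p) * 'D_(dir i) f p)) => //.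
- by move=> p Up; apply: continuous_comp; [exact: cf.1|exact/cphi.1/fW].
- move=> i p Up; apply: is_derive_chain; last exact: (Ck_on_is_derive i cf Up).
  exact: (Ck_on_is_derive tt cphi (fW _ Up)).
- move=> i; apply: Ck_on_mul => //; last exact: Ck_on_derive.
  by apply: (IH (fun x => 'D_1 phi x)); [exact: (Ck_on_derive tt cphi)|exact: Ck_on_pred].
Qed.

End Ck_on_composition.

Section elementary_Ck.
Context {R : realType}.

Lemma Ck1_id k (U : set R) : open U -> Ck1 k U id.
Proof.
move=> oU; case: k => [|k]; first by move=> p _; exact: cvg_id.
apply: (@Ck_onS _ _ _ _ _ _ _ (fun _ => fun=> 1)) => //.
- by move=> p _; exact: cvg_id.
- by move=> i; exact: Ck_on_const.
Qed.

Lemma Ck1_inv k : Ck1 k [set x : R | 0 < x] (fun x => x^-1).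
Proof.
have o0 : open [set x : R | 0 < x] by exact: open_gt.
have c p : 0 < p -> {for p, continuous (fun x : R => x^-1)}.
  by move=> p0; apply: inv_continuous; rewrite gt_eqF.
elim: k => [|k IH]; first by move=> p /c.
apply: (@Ck_onS _ _ _ _ _ _ _ (fun _ (x : R) => - (x^-1 * x^-1))) => //.
- move=> i p p0; have := @is_derive_inv R R id p 1 1 (lt0r_neq0 p0) (is_derive_id _ _).
  by rewrite mulN1r expr2 invfM.
- by move=> i; apply: Ck_on_opp => //; apply: Ck_on_mul.
Qed.

Lemma Ck1_ln k : Ck1 k [set x : R | 0 < x] (@ln R).
Proof.
have o0 : open [set x : R | 0 < x] by exact: open_gt.
case: k => [|k]; first by move=> p; exact: continuous_ln.
apply: (@Ck_onS _ _ _ _ _ _ _ (fun _ (x : R) => x^-1)) => //.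
- by move=> p; exact: continuous_ln.
- by move=> i; exact: Ck1_inv.
Qed.

Lemma Ck1_expR k : Ck1 k setT (@expR R).
Proof.
elim: k => [|k IH]; first by move=> p _; exact: continuous_expR.
apply: (@Ck_onS _ _ _ _ _ _ _ (fun _ x => expR x)) => //; first exact: openT.
by move=> p _; exact: continuous_expR.
Qed.

End elementary_Ck.

(** * Smooth bumps *)

Section flat_functions.
Context {R : realType}.

(** The derivatives of exp(-1/x), extended by 0, are combinations of these functions; the family is
    stable under differentiation, which gives smoothness for all j at once. *)
Definition flat_pow (j : nat) (x : R) : R :=
  if 0 < x then (x^-1) ^+ j * expR (- x^-1) else 0.

Lemma flat_pow_ge0 j x : 0 <= flat_pow j x.
Proof.
rewrite /flat_pow; case: ifP => // x0.
by rewrite mulr_ge0 ?expR_ge0// exprn_ge0// invr_ge0 ltW.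
Qed.

(** The inequality u/m <= exp(u/m) raised to the power m. *)
Lemma expr_expRN_le (m : nat) (u : R) : (0 < m)%N -> 0 <= u ->
  u ^+ m * expR (- u) <= m%:R ^+ m.
Proof.
move=> m0 u0; have mR : 0 < m%:R :> R by rewrite ltr0n.
have h : (u / m%:R) ^+ m <= expR u.
  have -> : expR u = expR (u / m%:R) ^+ m.
    by rewrite -expRM_natl mulrC divfK// gt_eqF.
  rewrite lerXn2r ?nnegrE ?expR_ge0 ?divr_ge0//.
  by rewrite (le_trans _ (expR_ge1Dx _))// lerDr.
rewrite expRN ler_pdivrMr ?expR_gt0//.
by rewrite -ler_pdivrMl ?exprn_gt0// mulrC -expr_div_n.
Qed.

Lemma flat_pow_le j x : flat_pow j x <= j.+1%:R ^+ j.+1 * `|x|.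
Proof.
rewrite /flat_pow; case: ifP => [x0|_]; last by rewrite mulr_ge0.
rewrite (gtr0_norm x0) -ler_pdivrMr// mulrAC -exprSr.
by apply: expr_expRN_le => //; rewrite invr_ge0 ltW.
Qed.

Lemma is_derive_flat_pow j (x : R) :
  is_derive x 1 (flat_pow j) (flat_pow j.+2 x - j%:R * flat_pow j.+1 x).
Proof.
have [x0|x0|->] := ltgtP x 0.
- rewrite /flat_pow (lt_gtF x0) mulr0 subrr.
  apply: (@near_eq_is_derive _ _ _ (fun=> 0)).
  by near=> y; rewrite /flat_pow lt_gtF//; near: y; exact: lt_nbhsl.
- rewrite /flat_pow x0.
  apply: (@near_eq_is_derive _ _ _ (fun y : R => (y^-1) ^+ j * expR (- y^-1))).
    by near=> y; rewrite /flat_pow ifT//; near: y; exact: lt_nbhsr.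
  have dV := @is_derive_inv R R id x 1 1 (lt0r_neq0 x0) (is_derive_id _ _).
  have dX := is_derive_exp j dV.
  have dE := @is_derive_chain R R expR _ x 1 _ _ (is_derive_expR _) (is_derive_opp dV).
  apply: (is_derive_eq (is_derive_mul dX dE)) => /=.
  case: j {dX} => [|j] /=; rewrite ?expr0 ?exprS; field; exact: lt0r_neq0.
- rewrite /flat_pow ltxx mulr0 subrr.
  have fE : flat_pow j 0 = 0 by rewrite /flat_pow ltxx.
  suff h : h^-1 *: ((flat_pow j \o shift 0) (h *: 1) - flat_pow j 0) @[h --> 0^'] --> (0 : R).
    by split; [apply/cvg_ex; exists 0|exact/cvg_lim].
  (* For h > 0 the difference quotient at 0 is [flat_pow j.+1 h], and [flat_pow_le] bounds it by
     this constant times |h|. *)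
  pose C : R := j.+2%:R ^+ j.+2.
  apply: (@squeeze_cvgr _ _ _ _ (fun h => - (C * `|h|)) (fun h => C * `|h|)).
  + near=> h; rewrite /= addr0 fE subr0 [h *: 1]mulr1 -ler_norml.
    have hn0 : h != 0 by near: h; exact: nbhs_dnbhs_neq.
    rewrite /GRing.scale/= normrM normfV (ger0_norm (flat_pow_ge0 _ _)).
    have [h0|h0] := ltP 0 h; last first.
      by rewrite /flat_pow ltNge h0 mulr0 mulr_ge0// exprn_ge0.
    apply: le_trans (flat_pow_le j.+1 h).
    by rewrite (gtr0_norm h0) /flat_pow h0 exprS mulrA.
  + rewrite -[X in _ --> X]oppr0; apply: cvgN; rewrite -[X in _ --> X](mulr0 C).
    apply: cvgMr; rewrite -[X in _ --> X](@normr0 R R); apply: cvg_norm.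
    exact: cvg_within.
  + rewrite -[X in _ --> X](mulr0 C).
    apply: cvgMr; rewrite -[X in _ --> X](@normr0 R R); apply: cvg_norm.
    exact: cvg_within.
Unshelve. all: by end_near. Qed.

Lemma Ck1_flat_pow k j : Ck1 k setT (flat_pow j).
Proof.
have c i : continuous (flat_pow i).
  by move=> x; apply: differentiable_continuous; apply/derivable1_diffP;
    case: (is_derive_flat_pow i x).
elim: k j => [|k IH] j; first by move=> p _; exact: c.
apply: (@Ck_onS _ _ _ _ _ _ _
  (fun _ x => flat_pow j.+2 x - j%:R * flat_pow j.+1 x)).
- exact: openT.
- by move=> p _; exact: c.
- by move=> i p _; exact: is_derive_flat_pow.
- move=> i; apply: Ck_on_sub; [exact: openT|exact: IH|].
  by apply: Ck_on_mul; [exact: openT|exact/Ck_on_const/openT|exact: IH].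
Qed.

Definition flat := flat_pow 0.

Lemma flat_gt0 x : 0 < x -> 0 < flat x.
Proof. by move=> x0; rewrite /flat /flat_pow x0 expr0 mul1r expR_gt0. Qed.

Lemma flat_le0 x : x <= 0 -> flat x = 0.
Proof. by move=> x0; rewrite /flat /flat_pow ltNge x0. Qed.

Lemma flat_ge0 x : 0 <= flat x.
Proof. exact: flat_pow_ge0. Qed.

Lemma le_flat x y : x <= y -> flat x <= flat y.
Proof.
move=> xy; have [x0|x0] := ltP 0 x; last by rewrite (flat_le0 x0) flat_ge0.
have y0 := lt_le_trans x0 xy; rewrite /flat /flat_pow x0 y0 !expr0 !mul1r.
by rewrite ler_expR lerN2 lef_pV2.
Qed.

Lemma Ck1_flat_onem k : Ck1 k setT (fun x => flat (1 - x)).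
Proof.
apply: (@Ck_on_comp _ _ _ _ _ setT setT) => //; first exact: openT.
  exact: Ck1_flat_pow.
by apply: Ck_on_sub; [exact: openT|exact/Ck_on_const/openT|exact/Ck1_id/openT].
Qed.

Definition flat_bump x := flat x * flat (1 - x).

Lemma Ck1_bump k : Ck1 k setT flat_bump.
Proof. by apply: Ck_on_mul; [exact: openT|exact: Ck1_flat_pow|exact: Ck1_flat_onem]. Qed.

Lemma bump_neq0 x : flat_bump x != 0 -> 0 < x < 1.
Proof.
apply: contraR; rewrite negb_and -!leNgt => /orP[x0|x1]; rewrite /flat_bump.
  by rewrite flat_le0// mul0r.
by rewrite [X in _ * X]flat_le0 ?mulr0// subr_le0.
Qed.

Lemma bump_ge a b x : a <= x <= b -> flat a * flat (1 - b) <= flat_bump x.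
Proof.
move=> /andP[ax xb]; apply: ler_pM; rewrite ?flat_ge0//; apply: le_flat => //.
by rewrite lerD2l lerN2.
Qed.

Definition plateau x := flat x / (flat x + flat (1 - x)).

Lemma plateau_denom_gt0 x : 0 < flat x + flat (1 - x).
Proof.
have [x0|x0] := ltP 0 x; first by rewrite ltr_pwDl ?flat_gt0 ?flat_ge0.
by rewrite ltr_wpDl ?flat_ge0// flat_gt0// subr_gt0 (le_lt_trans x0).
Qed.

Lemma Ck1_plateau k : Ck1 k setT plateau.
Proof.
apply: Ck_on_mul; [exact: openT|exact: Ck1_flat_pow|].
apply: (@Ck_on_comp _ _ _ _ _ setT [set x | 0 < x]); first exact: openT.
- by move=> x _; exact: plateau_denom_gt0.
- exact: Ck1_inv.
- by apply: Ck_on_add; [exact: openT|exact: Ck1_flat_pow|exact: Ck1_flat_onem].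
Qed.

Lemma plateau_le0 x : x <= 0 -> plateau x = 0.
Proof. by move=> x0; rewrite /plateau flat_le0// mul0r. Qed.

Lemma plateau_ge1 x : 1 <= x -> plateau x = 1.
Proof.
move=> x1; rewrite /plateau [flat (1 - x)]flat_le0 ?subr_le0// addr0 divff//.
by rewrite lt0r_neq0// flat_gt0// (lt_le_trans _ x1).
Qed.

Lemma plateau_ge0 x : 0 <= plateau x.
Proof. by rewrite divr_ge0 ?flat_ge0// ltW// plateau_denom_gt0. Qed.

Lemma le_plateau x y : x <= y -> plateau x <= plateau y.
Proof.
move=> xy; rewrite ler_pdivrMr ?plateau_denom_gt0// mulrAC ler_pdivlMr ?plateau_denom_gt0//.
rewrite !mulrDr [flat x * flat y]mulrC lerD2l ler_pM ?flat_ge0// le_flat//.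
by rewrite lerD2l lerN2.
Qed.

Lemma plateau_le1 x : plateau x <= 1.
Proof. by rewrite ler_pdivrMr ?plateau_denom_gt0// mul1r lerDl flat_ge0. Qed.

End flat_functions.

(** * Hyperbolic distance *)

Lemma big_option (R : Type) (idx : R) (op : Monoid.com_law idx) (I : finType)
    (F : option I -> R) :
  \big[op/idx]_i F i = op (F None) (\big[op/idx]_j F (Some j)).
Proof.
rewrite (bigD1 None)//=; congr (op _ _).
rewrite (reindex_omap Some id)//=; last by case.
by apply: eq_bigl => j; rewrite eqxx.
Qed.

Section half_space_coordinates.
Context {R : realType} {n : nat}.
Implicit Types (p : 'rV[R]_n * R) (U : set ('rV[R]_n * R)).
Local Notation dir := (@basis_dir R n).

Lemma open_half_space : open (@half_space R n).
Proof.
rewrite (_ : half_space = snd @^-1` [set y : R | 0 < y])//.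
by apply: open_comp => [p _|]; [exact: cvg_snd|exact: open_gt].
Qed.

Lemma is_derive_snd p i : is_derive p (dir i) snd (i == None)%:R.
Proof.
apply: (@is_derive_affine R _ R R id snd p (dir i) (i == None)%:R).
by move=> h; rewrite /=; case: i.
Qed.

Lemma is_derive_coord p i (j : 'I_n) :
  is_derive p (dir i) (fun q => q.1 ord0 j) (i == Some j)%:R.
Proof.
apply: (@is_derive_affine R _ R R id (fun q : 'rV[R]_n * R => q.1 ord0 j) p (dir i) (i == Some j)%:R).
move=> h; rewrite /= !mxE; case: i => [k|] /=; rewrite ?mxE//=.
by rewrite eq_sym.
Qed.

Lemma continuous_coord (j : 'I_n) : continuous (fun q : 'rV[R]_n * R => q.1 ord0 j).
Proof.
move=> q; apply: (@continuous_comp _ _ _ fst (fun x : 'rV[R]_n => x ord0 j) q).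
  exact: cvg_fst.
exact: coord_continuous.
Qed.

Lemma Ck_on_snd k U : open U -> Ck_on dir k U snd.
Proof.
move=> oU; case: k => [|k]; first by move=> p _; exact: cvg_snd.
apply: (@Ck_onS _ _ _ _ _ _ _ (fun i => fun=> (i == None)%:R)).
- exact: oU.
- by move=> p _; exact: cvg_snd.
- by move=> i p _; exact: is_derive_snd.
- by move=> i; exact: Ck_on_const.
Qed.

Lemma Ck_on_coord k U j : open U -> Ck_on dir k U (fun q => q.1 ord0 j).
Proof.
move=> oU; case: k => [|k]; first by move=> p _; exact: continuous_coord.
apply: (@Ck_onS _ _ _ _ _ _ _ (fun i => fun=> (i == Some j)%:R)) => //.
- by move=> p _; exact: continuous_coord.
- by move=> i p _; exact: is_derive_coord.
- by move=> i; exact: Ck_on_const.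
Qed.

Lemma Ck_on_sndV k : Ck_on dir k half_space (fun q => q.2^-1).
Proof.
apply: (@Ck_on_comp _ _ _ _ _ half_space [set x | 0 < x] (fun x => x^-1) snd).
- exact: open_half_space.
- by [].
- exact: Ck1_inv.
- exact/Ck_on_snd/open_half_space.
Qed.

Lemma is_derive_sndV p i : half_space p ->
  is_derive p (dir i) (fun q => q.2^-1) (- (i == None)%:R / p.2 ^+ 2).
Proof. by move=> p0; apply: is_derive_inv; [rewrite gt_eqF|exact: is_derive_snd]. Qed.

Definition norm2 p : R := \sum_j p.1 ord0 j ^+ 2.

Lemma norm2_ge0 p : 0 <= norm2 p.
Proof. by apply: sumr_ge0 => j _; exact: sqr_ge0. Qed.

Lemma is_derive_norm2 p i : is_derive p (dir i) norm2
  (if i is Some j then 2 * p.1 ord0 j else 0).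
Proof.
apply: (is_derive_eq (is_derive_bigsum (fun j => is_derive_exp 2 (is_derive_coord p i j)))).
case: i => [j|] /=.
  rewrite (bigD1 j)//= eqxx mulr1 expr1 big1 ?addr0// => k kj.
  by rewrite (inj_eq Some_inj) eq_sym (negbTE kj) mulr0.
by rewrite big1// => k _; rewrite mulr0.
Qed.

Lemma Ck_on_norm2 k U : open U -> Ck_on dir k U norm2.
Proof.
by move=> oU; apply: Ck_on_sum => // j; apply: Ck_on_exp => //; exact: Ck_on_coord.
Qed.

(* The hyperbolic cosine of the distance to (0, 1). *)
Definition cdist p : R := (1 + norm2 p + p.2 ^+ 2) / (2 * p.2).

Definition dcdist i p : R :=
  if i is Some j then p.1 ord0 j / p.2 else 1 - cdist p / p.2.

Lemma is_derive_cdist p i : half_space p -> is_derive p (dir i) cdist (dcdist i p).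
Proof.
rewrite /half_space/= => p0.
have p20 : p.2 != 0 by rewrite gt_eqF.
have dn := is_derive_norm2 p i.
have dy := is_derive_snd p i.
have dN := is_derive_add (is_derive_add (is_derive_const p (dir i) (1 : R)) dn) (is_derive_exp 2 dy).
have dD := is_derive_mul (is_derive_const p (dir i) (2 : R)) dy.
have D0 : 2 * p.2 != 0 by rewrite mulf_neq0// pnatr_eq0.
apply: (is_derive_eq (is_derive_mul dN (is_derive_inv (f := fun q : 'rV_n * R => 2 * q.2) D0 dD))).
rewrite /dcdist /cdist; case: i {dn dy dN dD} => [j|] /=; field.
all: rewrite ?p20 ?pnatr_eq0//.
Qed.

Lemma Ck_on_cdist k : Ck_on dir k half_space cdist.
Proof.
have o := open_half_space.
apply: (@Ck_on_eq _ _ _ _ _ _ (fun p => (1 + norm2 p + p.2 ^+ 2) * (2^-1 * p.2^-1))) => //.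
  by move=> p _; rewrite /cdist invfM.
apply: Ck_on_mul => //.
  apply: Ck_on_add => //; last by apply: Ck_on_exp => //; exact: Ck_on_snd.
  by apply: Ck_on_add => //; [exact: Ck_on_const|exact: Ck_on_norm2].
by apply: Ck_on_mul => //; [exact: Ck_on_const|exact: Ck_on_sndV].
Qed.

Definition ddcdist (i : option 'I_n) p : R :=
  if i is Some _ then p.2^-1 else (2 * cdist p - p.2) / p.2 ^+ 2.

Lemma is_derive_dcdist p i : half_space p ->
  is_derive p (dir i) (dcdist i) (ddcdist i p).
Proof.
rewrite /half_space/= => p0.
have p20 : p.2 != 0 by rewrite gt_eqF.
have dV := is_derive_sndV i p0.
case: i dV => [j|] dV.
  apply: (is_derive_eq (is_derive_mul (is_derive_coord p (Some j) j) dV)).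
  by rewrite /= eqxx oppr0 !mul0r mulr0 addr0 mul1r.
apply: (is_derive_eq (is_derive_sub (is_derive_const p (dir None) (1 : R))
  (is_derive_mul (is_derive_cdist None p0) dV))).
by rewrite /ddcdist /dcdist eqxx /=; field.
Qed.

Lemma Ck_on_dcdist k i : Ck_on dir k half_space (dcdist i).
Proof.
have o := open_half_space.
case: i => [j|].
  by apply: Ck_on_mul => //; [exact: Ck_on_coord|exact: Ck_on_sndV].
apply: Ck_on_sub => //; first exact: Ck_on_const.
by apply: Ck_on_mul => //; [exact: Ck_on_cdist|exact: Ck_on_sndV].
Qed.

(** The Laplacian of c, the square of its gradient ([sum_dcdist_sq]) and the vertical derivative 1 -
    c/y are all the geometry that enters the calibration. *)
Lemma sum_ddcdist p : half_space p ->
  \sum_i ddcdist i p = (n%:R - 1) / p.2 + 2 * cdist p / p.2 ^+ 2.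
Proof.
rewrite /half_space/= => p0; have p20 : p.2 != 0 by rewrite gt_eqF.
rewrite big_option /= sumr_const card_ord -[_ *+ n]mulr_natr.
by field.
Qed.

Lemma sum_dcdist_sq p : half_space p ->
  \sum_i dcdist i p ^+ 2 = (cdist p ^+ 2 - 1) / p.2 ^+ 2.
Proof.
rewrite /half_space/= => p0; have p20 : p.2 != 0 by rewrite gt_eqF.
rewrite big_option /=.
have -> : \sum_j (p.1 ord0 j / p.2) ^+ 2 = norm2 p / p.2 ^+ 2.
  by rewrite /norm2 mulr_suml; apply: eq_bigr => j _; rewrite expr_div_n.
by rewrite /cdist; field; rewrite p20 ?pnatr_eq0.
Qed.

Lemma cdist_sub1 p : half_space p ->
  cdist p - 1 = (norm2 p + (p.2 - 1) ^+ 2) / (2 * p.2).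
Proof.
rewrite /half_space/= => p0; have p20 : p.2 != 0 by rewrite gt_eqF.
by rewrite /cdist; field; rewrite p20 ?pnatr_eq0.
Qed.

Lemma cdist_ge1 p : half_space p -> 1 <= cdist p.
Proof.
move=> p0; rewrite -subr_ge0 cdist_sub1// divr_ge0//.
  by rewrite addr_ge0 ?norm2_ge0 ?sqr_ge0.
by rewrite mulr_ge0// ltW.
Qed.

Lemma hyp_distE (x : 'rV[R]_n) (y : R) : 0 < y ->
  hyp_dist x y = arcosh (cdist (x, y)).
Proof.
move=> y0; rewrite /hyp_dist gtr0_norm//; congr arcosh.
rewrite -[in RHS](subrK 1 (cdist _)) cdist_sub1// addrC /norm2 /=.
by congr (_ / _ + _); rewrite addrC.
Qed.

Definition Ckc (k : nat) (v : 'rV[R]_n * R -> R) :=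
  (exists2 K, 0 < K & supported K v) /\ Ck_on dir k half_space v.

Lemma CkP k (v : 'rV[R]_n * R -> R) : Ck k v <-> Ck_on dir k setT v.
Proof.
elim: k v => [|k IH] v /=; first by split=> [cv p _|cv p]; exact: cv.
split=> [] [cv dv].
  split=> [p _|i]; first exact: cv.
  by split=> [p _|]; [exact: (dv i).1|exact/IH/(dv i).2].
split=> [p|i]; first exact: cv.
by split=> [p|]; [exact: (dv i).1|exact/IH/(dv i).2].
Qed.

(** Compactness of the support bounds the coordinates and, through the minimum of the height on it,
    keeps it away from the boundary. *)
Lemma test_function_Ckc (v : 'rV[R]_n * R -> R) k : test_function v -> Ckc k v.
Proof.
move=> [Cv cpt sub]; split; last first.
  by apply: (@Ck_on_subset _ _ _ _ _ setT) => //; exact/CkP.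
have cvsub p : v p != 0 -> tsupport v p by move=> vp; apply: subset_closure.
have /compact_bounded[M [_ hM]] := cpt.
pose L := `|M| + 1.
have ML : M < L by rewrite (le_lt_trans (ler_norm M))// ltrDl.
have L0 : 0 < L by rewrite ltr_wpDl.
have hL p : v p != 0 -> `|p| <= L by move=> /cvsub; exact: hM.
have [e e0 he] : exists2 e, 0 < e & forall p, v p != 0 -> e <= p.2.
  (* For v = 0 the support is empty and the height has no minimum on it. *)
  have [[q vq]|vN] := pselect (exists q, v q != 0); last first.
    by exists 1 => // p vp; exfalso; apply: vN; exists p.
  have [||p tp ep] := @compact_EVT_min _ _ snd (tsupport v) _ cpt.
  - by exists q; exact: cvsub.
  - by apply: continuous_subspaceT => p; exact: cvg_snd.
  exists p.2; first by apply: sub; rewrite inE in tp.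
  by move=> r vr; apply: ep; rewrite inE; exact: cvsub.
exists (Num.max L e^-1); first by rewrite lt_max L0.
move=> p vp; have := hL _ vp; rewrite prod_normE ge_max => /andP[p1L p2L]; split.
  move=> i; rewrite le_max (le_trans _ p1L)// (_ : `|p.1| = mx_norm p.1)// mx_normrE.
  exact: (le_bigmax _ (fun ij => `|p.1 ij.1 ij.2|) (ord0, i)).
rewrite (le_trans _ (he _ vp)) /=; last first.
  by rewrite invf_ple ?posrE ?lt_max ?L0// le_max lexx orbT.
by rewrite le_max (le_trans _ p2L)// ler_norm.
Qed.

End half_space_coordinates.

(** * The distance and its hyperbolic sine as functions of c *)

Section inverse_hyperbolic_cosine.
Context {R : realType}.
Implicit Types c : R.

Lemma Ck1_sqrt k : Ck1 k [set x : R | 0 < x] Num.sqrt.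
Proof.
have o0 : open [set x : R | 0 < x] by exact: open_gt.
apply: (@Ck_on_eq _ _ _ _ _ _ (fun x => expR (ln x * 2^-1))) => //.
  move=> x x0; have s0 : 0 < Num.sqrt x by rewrite sqrtr_gt0.
  rewrite -[in LHS](sqr_sqrtr (ltW x0)) lnXn// -[ln _ *+ 2]mulr_natr mulfK ?pnatr_eq0//.
  by rewrite lnK.
apply: (@Ck_on_comp _ _ _ _ _ _ setT) => //; first exact: Ck1_expR.
by apply: Ck_on_mul => //; [exact: Ck1_ln|exact: Ck_on_const].
Qed.

Definition sinh_arcosh c : R := Num.sqrt (c ^+ 2 - 1).

Lemma sqr_sub1_gt0 c : 1 < c -> 0 < c ^+ 2 - 1.
Proof. by move=> c1; rewrite subr_gt0 exprn_egt1. Qed.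

Lemma sinh_arcosh_gt0 c : 1 < c -> 0 < sinh_arcosh c.
Proof. by move=> c1; rewrite sqrtr_gt0 sqr_sub1_gt0. Qed.

Lemma sqr_sinh_arcosh c : 1 < c -> sinh_arcosh c ^+ 2 = c ^+ 2 - 1.
Proof. by move=> c1; rewrite sqr_sqrtr// ltW// sqr_sub1_gt0. Qed.

Lemma arcosh_gt0 c : 1 < c -> 0 < arcosh c.
Proof.
by move=> c1; rewrite ln_gt0// (lt_le_trans c1)// lerDl sqrtr_ge0.
Qed.

Lemma open_gt1 : open [set c : R | 1 < c].
Proof. exact: open_gt. Qed.

Lemma is_derive_sqr_sub1 c : is_derive c 1 (fun x : R => x ^+ 2 - 1) (2 * c).
Proof.
have d := is_derive_sub (is_derive_exp 2 (is_derive_id c 1)) (is_derive_const c 1 (1 : R)).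
by apply: (is_derive_eq d); rewrite /= expr1 mulr1 subr0.
Qed.

Lemma is_derive_sinh_arcosh c : 1 < c ->
  is_derive c 1 sinh_arcosh (c / sinh_arcosh c).
Proof.
move=> c1; have S0 := sqr_sub1_gt0 c1; have s0 := sinh_arcosh_gt0 c1.
apply: (is_derive_eq (is_derive_chain (f := fun x : R => x ^+ 2 - 1) (is_derive1_sqrt S0) (is_derive_sqr_sub1 c))).
by rewrite -/(sinh_arcosh c); field; rewrite lt0r_neq0.
Qed.

Lemma is_derive_arcosh c : 1 < c -> is_derive c 1 (@arcosh R) (sinh_arcosh c)^-1.
Proof.
move=> c1; have s0 := sinh_arcosh_gt0 c1.
have cs0 : 0 < c + sinh_arcosh c by rewrite addr_gt0// (lt_trans ltr01).
apply: (is_derive_eq (is_derive_chain (f := fun x => x + sinh_arcosh x) (is_derive1_ln cs0)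
  (is_derive_add (is_derive_id c 1) (is_derive_sinh_arcosh c1)))).
by field; rewrite !lt0r_neq0.
Qed.

Lemma Ck1_sqr_sub1 k : Ck1 k [set c : R | 1 < c] (fun c => c ^+ 2 - 1).
Proof.
have o := open_gt1.
apply: Ck_on_sub => //; last exact: Ck_on_const.
by apply: Ck_on_exp => //; exact: Ck1_id.
Qed.

Lemma Ck1_sinh_arcosh k : Ck1 k [set c : R | 1 < c] sinh_arcosh.
Proof.
apply: (@Ck_on_comp _ _ _ _ _ _ [set x | 0 < x]); first exact: open_gt1.
- by move=> c; exact: sqr_sub1_gt0.
- exact: Ck1_sqrt.
- exact: Ck1_sqr_sub1.
Qed.

Lemma Ck1_arcosh k : Ck1 k [set c : R | 1 < c] (@arcosh R).
Proof.
have o := open_gt1.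
apply: (@Ck_on_comp _ _ _ _ _ _ [set x | 0 < x]) => //.
- by move=> c c1; rewrite /= ltr_wpDr ?sqrtr_ge0// (lt_trans ltr01).
- exact: Ck1_ln.
- by apply: Ck_on_add => //; [exact: Ck1_id|exact: Ck1_sinh_arcosh].
Qed.

Lemma continuous_sinh_arcosh : continuous sinh_arcosh.
Proof.
move=> c; apply: (@continuous_comp _ _ _ (fun c => c ^+ 2 - 1) Num.sqrt).
  by apply: cvgB; [exact: exprn_continuous|exact: cvg_cst].
exact: sqrt_continuous.
Qed.

Lemma continuous_arcosh c : 1 <= c -> {for c, continuous (@arcosh R)}.
Proof.
move=> c1; apply: (@continuous_comp _ _ _ (fun c => c + sinh_arcosh c) (@ln R)).
  by apply: cvgD; [exact: cvg_id|exact: continuous_sinh_arcosh].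
by apply: continuous_ln; rewrite ltr_wpDr ?sqrtr_ge0// (lt_le_trans ltr01).
Qed.

(** At 1 only continuity is asked, because the derivatives of [arcosh] and [sinh_arcosh] blow up
    there. *)
Let vanishing_monotone (f df : R -> R) c : 1 < c ->
  (forall x : R, 1 <= x -> {for x, continuous f}) ->
  (forall x : R, 1 < x -> is_derive x 1 f (df x) /\ 0 <= df x) ->
  f 1 = 0 -> 0 <= f c.
Proof.
move=> c1 cf fd f1.
have [x||d] := @MVT R f df 1 c c1.
- by rewrite in_itv/= => /andP[/fd[]].
- by apply: continuous_in_subspaceT => x; rewrite inE/= in_itv/= => /andP[/cf].
rewrite in_itv/= => /andP[/fd[_ d0] _]; rewrite f1 subr0 => ->.
by rewrite mulr_ge0// subr_ge0 ltW.
Qed.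

Lemma arcosh1 : arcosh (1 : R) = 0.
Proof. by rewrite /arcosh expr1n subrr sqrtr0 addr0 ln1. Qed.

Lemma sinh_arcosh1 : sinh_arcosh 1 = 0.
Proof. by rewrite /sinh_arcosh expr1n subrr sqrtr0. Qed.

Lemma arcosh_le_sinh c : 1 < c -> arcosh c <= sinh_arcosh c.
Proof.
move=> c1; rewrite -subr_ge0.
apply: (@vanishing_monotone (fun c => sinh_arcosh c - arcosh c)
  (fun c => c / sinh_arcosh c - (sinh_arcosh c)^-1)) => //.
- move=> x x1; apply: cvgB; first exact: continuous_sinh_arcosh.
  exact: continuous_arcosh.
- move=> x x1; split.
    by apply: is_derive_sub; [exact: is_derive_sinh_arcosh|exact: is_derive_arcosh].
  rewrite -{2}[_^-1]mul1r -mulrBl divr_ge0 ?sqrtr_ge0// subr_ge0; exact: ltW.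
- by rewrite arcosh1 sinh_arcosh1 subrr.
Qed.

(** This is tanh r <= r. Differentiated in c, the difference of the two sides gives [arcosh c]
    itself. The inequality makes the weight B - r^-2 nonnegative. *)
Lemma sinh_le_arcosh_cosh c : 1 < c -> sinh_arcosh c <= arcosh c * c.
Proof.
move=> c1; rewrite -subr_ge0.
apply: (@vanishing_monotone (fun c => arcosh c * c - sinh_arcosh c) (@arcosh R)) => //.
- move=> x x1; apply: cvgB; last exact: continuous_sinh_arcosh.
  by apply: cvgM; [exact: continuous_arcosh|exact: cvg_id].
- move=> x x1; split; last exact/ltW/arcosh_gt0.
  have d := is_derive_sub (is_derive_mul (is_derive_arcosh x1) (is_derive_id x 1))
    (is_derive_sinh_arcosh x1).
  by apply: (is_derive_eq d); rewrite mulr1 mulrC addrAC subrr add0r.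
- by rewrite arcosh1 sinh_arcosh1 mul0r subrr.
Qed.

End inverse_hyperbolic_cosine.

(** * The calibration *)

Section hardy_rellich_algebra.
Context {R : realFieldType}.
Implicit Types nu c r s y : R.

(* Profiles of the calibrating field, as functions of the distance r and of
   c = cosh r, s = sinh r, in dimension N = nu + 1. *)
Definition weight nu s : R := nu ^+ 2 / 4 + s ^- 2.

(** The derivative with respect to c of log(r^q s^(-nu/2)), given that dc = s dr. *)
Definition radial_slope nu c r s (q : R) : R :=
  q * (r^-1 * s^-1) - nu / 2 * (c * s ^- 2).

(** The last two terms are the two weights times their slopes. The first is half the derivative of
    s^-2 in c: it cancels the term in v grad v . grad c that appears when the coefficient 1/2 + s^-2
    of v grad v is differentiated. *)
Definition radial_profile nu c r s : R :=
  - (c * s ^- 4) + (weight nu s - r ^- 2) * radial_slope nu c r s (1 / 2)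
  + r ^- 2 * radial_slope nu c r s (3 / 2).

Definition dradial_slope nu c r s (q : R) : R :=
  - (q * (r ^- 2 * s ^- 2 + r^-1 * (c * s ^- 3)))
  - nu / 2 * (s ^- 2 - 2 * c ^+ 2 * s ^- 4).

Definition dradial_profile nu c r s : R :=
  - (s ^- 4 - 4 * c ^+ 2 * s ^- 6)
  + ((- 2 * c * s ^- 4 + 2 * (r ^- 3 * s^-1)) * radial_slope nu c r s (1 / 2)
     + (weight nu s - r ^- 2) * dradial_slope nu c r s (1 / 2))
  + (- 2 * (r ^- 3 * s^-1) * radial_slope nu c r s (3 / 2)
     + r ^- 2 * dradial_slope nu c r s (3 / 2)).

(* The divergence of the calibrating field is the left-hand side minus a sum of
   squares and a nonnegative multiple of v ^+ 2; here L, P, Q, T stand for the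
   Laplacian of v, |grad v|^2, <grad v, grad c> and the last component of grad v. *)
Lemma calibration_identity nu c r s y (v L P Q T : R) :
  y != 0 -> r != 0 -> s != 0 -> s ^+ 2 = c ^+ 2 - 1 ->
  let a := - (nu - 1) / 2 in
  let B := weight nu s in let H := radial_profile nu c r s in
  let sq q := P - 2 * v * (a / y * T + radial_slope nu c r s q * Q) + v ^+ 2 *
    (a ^+ 2 / y ^+ 2 + 2 * (a / y) * radial_slope nu c r s q * (1 - c / y)
     + radial_slope nu c r s q ^+ 2 * ((c ^+ 2 - 1) / y ^+ 2)) in
  y ^+ 2 * L ^+ 2 + (nu ^+ 2 - 2) / 4 * P - (nu ^+ 2 - 1) / 16 * (v ^+ 2 / y ^+ 2) =
  (2 * c * s ^- 4 * v + 2 * v * H) * Q - (1 / 2 + s ^- 2) * P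
  - (1 / 2 + s ^- 2) * v * L + 2 * v * a * B / y * T
  + v ^+ 2 * (a * (- 2 * c * s ^- 4 * (1 - c / y) / y - B / y ^+ 2)
              + dradial_profile nu c r s * ((c ^+ 2 - 1) / y ^+ 2)
              + H * ((nu - 1) / y + 2 * c / y ^+ 2))
  + (y * L + v / 4 / y + v / (2 * s ^+ 2) / y) ^+ 2
  + (B - r ^- 2) * sq (1 / 2) + r ^- 2 * sq (3 / 2)
  + (nu ^+ 2 / 16 * r ^- 2 + r ^- 4 + r ^- 2 * s ^- 2 / 4 + c * r^-1 * s ^- 3
     + (nu ^+ 2 / 4 * (nu * (nu - 2) / 4) - 2) * s ^- 2
     + (nu * (nu - 2) / 4 - 13 / 4) * s ^- 4) * (v ^+ 2 / y ^+ 2).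
Proof.
move=> y0 r0 s0 sc a B H sq.
(* The two sides agree only modulo s^2 = c^2 - 1. X is the cofactor of this relation, so that what
   remains is an identity of rational functions in which c and s are independent. *)
pose X := v ^+ 2 / y ^+ 2 *
  (- (2 * a + 2 + nu) * s ^- 4 - B * (nu * a + nu ^+ 2 / 4) * s ^- 2).
rewrite /sq -sc; apply/eqP; rewrite -subr_eq0; apply/eqP.
transitivity (X * (c ^+ 2 - 1 - s ^+ 2)); last by rewrite sc subrr mulr0.
rewrite /X /H /radial_profile /dradial_profile /radial_slope /dradial_slope /B /weight /a.
by field; rewrite y0 r0 s0.
Qed.

(** Since r <= s and c >= 1, the terms r^-2 s^-2 / 4 and c r^-1 s^-3 dominate s^-4 / 4 and s^-4.
    Together they offset the last coefficient, whose minimum -5/4 is reached at nu = 4. The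
    coefficient of s^-2 is nonnegative. *)
Lemma remainder_ge nu c r s : 4 <= nu -> 0 < r -> r <= s -> 1 <= c ->
  nu ^+ 2 / 16 * r ^- 2 + 9 / 16 * r ^- 4 <=
  nu ^+ 2 / 16 * r ^- 2 + r ^- 4 + r ^- 2 * s ^- 2 / 4 + c * r^-1 * s ^- 3
     + (nu ^+ 2 / 4 * (nu * (nu - 2) / 4) - 2) * s ^- 2
     + (nu * (nu - 2) / 4 - 13 / 4) * s ^- 4.
Proof.
move=> nu4 r0 rs c1; have s0 := lt_le_trans r0 rs.
rewrite -!exprVn; set ri := r^-1; set si := s^-1.
have si0 : 0 < si by rewrite invr_gt0.
have rsi : si <= ri by rewrite lef_pV2.
have h2 : si ^+ 2 <= ri ^+ 2 by rewrite lerXn2r ?nnegrE ?(ltW si0)// (le_trans (ltW si0)).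
have h4 : si ^+ 4 <= ri ^+ 4 by rewrite lerXn2r ?nnegrE ?(ltW si0)// (le_trans (ltW si0)).
have h22 : si ^+ 4 <= ri ^+ 2 * si ^+ 2.
  have -> : si ^+ 4 = si ^+ 2 * si ^+ 2 by rewrite -exprD.
  by rewrite ler_wpM2r ?exprn_ge0 ?(ltW si0).
have h13 : si ^+ 4 <= c * ri * si ^+ 3.
  rewrite exprS ler_wpM2r ?exprn_ge0 ?(ltW si0)// (le_trans rsi)// ler_peMl//.
  by rewrite (le_trans (ltW si0)).
have k2 : 2 <= nu * (nu - 2) / 4 by nra.
have l4 : 4 <= nu ^+ 2 / 4 by nra.
have lk : 0 <= (nu ^+ 2 / 4 * (nu * (nu - 2) / 4) - 2) * si ^+ 2.
  by rewrite mulr_ge0 ?exprn_ge0 ?(ltW si0)//; nra.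
have kk : - (5 / 4) * si ^+ 4 <= (nu * (nu - 2) / 4 - 13 / 4) * si ^+ 4.
  by rewrite ler_wpM2r ?exprn_ge0 ?(ltW si0)//; lra.
have s4 : 0 <= si ^+ 4 by rewrite exprn_ge0 ?(ltW si0).
lra.
Qed.

Lemma calibration_le nu c r s y (v L P Q T : R) :
  4 <= nu -> y != 0 -> 0 < r -> r <= s -> s <= r * c -> 1 <= c ->
  s ^+ 2 = c ^+ 2 - 1 ->
  let a := - (nu - 1) / 2 in
  let B := weight nu s in let H := radial_profile nu c r s in
  let sq q := P - 2 * v * (a / y * T + radial_slope nu c r s q * Q) + v ^+ 2 *
    (a ^+ 2 / y ^+ 2 + 2 * (a / y) * radial_slope nu c r s q * (1 - c / y)
     + radial_slope nu c r s q ^+ 2 * ((c ^+ 2 - 1) / y ^+ 2)) in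
  0 <= sq (1 / 2) -> 0 <= sq (3 / 2) ->
  (2 * c * s ^- 4 * v + 2 * v * H) * Q - (1 / 2 + s ^- 2) * P
  - (1 / 2 + s ^- 2) * v * L + 2 * v * a * B / y * T
  + v ^+ 2 * (a * (- 2 * c * s ^- 4 * (1 - c / y) / y - B / y ^+ 2)
              + dradial_profile nu c r s * ((c ^+ 2 - 1) / y ^+ 2)
              + H * ((nu - 1) / y + 2 * c / y ^+ 2))
  + ((nu ^+ 2 - 1) / 16 + nu ^+ 2 / 16 * r ^- 2 + 9 / 16 * r ^- 4) * (v ^+ 2 / y ^+ 2)
  <= y ^+ 2 * L ^+ 2 + (nu ^+ 2 - 2) / 4 * P.
Proof.
move=> nu4 y0 r0 rs src c1 sc a B H sq sq1 sq2.
have s0 := lt_le_trans r0 rs.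
have id := calibration_identity nu v L P Q T y0 (lt0r_neq0 r0) (lt0r_neq0 s0) sc.
rewrite /= -/a -/B -/H -/(sq (1 / 2)) -/(sq (3 / 2)) in id.
have vy0 : 0 <= v ^+ 2 / y ^+ 2 by rewrite divr_ge0 ?sqr_ge0.
have hE := ler_wpM2r vy0 (remainder_ge nu4 r0 rs c1).
have b2 : 0 <= r ^- 2 * sq (3 / 2).
  by rewrite mulr_ge0// invr_ge0 exprn_ge0// ltW.
(* From s <= r c one gets r^-2 <= (c/s)^2 = 1 + s^-2, and 1 <= nu^2 / 4. *)
have b1 : 0 <= (B - r ^- 2) * sq (1 / 2).
  rewrite mulr_ge0// subr_ge0 /B /weight -!exprVn.
  have h : r^-1 <= c * s^-1 by rewrite -ler_pdivrMr ?invr_gt0// invrK ler_pdivrMl.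
  have h2 : r^-1 ^+ 2 <= (c * s^-1) ^+ 2.
    by rewrite lerXn2r ?nnegrE ?invr_ge0 ?(ltW r0)// mulr_ge0 ?invr_ge0 ?(ltW s0)// (le_trans ler01).
  have h3 : (c * s^-1) ^+ 2 = 1 + s^-1 ^+ 2.
    rewrite exprMn; have -> : c ^+ 2 = s ^+ 2 + 1 by rewrite sc subrK.
    by rewrite mulrDl mul1r -exprMn divff ?lt0r_neq0// expr1n.
  by rewrite (le_trans h2)// h3 lerD2r; nra.
have b3 : 0 <= (y * L + v / 4 / y + v / (2 * s ^+ 2) / y) ^+ 2 by exact: sqr_ge0.
rewrite -[leRHS](subrK ((nu ^+ 2 - 1) / 16 * (v ^+ 2 / y ^+ 2))) id.
rewrite -[X in _ + X * _]addrA [X in _ + X]mulrDl [X in _ + X <= _]addrC addrA lerD2r.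
apply: lerD hE; rewrite -[leRHS]addrA -[leRHS]addrA lerDl.
by rewrite !addr_ge0.
Qed.

End hardy_rellich_algebra.

(** * The calibrating field and its divergence *)

Section calibrating_field.
Context {R : realType}.
Implicit Types (nu c q : R).

Lemma is_derive_sinh_arcoshV m c : 1 < c ->
  is_derive c 1 (fun c => sinh_arcosh c ^- m) (- (m%:R * c * sinh_arcosh c ^- m.+2)).
Proof.
move=> c1; have s0 := lt0r_neq0 (sinh_arcosh_gt0 c1).
have d := is_derive_inv (f := fun c => sinh_arcosh c ^+ m) (expf_neq0 m s0)
  (is_derive_exp m (is_derive_sinh_arcosh c1)).
apply: (is_derive_eq d); case: m {d} => [|m] /=; first by rewrite !mul0r oppr0 mul0r.
by rewrite !exprS; field; rewrite s0 expf_neq0.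
Qed.

Lemma is_derive_arcoshV m c : 1 < c ->
  is_derive c 1 (fun c => arcosh c ^- m)
    (- (m%:R * (arcosh c ^- m.+1 * (sinh_arcosh c)^-1))).
Proof.
move=> c1; have s0 := lt0r_neq0 (sinh_arcosh_gt0 c1).
have r0 := lt0r_neq0 (arcosh_gt0 c1).
have d := is_derive_inv (f := fun c => arcosh c ^+ m) (expf_neq0 m r0)
  (is_derive_exp m (is_derive_arcosh c1)).
apply: (is_derive_eq d); case: m {d} => [|m] /=; first by rewrite !mul0r oppr0 mul0r.
by rewrite !exprS; field; rewrite s0 r0 expf_neq0.
Qed.

Definition weight_of nu c := weight nu (sinh_arcosh c).
Definition profile_of nu c := radial_profile nu c (arcosh c) (sinh_arcosh c).

Lemma is_derive_weight_of nu c : 1 < c ->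
  is_derive c 1 (weight_of nu) (- 2 * c * sinh_arcosh c ^- 4).
Proof.
move=> c1; apply: (is_derive_eq (is_derive_add (is_derive_const c 1 (nu ^+ 2 / 4 : R))
  (is_derive_sinh_arcoshV 2 c1))).
by rewrite add0r mulNr mulNr.
Qed.

Lemma is_derive_profile_of nu c : 1 < c ->
  is_derive c 1 (profile_of nu) (dradial_profile nu c (arcosh c) (sinh_arcosh c)).
Proof.
move=> c1; have dc := is_derive_id c 1.
have cst a := is_derive_const c 1 (a : R).
have slope q := is_derive_sub
  (is_derive_mul (cst q) (is_derive_mul (is_derive_arcoshV 1 c1) (is_derive_sinh_arcoshV 1 c1)))
  (is_derive_mul (cst (nu / 2)) (is_derive_mul dc (is_derive_sinh_arcoshV 2 c1))).
have := is_derive_add (is_derive_add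
  (is_derive_opp (is_derive_mul dc (is_derive_sinh_arcoshV 4 c1)))
  (is_derive_mul (is_derive_sub (is_derive_weight_of nu c1) (is_derive_arcoshV 2 c1)) (slope (1 / 2))))
  (is_derive_mul (is_derive_arcoshV 2 c1) (slope (3 / 2))).
move=> d; apply: (is_derive_eq d); rewrite /dradial_profile /weight_of /dradial_slope /radial_slope.
have s0 := lt0r_neq0 (sinh_arcosh_gt0 c1); have r0 := lt0r_neq0 (arcosh_gt0 c1).
by rewrite /= /weight; field; rewrite s0 r0.
Qed.

Lemma Ck1_sinh_arcoshV k m : Ck1 k [set c : R | 1 < c] (fun c => sinh_arcosh c ^- m).
Proof.
have o := @open_gt1 R.
apply: (@Ck_on_comp _ _ _ _ _ _ [set x | 0 < x] (fun x => x^-1) (fun c => sinh_arcosh c ^+ m)) => //.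
- by move=> c c1; rewrite /= exprn_gt0// sinh_arcosh_gt0.
- exact: Ck1_inv.
- by apply: Ck_on_exp => //; exact: Ck1_sinh_arcosh.
Qed.

Lemma Ck1_arcoshV k m : Ck1 k [set c : R | 1 < c] (fun c => arcosh c ^- m).
Proof.
have o := @open_gt1 R.
apply: (@Ck_on_comp _ _ _ _ _ _ [set x | 0 < x] (fun x => x^-1) (fun c => arcosh c ^+ m)) => //.
- by move=> c c1; rewrite /= exprn_gt0// arcosh_gt0.
- exact: Ck1_inv.
- by apply: Ck_on_exp => //; exact: Ck1_arcosh.
Qed.

Lemma Ck1_weight_of k nu : Ck1 k [set c : R | 1 < c] (weight_of nu).
Proof.
have o := @open_gt1 R.
by apply: Ck_on_add => //; [exact: Ck_on_const|exact: Ck1_sinh_arcoshV].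
Qed.

Lemma Ck1_profile_of k nu : Ck1 k [set c : R | 1 < c] (profile_of nu).
Proof.
have o := @open_gt1 R.
have slope q : Ck1 k [set c : R | 1 < c]
    (fun c => radial_slope nu c (arcosh c) (sinh_arcosh c) q).
  apply: Ck_on_sub => //; apply: Ck_on_mul => //; try exact: Ck_on_const.
    by apply: Ck_on_mul => //; [exact: (Ck1_arcoshV k 1)|exact: (Ck1_sinh_arcoshV k 1)].
  by apply: Ck_on_mul => //; [exact: Ck1_id|exact: Ck1_sinh_arcoshV].
apply: Ck_on_add => //; last first.
  by apply: Ck_on_mul => //; [exact: Ck1_arcoshV|exact: slope].
apply: Ck_on_add => //.
  by apply: Ck_on_opp => //; apply: Ck_on_mul => //; [exact: Ck1_id|exact: Ck1_sinh_arcoshV].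
apply: Ck_on_mul => //; last exact: slope.
by apply: Ck_on_sub => //; [exact: Ck1_weight_of|exact: Ck1_arcoshV].
Qed.

Context {n : nat}.
Implicit Types (p : 'rV[R]_n * R) (v : 'rV[R]_n * R -> R).
Local Notation dir := (@basis_dir R n).
Local Notation nu := (n%:R : R).

Definition punctured : set ('rV[R]_n * R) := [set p | half_space p /\ 1 < cdist p].

Lemma open_punctured : open punctured.
Proof.
rewrite openE => p [p0 c1]; apply: filterI.
  exact: open_nbhs_nbhs (conj open_half_space p0).
have := Ck_on_continuous (Ck_on_cdist 0) p0.
by move/cvgr_gt => /(_ _ c1).
Qed.

Lemma Ck_on_cdist_comp k (phi : R -> R) : Ck1 k [set c | 1 < c] phi ->
  Ck_on dir k punctured (fun p => phi (cdist p)).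
Proof.
move=> cphi; apply: Ck_on_comp cphi _; first exact: open_punctured.
  by move=> p [].
by apply: (Ck_on_subset _ (Ck_on_cdist k)) => p [].
Qed.

(** The factor of v grad v reduces to 1/2 + s^-2, the coefficient of v L in the completed square.
    The part in v^2 carries the weights times the logarithmic gradients of the ground states: B a/y
    in the vertical direction, and the radial profile along grad c. *)
Definition calib v (i : option 'I_n) p : R :=
  v p ^+ 2 * ((i == None)%:R * (- (nu - 1) / 2) * (weight_of nu (cdist p) * p.2^-1)
              + profile_of nu (cdist p) * dcdist i p)
  - (weight_of nu (cdist p) + (1 / 2 - nu ^+ 2 / 4)) * (v p * partial i v p).

Lemma Ck_on_calib v i : Ck_on dir 2 half_space v -> Ck_on dir 1 punctured (calib v i).
Proof.
move=> cv; have o := open_punctured.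
have sub : punctured `<=` half_space by move=> p [].
have cv1 : Ck_on dir 1 punctured v by apply: Ck_on_subset sub (Ck_on_pred cv).
have cw : Ck_on dir 1 punctured (fun p => weight_of nu (cdist p)).
  by apply: Ck_on_cdist_comp; exact: Ck1_weight_of.
have cp : Ck_on dir 1 punctured (fun p => profile_of nu (cdist p)).
  by apply: Ck_on_cdist_comp; exact: Ck1_profile_of.
have cd : Ck_on dir 1 punctured (dcdist i) by apply: Ck_on_subset sub (Ck_on_dcdist 1 i).
have cV : Ck_on dir 1 punctured (fun p => p.2^-1) by apply: Ck_on_subset sub (Ck_on_sndV 1).
have cdv : Ck_on dir 1 punctured (partial i v) by apply: Ck_on_subset sub (Ck_on_derive i cv).
have cst b : Ck_on dir 1 punctured (fun=> b) by exact: Ck_on_const.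
exact: (Ck_on_sub o
  (Ck_on_mul o (Ck_on_exp 2 o cv1)
    (Ck_on_add o (Ck_on_mul o (cst ((i == None)%:R * (- (nu - 1) / 2))) (Ck_on_mul o cw cV))
      (Ck_on_mul o cp cd)))
  (Ck_on_mul o (Ck_on_add o cw (cst (1 / 2 - nu ^+ 2 / 4))) (Ck_on_mul o cv1 cdv))).
Qed.

Lemma is_derive_calib v i p : Ck_on dir 2 half_space v -> punctured p ->
  let c := cdist p in let s := sinh_arcosh c in let r := arcosh c in
  let g := dcdist i p in let y := p.2 in let a := - (nu - 1) / 2 in
  is_derive p (dir i) (calib v i)
    (2 * v p * profile_of nu c * (partial i v p * g)
     + 2 * v p * a * weight_of nu c / y * ((i == None)%:R * partial i v p)
     + v p ^+ 2 * a * ((i == None)%:R * (- 2 * c * s ^- 4 * (g / y) - weight_of nu c / y ^+ 2))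
     + v p ^+ 2 * dradial_profile nu c r s * g ^+ 2
     + v p ^+ 2 * profile_of nu c * ddcdist i p
     + 2 * c * s ^- 4 * v p * (partial i v p * g)
     - (1 / 2 + s ^- 2) * partial i v p ^+ 2
     - (1 / 2 + s ^- 2) * v p * partial i (partial i v) p).
Proof.
move=> cv [p0 c1] c s r g y a.
have dv := Ck_on_is_derive i cv p0.
have ddv := Ck_on_is_derive i (Ck_on_derive i cv) p0.
have dw := is_derive_chain (is_derive_weight_of nu c1) (is_derive_cdist i p0).
have dp := is_derive_chain (is_derive_profile_of nu c1) (is_derive_cdist i p0).
have dg := is_derive_dcdist i p0.
have dV := is_derive_sndV i p0.
have cst b := is_derive_const p (dir i) (b : R).
have d := is_derive_sub
 (is_derive_mul (is_derive_exp 2 dv)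
   (is_derive_add (is_derive_mul (cst ((i == None)%:R * (- (nu - 1) / 2)))
       (is_derive_mul dw dV)) (is_derive_mul dp dg)))
 (is_derive_mul (is_derive_add dw (cst (1 / 2 - nu ^+ 2 / 4))) (is_derive_mul dv ddv)).
apply: (is_derive_eq d); rewrite -/c -/s -/r -/g -/y -/a /partial.
have y0 : y != 0 by rewrite gt_eqF.
have s0 : s != 0 by rewrite gt_eqF// sinh_arcosh_gt0.
have -> : weight_of nu c = nu ^+ 2 / 4 + s ^- 2 by [].
move: (profile_of nu c) (dradial_profile nu c r s) (ddcdist i p) => A1 A2 A3.
rewrite -/(partial i v p).
move: ('D_(dir i) (partial i v) p) (partial i v p) (v p) => V2 V1 V0.
rewrite {}/g /=; move: (dcdist i p) => g.
clear dv ddv dw dp dg dV cst d; clearbody s r a y; clearbody c.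
by case: (i == None); rewrite /= ?mulr0n; field; rewrite y0 s0.
Qed.

Lemma sum_calib v p : Ck_on dir 2 half_space v -> punctured p ->
  let c := cdist p in let s := sinh_arcosh c in let r := arcosh c in
  let y := p.2 in let a := - (nu - 1) / 2 in
  let Q := \sum_i partial i v p * dcdist i p in
  \sum_i 'D_(dir i) (calib v i) p =
  (2 * c * s ^- 4 * v p + 2 * v p * profile_of nu c) * Q
  - (1 / 2 + s ^- 2) * grad_sq v p - (1 / 2 + s ^- 2) * v p * laplacian v p
  + 2 * v p * a * weight_of nu c / y * partial None v p
  + v p ^+ 2 * (a * (- 2 * c * s ^- 4 * (1 - c / y) / y - weight_of nu c / y ^+ 2)
              + dradial_profile nu c r s * ((c ^+ 2 - 1) / y ^+ 2)
              + profile_of nu c * ((nu - 1) / y + 2 * c / y ^+ 2)).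
Proof.
move=> cv hp c s r y a Q; have [p0 _] := hp.
under eq_bigr => i _ do rewrite (@derive_val _ _ _ _ _ _ _ (is_derive_calib i cv hp)).
rewrite !big_split /= !sumrN -!mulr_sumr.
rewrite sum_ddcdist// sum_dcdist_sq// -/c -/s -/r -/y -/a -/Q.
have -> : \sum_(i : option 'I_n) (i == None)%:R * partial i v p = partial None v p.
  by rewrite big_option/= mul1r big1 ?addr0// => j _; rewrite mul0r.
have -> : \sum_(i : option 'I_n) ((i == None)%:R *
    (- 2 * c * s ^- 4 * (dcdist i p / y) - weight_of nu c / y ^+ 2)) =
    - 2 * c * s ^- 4 * ((1 - c / y) / y) - weight_of nu c / y ^+ 2.
  by rewrite big_option/= mul1r big1 ?addr0// => j _; rewrite mul0r.
rewrite -/(grad_sq v p) -/(laplacian v p).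
by ring.
Qed.

(** The right-hand side is |grad v - v (a/y e + u grad c)|^2 expanded, with e the vertical unit
    vector. *)
Lemma sum_square_ge0 v p (u a : R) : half_space p ->
  0 <= grad_sq v p
    - 2 * v p * (a / p.2 * partial None v p + u * \sum_i partial i v p * dcdist i p)
    + v p ^+ 2 * (a ^+ 2 / p.2 ^+ 2 + 2 * (a / p.2) * u * (1 - cdist p / p.2)
     + u ^+ 2 * ((cdist p ^+ 2 - 1) / p.2 ^+ 2)).
Proof.
move=> p0.
have : 0 <= \sum_i (partial i v p - v p * ((i == None)%:R * (a / p.2) + u * dcdist i p)) ^+ 2.
  by apply: sumr_ge0 => i _; exact: sqr_ge0.
congr (_ <= _).
have E i : (partial i v p - v p * ((i == None)%:R * (a / p.2) + u * dcdist i p)) ^+ 2 =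
  partial i v p ^+ 2 - (2 * v p * (a / p.2)) * ((i == None)%:R * partial i v p)
  - (2 * v p * u) * (partial i v p * dcdist i p)
  + v p ^+ 2 * (a / p.2) ^+ 2 * (i == None)%:R
  + v p ^+ 2 * 2 * (a / p.2) * u * ((i == None)%:R * dcdist i p)
  + v p ^+ 2 * u ^+ 2 * dcdist i p ^+ 2.
  by case: (i == None); rewrite ?mulr0n ?mulr1n; ring.
under eq_bigr => i _ do rewrite E.
rewrite !big_split /= !sumrN -!mulr_sumr sum_dcdist_sq//.
have -> : \sum_(i : option 'I_n) (i == None)%:R * partial i v p = partial None v p.
  by rewrite big_option/= mul1r big1 ?addr0// => j _; rewrite mul0r.
have -> : \sum_(i : option 'I_n) (i == None)%:R = 1 :> R.
  by rewrite big_option/= big1 ?addr0// => j _.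
have -> : \sum_(i : option 'I_n) (i == None)%:R * dcdist i p = 1 - cdist p / p.2.
  by rewrite big_option/= mul1r big1 ?addr0// => j _; rewrite mul0r.
by rewrite -/(grad_sq v p) -expr_div_n; ring.
Qed.

Definition hr_potential p : R :=
  (nu ^+ 2 - 1) / 16 + nu ^+ 2 / 16 * arcosh (cdist p) ^- 2 + 9 / 16 * arcosh (cdist p) ^- 4.

Lemma sum_calib_le v p : (3 < n)%N -> Ck_on dir 2 half_space v -> punctured p ->
  \sum_i 'D_(dir i) (calib v i) p + hr_potential p * (v p ^+ 2 / p.2 ^+ 2) <=
  p.2 ^+ 2 * laplacian v p ^+ 2 + (nu ^+ 2 - 2) / 4 * grad_sq v p.
Proof.
move=> n3 cv hp; have [p0 c1] := hp; rewrite sum_calib//.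
have nu4 : 4 <= nu by rewrite (ler_nat _ 4).
apply: calibration_le => //.
- by rewrite gt_eqF.
- exact: arcosh_gt0.
- exact: arcosh_le_sinh.
- exact: sinh_le_arcosh_cosh.
- exact: ltW.
- exact: sqr_sinh_arcosh.
- exact: sum_square_ge0.
- exact: sum_square_ge0.
Qed.

End calibrating_field.

(** * Removing the pole *)

Section cutoff.
Context {R : realType} {n : nat}.
Implicit Types (p : 'rV[R]_n * R) (v f : 'rV[R]_n * R -> R).
Local Notation dir := (@basis_dir R n).
Local Notation nu := (n%:R : R).

(** Built on c instead of d to remain smooth at the pole. As c - 1 is comparable to d^2 there, the
    transition takes place at distance of order 1/t. *)
Definition cutoff (t : R) p : R := plateau (t ^+ 2 * (cdist p - 1) - 1).

Lemma cutoff_ge0 t p : 0 <= cutoff t p. Proof. exact: plateau_ge0. Qed.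
Lemma cutoff_le1 t p : cutoff t p <= 1. Proof. exact: plateau_le1. Qed.

Lemma cutoff_eq0 t p : t ^+ 2 * (cdist p - 1) <= 1 -> cutoff t p = 0.
Proof. by move=> h; rewrite /cutoff plateau_le0// subr_le0. Qed.

Definition dcutoff (t : R) p : R :=
  t ^+ 2 * 'D_1 plateau (t ^+ 2 * (cdist p - 1) - 1).

Lemma is_derive_plateau (x : R) : is_derive x 1 plateau ('D_1 plateau x).
Proof. exact: (@Ck_on_is_derive _ _ _ _ 0 _ _ tt x (@Ck1_plateau R 1) I). Qed.

Lemma is_derive_cutoff t i p : half_space p ->
  is_derive p (dir i) (cutoff t) (dcutoff t p * dcdist i p).
Proof.
move=> p0; have cst b := is_derive_const p (dir i) (b : R).
have d := is_derive_sub (is_derive_mul (cst (t ^+ 2))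
  (is_derive_sub (is_derive_cdist i p0) (cst 1))) (cst 1).
apply: (is_derive_eq (is_derive_chain
  (f := fun p => t ^+ 2 * (cdist p - 1) - 1) (is_derive_plateau _) d)).
by rewrite /dcutoff; ring.
Qed.

Lemma Ck_on_cutoff k t : Ck_on dir k half_space (cutoff t).
Proof.
have o := @open_half_space R n; have cst b := Ck_on_const dir k (b : R) o.
apply: (Ck_on_comp (W := setT) o _ (@Ck1_plateau R k)) => //.
exact: (Ck_on_sub o (Ck_on_mul o (cst (t ^+ 2)) (Ck_on_sub o (Ck_on_cdist k) (cst 1))) (cst 1)).
Qed.

Definition inner_region (t : R) : set ('rV[R]_n * R) :=
  [set p | half_space p /\ t ^+ 2 * (cdist p - 1) - 1 < 0].

Lemma open_inner_region t : open (inner_region t).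
Proof.
rewrite openE => p [p0 hp]; apply: filterI.
  exact: open_nbhs_nbhs (conj open_half_space p0).
have o := @open_half_space R n; have cst b := Ck_on_const dir 0 (b : R) o.
have := Ck_on_continuous (Ck_on_sub o (Ck_on_mul o (cst (t ^+ 2))
  (Ck_on_sub o (Ck_on_cdist 0) (cst 1))) (cst 1)) p0.
by move/cvgr_lt => /(_ _ hp).
Qed.

Lemma half_space_cover t p : half_space p -> punctured p \/ inner_region t p.
Proof.
move=> p0; have := cdist_ge1 p0; rewrite le_eqVlt => /predU1P[c1|]; last by left.
by right; split=> //; rewrite -c1 subrr mulr0 sub0r oppr_lt0.
Qed.

(** Smoothness is local: off the pole both factors are smooth, and on the neighbourhood
    [inner_region t] of the pole the product is identically zero. *)
Lemma Ck_on_mul_cutoff k t f : Ck_on dir k punctured f ->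
  Ck_on dir k half_space (fun p => cutoff t p * f p).
Proof.
move=> cf; apply: (@Ck_on_subset _ _ _ _ _ (punctured `|` inner_region t)).
  by move=> p /(half_space_cover t).
apply: Ck_on_union.
  apply: (Ck_on_mul open_punctured _ cf).
  by apply: (Ck_on_subset _ (Ck_on_cutoff k t)) => p [].
apply: (@Ck_on_eq _ _ _ dir k _ (fun=> 0)); first exact: open_inner_region.
  by move=> p [_ h]; rewrite cutoff_eq0 ?mul0r// -subr_le0 ltW.
exact/Ck_on_const/open_inner_region.
Qed.

Lemma Cc_mul_cutoff K t v f : 0 < K -> supported K v ->
  (forall p, v p = 0 -> f p = 0) -> Ck_on dir 0 punctured f ->
  Cc (fun p => cutoff t p * f p).
Proof.
move=> K0 hv vf cf; split; last first.
  exact: (Ck_on_mul_cutoff t cf).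
exists K => //; apply: supported_sub hv _ => p; apply: contraNN => /eqP/vf ->.
by rewrite mulr0.
Qed.

Lemma derive_cutoff_inner t f i p : inner_region t p ->
  'D_(dir i) (fun q => cutoff t q * f q) p = 0.
Proof.
move=> hp; have : \forall q \near p, cst 0 q = cutoff t q * f q.
  have := open_nbhs_nbhs (conj (@open_inner_region t) hp).
  by apply: filterS => q [_ h]; rewrite /= cutoff_eq0 ?mul0r// -subr_le0 ltW.
by move=> /near_eq_derive <-; rewrite derive_cst.
Qed.

Definition hr_energy v p : R :=
  p.2 ^+ 2 * laplacian v p ^+ 2 + (nu ^+ 2 - 2) / 4 * grad_sq v p.

Lemma hr_energy_ge0 v p : (3 < n)%N -> 0 <= hr_energy v p.
Proof.
move=> n3; have nu4 : 4 <= nu by rewrite (ler_nat _ 4).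
rewrite /hr_energy addr_ge0// mulr_ge0 ?sqr_ge0//; first by nra.
by apply: sumr_ge0 => i _; exact: sqr_ge0.
Qed.

Lemma grad_sq_Ck k v : Ck_on dir k.+1 half_space v ->
  Ck_on dir k half_space (grad_sq v).
Proof.
move=> cv; have o := @open_half_space R n.
by apply: Ck_on_sum => // i; apply: Ck_on_exp => //; exact: (Ck_on_derive i cv).
Qed.

Lemma laplacian_Ck k v : Ck_on dir k.+2 half_space v ->
  Ck_on dir k half_space (laplacian v).
Proof.
move=> cv; have o := @open_half_space R n.
by apply: Ck_on_sum => // i; exact: (Ck_on_derive i (Ck_on_derive i cv)).
Qed.

Lemma supported_grad_sq K v : 0 < K -> supported K v -> supported K (grad_sq v).
Proof.
move=> K0 hv p; apply: contraPP => hp; rewrite /grad_sq big1 ?eqxx// => i _.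
suff -> : partial i v p = 0 by rewrite expr0n.
by apply/eqP/negPn/negP => /(supported_partial K0 hv).
Qed.

Lemma supported_laplacian K v : 0 < K -> supported K v -> supported K (laplacian v).
Proof.
move=> K0 hv p; apply: contraPP => hp; rewrite /laplacian big1 ?eqxx// => i _.
by apply/eqP/negPn/negP => /(supported_partial K0 (supported_partial K0 hv)).
Qed.

Lemma supported_combination K f g h : supported K f -> supported K g ->
  (forall p, f p = 0 -> g p = 0 -> h p = 0) -> supported K h.
Proof.
move=> hf hg fgh p hp; have [f0|] := eqVneq (f p) 0; last exact: hf.
have [g0|] := eqVneq (g p) 0; last exact: hg.
by move: hp; rewrite (fgh _ f0 g0) eqxx.
Qed.

Lemma Cc_hr_energy v : Ckc 2 v -> Cc (hr_energy v).
Proof.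
move=> [[K K0 hv] cv]; split.
  exists K => //; apply: (supported_combination (supported_laplacian K0 hv) (supported_grad_sq K0 hv)).
  by move=> p; rewrite /hr_energy => -> ->; rewrite expr0n !mulr0 addr0.
have o := @open_half_space R n; have cst b := Ck_on_const dir 0 (b : R) o.
exact: (Ck_on_add o (Ck_on_mul o (Ck_on_exp 2 o (Ck_on_snd 0 o)) (Ck_on_exp 2 o (laplacian_Ck cv)))
  (Ck_on_mul o (cst ((nu ^+ 2 - 2) / 4)) (grad_sq_Ck (Ck_on_pred cv)))).
Qed.

Lemma supported_le K L f : 0 < K -> K <= L -> supported K f -> supported L f.
Proof.
move=> K0 KL hf p /hf[h1 /andP[h2 h3]]; split; first by move=> i; exact: le_trans KL.
rewrite (le_trans h3 KL) andbT (le_trans _ h2)// lef_pV2// posrE//.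
exact: lt_le_trans KL.
Qed.

Lemma CcD f g : Cc f -> Cc g -> Cc (f \+ g).
Proof.
move=> [[K K0 hf] cf] [[L L0 hg] cg]; split; last first.
  by move=> p p0; apply: cvgD; [exact: cf|exact: cg].
exists (Num.max K L); first by rewrite lt_max K0.
apply: (supported_combination (f := f) (g := g)).
- by apply: supported_le hf => //; rewrite le_max lexx.
- by apply: supported_le hg => //; rewrite le_max lexx orbT.
- by move=> p /= -> ->; rewrite addr0.
Qed.

Lemma CcZ a f : Cc f -> Cc (fun p => a * f p).
Proof.
move=> cf; apply: (Cc_sub cf); first by move=> p; apply: contraNN => /eqP ->; rewrite mulr0.
by move=> p p0; apply: cvgM; [exact: cvg_cst|exact: cf.2].
Qed.

Definition cut_divergence t v p : R :=
  \sum_i 'D_(dir i) (fun q => cutoff t q * calib v i q) p.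

Lemma calib_eq0 v i p : v p = 0 -> calib v i p = 0.
Proof. by move=> v0; rewrite /calib v0 expr0n !mul0r mulr0 subrr. Qed.

Lemma Cc_cut_divergence t v : Ckc 2 v ->
  Cc (cut_divergence t v) /\ hint (cut_divergence t v) = 0.
Proof.
move=> [[K K0 hv] cv].
have cG i : Ck_on dir 1 half_space (fun q => cutoff t q * calib v i q).
  by apply: Ck_on_mul_cutoff; exact: Ck_on_calib.
have sG i : supported K (fun q => cutoff t q * calib v i q).
  by apply: supported_sub hv _ => p; apply: contraNN => /eqP/calib_eq0 ->; rewrite mulr0.
have CG i : Cc (fun q => cutoff t q * calib v i q).
  by split; [exists K|exact: (Ck_on_pred (cG i))].
have CdG i : Cc (fun q => 'D_(dir i) (fun q => cutoff t q * calib v i q) q).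
  by split; [exists K => //; exact: (supported_partial (i := i) K0 (sG i))|exact: (Ck_on_derive i (cG i))].
rewrite /cut_divergence; elim: (index_enum _) => [|i s [IH1 IH2]].
  split; under eq_fun do rewrite big_nil.
    split; last by move=> p _; exact: cvg_cst.
    by exists K => // p /eqP.
  by rewrite /hint Rintegral_cst//= mul0r.
have E : (fun p => \sum_(j <- i :: s) 'D_(dir j) (fun q => cutoff t q * calib v j q) p) =
  (fun q => 'D_(dir i) (fun q => cutoff t q * calib v i q) q) \+
  (fun p => \sum_(j <- s) 'D_(dir j) (fun q => cutoff t q * calib v j q) p).
  by apply/funext => p; rewrite big_cons.
rewrite E; split; first exact: CcD.
by rewrite hintD// IH2 addr0; apply: (@hint_partial_eq0 _ _ i _ _ (CG i) (CdG i)) => p p0;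
  exact: (Ck_on_is_derive i (cG i)).
Qed.

(** Near the pole the cutoff vanishes and [hr_energy_ge0] suffices. Elsewhere the calibration
    inequality is multiplied by the cutoff, and cutoff <= 1 on the nonnegative energy does the rest.
    The gradient of the cutoff contributes in the shell only, the plateau being locally constant
    beyond it. *)
Lemma cut_divergence_le t v p : (3 < n)%N -> Ck_on dir 2 half_space v -> half_space p ->
  cutoff t p * hr_potential p * (v p ^+ 2 / p.2 ^+ 2) + cut_divergence t v p <=
  hr_energy v p + (if 1 <= t ^+ 2 * (cdist p - 1) <= 2 then
    dcutoff t p * \sum_i dcdist i p * calib v i p else 0).
Proof.
move=> n3 cv p0; have E0 := hr_energy_ge0 v p n3.
have [hp|hp] := ltP (t ^+ 2 * (cdist p - 1)) 1.
  rewrite /= addr0 cutoff_eq0 ?(ltW hp)// !mul0r add0r.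
  rewrite /cut_divergence big1// => i _; apply: derive_cutoff_inner.
  by split=> //; rewrite subr_lt0.
have c1 : 1 < cdist p.
  rewrite lt_neqAle cdist_ge1// andbT; apply: contraTneq hp => <-.
  by rewrite subrr mulr0 -ltNge.
have pp : punctured p by [].
have -> : cut_divergence t v p = dcutoff t p * (\sum_i dcdist i p * calib v i p) +
    cutoff t p * \sum_i 'D_(dir i) (calib v i) p.
  rewrite !mulr_sumr -big_split; apply: eq_bigr => i _ /=; rewrite mulrA.
  have d := is_derive_mul (is_derive_cutoff t i p0)
    (Ck_on_is_derive i (Ck_on_calib i cv) pp).
  by rewrite (@derive_val _ _ _ _ _ _ _ d).
have -> : (if true && (t ^+ 2 * (cdist p - 1) <= 2) then
    dcutoff t p * (\sum_i dcdist i p * calib v i p) else 0) =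
    dcutoff t p * (\sum_i dcdist i p * calib v i p).
  rewrite /=; case: leP => // h2.
  suff -> : dcutoff t p = 0 by rewrite mul0r.
  suff D0 : 'D_1 plateau (t ^+ 2 * (cdist p - 1) - 1) = 0 by rewrite /dcutoff D0 mulr0.
  have : \forall q \near t ^+ 2 * (cdist p - 1) - 1, cst 1 q = plateau q.
    near=> q; rewrite plateau_ge1//; near: q.
    have : 1 < t ^+ 2 * (cdist p - 1) - 1 by rewrite ltrBrDr.
    by move=> h; apply: filterS (lt_nbhsr h) => q; exact: ltW.
  by move=> /near_eq_derive <-; rewrite derive_cst.
rewrite addrCA [leRHS]addrC lerD2l -mulrA -mulrDr addrC.
apply: le_trans (ler_wpM2l (cutoff_ge0 _ _) (sum_calib_le n3 cv pp)) _.
by rewrite ler_piMl// cutoff_le1.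
Unshelve. all: by end_near. Qed.

End cutoff.

(** * Size of the field near the pole *)

Section cutoff_error.
Context {R : realType}.

Lemma norm_mul_le (x y X Y : R) : `|x| <= X -> `|y| <= Y -> `|x * y| <= X * Y.
Proof. by move=> xX yY; rewrite normrM ler_pM. Qed.

Lemma norm_add_le (x y X Y : R) : `|x| <= X -> `|y| <= Y -> `|x + y| <= X + Y.
Proof. by move=> xX yY; rewrite (le_trans (ler_normD _ _))// lerD. Qed.

Lemma norm_sub_le (x y X Y : R) : `|x| <= X -> `|y| <= Y -> `|x - y| <= X + Y.
Proof. by move=> xX yY; apply: norm_add_le => //; rewrite normrN. Qed.

Lemma norm_ge0_le (x X : R) : 0 <= x -> x <= X -> `|x| <= X.
Proof. by move=> x0; rewrite ger0_norm. Qed.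

Lemma derive_plateau_bounded :
  exists2 D : R, 0 <= D & forall x, 0 <= x <= 1 -> `|'D_1 plateau x| <= D.
Proof.
have : compact ((fun x : R => 'D_1 plateau x) @` `[0, 1]%classic).
  apply: continuous_compact; last exact: segment_compact.
  apply: continuous_subspaceT => x.
  exact: (@Ck_on_derive _ _ _ _ 0 _ _ tt (@Ck1_plateau R 1) x I).
move=> /compact_bounded[M [_ hM]]; exists (`|M| + 1) => // x x01.
apply: (hM (`|M| + 1)); first by rewrite (le_lt_trans (ler_norm M))// ltrDl.
by exists x => //=; rewrite in_itv.
Qed.

Context {n : nat}.
Implicit Types (p : 'rV[R]_n * R) (v f : 'rV[R]_n * R -> R).
Local Notation nu := (n%:R : R).

Lemma Cc_bounded f : Cc f -> exists2 C, 0 <= C & forall p, `|f p| <= C.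
Proof.
move=> /Cc_compact_box/compact_box_bounded[C C0 hC]; exists C => // -[x y].
by have := hC (consrow y x); rewrite /= split_consrow.
Qed.

(** The powers are those of r^-2 and r^-4 at distance r of order 1/t: each slope is of order r^-2,
    and so is each weight. *)
Lemma profile_bound (t c r s q : R) : 1 <= t -> 0 < r -> 0 < s -> 1 <= c <= 3 ->
  s^-1 <= t -> r^-1 <= 3 * t -> let A := nu ^+ 2 + 10 in
  `|weight nu s| <= A * t ^+ 2 /\
  `|radial_profile nu c r s| <= (3 + A * A + 18 * A) * t ^+ 4.
Proof.
move=> t1 r0 s0 /andP[c1 c3] st rt A.
have t0 : 0 <= t by rewrite (le_trans ler01).
have nu0 : 0 <= nu by [].
have si : `|s^-1| <= t by apply: norm_ge0_le => //; rewrite invr_ge0 ltW.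
have ri : `|r^-1| <= 3 * t by apply: norm_ge0_le => //; rewrite invr_ge0 ltW.
have cc : `|c| <= 3 by apply: norm_ge0_le => //; rewrite (le_trans ler01).
have s2 : `|s ^- 2| <= t ^+ 2 by rewrite -exprVn expr2 [t ^+ 2]expr2; exact: norm_mul_le.
have s4 : `|s ^- 4| <= t ^+ 4.
  have -> : s ^- 4 = s ^- 2 * s ^- 2 by rewrite -invfM -exprD.
  have -> : t ^+ 4 = t ^+ 2 * t ^+ 2 by rewrite -exprD.
  exact: norm_mul_le.
have r2 : `|r ^- 2| <= 9 * t ^+ 2.
  rewrite -exprVn expr2; apply: le_trans (norm_mul_le ri ri) _.
  by rewrite le_eqVlt; apply/orP; left; apply/eqP; ring.
have tt1 : 1 <= t ^+ 2 by rewrite exprn_ege1.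
have w : `|weight nu s| <= A * t ^+ 2.
  have h : `|nu ^+ 2 / 4| <= nu ^+ 2 / 4 * t ^+ 2.
    by rewrite ger0_norm ?divr_ge0 ?exprn_ge0// ler_peMr// divr_ge0 ?exprn_ge0.
  apply: le_trans (norm_add_le h s2) _; rewrite /A.
  by have := sqr_ge0 nu; nra.
split=> //.
have slope q' : `|q'| <= 3 / 2 -> `|radial_slope nu c r s q'| <= A * t ^+ 2.
  move=> hq; have h1 := norm_mul_le hq (norm_mul_le ri si).
  have h0 : `|nu / 2| <= nu / 2 by rewrite ger0_norm// divr_ge0.
  have h2 := norm_mul_le h0 (norm_mul_le cc s2).
  apply: le_trans (norm_sub_le h1 h2) _; rewrite /A.
  have E : 3 / 2 * (3 * t * t) + nu / 2 * (3 * t ^+ 2) = (9 / 2 + 3 / 2 * nu) * t ^+ 2.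
    by field.
  rewrite E ler_wpM2r ?sqr_ge0//; nra.
have hq1 : `|1 / 2 : R| <= 3 / 2 by rewrite ger0_norm; lra.
have hq2 : `|3 / 2 : R| <= 3 / 2 by rewrite ger0_norm; lra.
have h1 : `|- (c * s ^- 4)| <= 3 * t ^+ 4 by rewrite normrN; exact: norm_mul_le.
have h2 := norm_mul_le (norm_sub_le w r2) (slope _ hq1).
have h3 := norm_mul_le r2 (slope _ hq2).
apply: le_trans (norm_add_le (norm_add_le h1 h2) h3) _.
by rewrite le_eqVlt; apply/orP; left; apply/eqP; ring.
Qed.

(** All follows from 2 y (c - 1) = |x|^2 + (y - 1)^2. As c - 1 <= 2, one has y^2 - 6 y + 1 <= 0,
    which places y between 1/6 and 6; then the right-hand side is at most 24 / t^2, below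
    (5/t)^2. *)
Lemma ball_geometry (t : R) p : 1 <= t -> half_space p ->
  t ^+ 2 * (cdist p - 1) <= 2 ->
  [/\ cdist p <= 3, 6^-1 <= p.2 <= 6, (forall i, `|p.1 ord0 i| <= 5 / t) & `|p.2 - 1| <= 5 / t].
Proof.
move=> t1 p0 h2; have c1 := cdist_ge1 p0; set c := cdist p in c1 h2 *.
have t0 : 0 < t by rewrite (lt_le_trans ltr01).
have tt1 : 1 <= t ^+ 2 by rewrite exprn_ege1.
have c3 : c <= 3.
  have : 1 * (c - 1) <= t ^+ 2 * (c - 1) by rewrite ler_wpM2r// subr_ge0.
  lra.
have E : 2 * p.2 * (c - 1) = norm2 p + (p.2 - 1) ^+ 2.
  rewrite /c cdist_sub1// mulrCA divff ?mulr1// mulf_neq0 ?pnatr_eq0// gt_eqF//.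
have n0 := norm2_ge0 p.
have y6 : p.2 <= 6 by move: p0; rewrite /half_space/= => p0; nra.
have y6V : 6^-1 <= p.2 by move: p0; rewrite /half_space/= => p0; nra.
have key (z : R) : z ^+ 2 <= norm2 p + (p.2 - 1) ^+ 2 -> `|z| <= 5 / t.
  move=> hz; rewrite -(@ler_pXn2r _ 2)// ?nnegrE ?divr_ge0 ?(ltW t0)//.
  rewrite real_normK ?num_real// expr_div_n ler_pdivlMr ?exprn_gt0//.
  have : z ^+ 2 * t ^+ 2 <= 2 * p.2 * (c - 1) * t ^+ 2.
    by rewrite ler_wpM2r ?sqr_ge0// E.
  move: p0; rewrite /half_space/= => p0.
  have : 2 * p.2 * (t ^+ 2 * (c - 1)) <= 2 * p.2 * 2 by rewrite ler_wpM2l// mulr_ge0// ltW.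
  lra.
split=> //; first by rewrite y6V.
  move=> i; apply: key; rewrite (le_trans (_ : _ <= norm2 p)) ?lerDl ?sqr_ge0//.
  by rewrite /norm2 (bigD1 i)//= lerDl sumr_ge0// => j _; exact: sqr_ge0.
by apply: key; rewrite lerDr.
Qed.

(** Here s^2 = (c - 1)(c + 1) is comparable to t^-2, and r >= s/c >= s/3. *)
Lemma shell_geometry (t : R) p : 1 <= t -> half_space p ->
  1 <= t ^+ 2 * (cdist p - 1) <= 2 ->
  let c := cdist p in let s := sinh_arcosh c in
  [/\ 1 < c <= 3, s^-1 <= t, (arcosh c)^-1 <= 3 * t & s ^+ 2 * t ^+ 2 <= 9].
Proof.
move=> t1 p0 /andP[h1 h2] c s; have [c3 _ _ _] := ball_geometry t1 p0 h2.
have t0 : 0 < t by rewrite (lt_le_trans ltr01).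
have tt1 : 1 <= t ^+ 2 by rewrite exprn_ege1.
have c1 : 1 < c.
  rewrite lt_neqAle cdist_ge1// andbT; apply: contraTneq h1; rewrite -/c => <-.
  by rewrite subrr mulr0 -ltNge.
have s0 : 0 < s by exact: sinh_arcosh_gt0.
have sE : s ^+ 2 = (c - 1) * (c + 1) by rewrite /s sqr_sinh_arcosh// subr_sqr_1.
have ts : 1 <= t * s.
  rewrite -(@ler_pXn2r _ 2)// ?nnegrE ?mulr_ge0 ?(ltW t0) ?(ltW s0)// expr1n exprMn sE mulrA.
  by move: h1; rewrite -/c => h1; nra.
have sV : s^-1 <= t by rewrite -[leLHS]mul1r ler_pdivrMr.
have rV : (arcosh c)^-1 <= 3 * t.
  have r0 := arcosh_gt0 c1.
  have := sinh_le_arcosh_cosh c1; rewrite -/s => h.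
  rewrite -[leLHS]mul1r ler_pdivrMr// (le_trans ts)//.
  rewrite (le_trans (ler_wpM2l (ltW t0) h))//.
  by have := ler_wpM2l (ltW t0) (ler_wpM2l (ltW r0) c3); rewrite -/c; lra.
have st : s ^+ 2 * t ^+ 2 <= 9.
  rewrite sE mulrC mulrA; move: h2; rewrite -/c => h2.
  have : t ^+ 2 * (c - 1) * (c + 1) <= 2 * (c + 1) by rewrite ler_wpM2r// ; lra.
  by move: c3; rewrite -/c; lra.
by split=> //; rewrite c1.
Qed.

End cutoff_error.

Section cutoff_inequality.
Context {R : realType} {n : nat}.
Implicit Types (p : 'rV[R]_n * R) (v f : 'rV[R]_n * R -> R).
Local Notation dir := (@basis_dir R n).
Local Notation nu := (n%:R : R).

(** The derivative of the cutoff in c is O(t^2). In the sum, the profile times |grad c|^2 is of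
    order t^4 t^-2, and the other terms are also O(t^2). *)
Lemma cutoff_error_le v : (0 < n)%N -> Ckc 2 v ->
  exists2 M, 0 <= M & forall t p, 1 <= t -> half_space p ->
    1 <= t ^+ 2 * (cdist p - 1) <= 2 ->
    dcutoff t p * (\sum_i dcdist i p * calib v i p) <= M * t ^+ 4.
Proof.
move=> n0 [[K K0 hv] cv].
have [C C0 hC] : exists2 C, 0 <= C & forall p, `|v p| <= C.
  by apply: Cc_bounded; split; [exists K|exact: (Ck_on_pred (Ck_on_pred cv))].
have [P P0 hP] : exists2 C, 0 <= C & forall p, `|grad_sq v p| <= C.
  apply: Cc_bounded; split; last exact: (Ck_on_pred (grad_sq_Ck cv)).
  by exists K => //; exact: supported_grad_sq.
have [D D0 hD] := @derive_plateau_bounded R.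
pose A : R := nu ^+ 2 + 10.
pose H : R := 3 + A * A + 18 * A.
have A0 : 0 <= A by rewrite addr_ge0 ?sqr_ge0.
pose M1 := C ^+ 2 * (nu * A * 108 + H * 324) + (2 * A) * (C * ((P + 324) / 2)).
have H0 : 0 <= H by rewrite !addr_ge0// ?mulr_ge0.
have M10 : 0 <= M1.
  have nA : 0 <= nu * A := mulr_ge0 (ler0n _ n) A0.
  have P2 : 0 <= (P + 324) / 2 by exact: divr_ge0 (addr_ge0 P0 (ler0n _ 324)) (ler0n _ 2).
  apply: addr_ge0; last exact: mulr_ge0 (mulr_ge0 (ler0n _ 2) A0) (mulr_ge0 C0 P2).
  apply: (mulr_ge0 (sqr_ge0 C)).
  exact: addr_ge0 (mulr_ge0 nA (ler0n _ 108)) (mulr_ge0 H0 (ler0n _ 324)).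
exists (D * M1); first exact: mulr_ge0.
move=> t p t1 p0 shell.
have [/andP[c1 c3] sV rV st] := shell_geometry t1 p0 shell.
have [_ /andP[y1 y6] _ _] := ball_geometry t1 p0 (andP shell).2.
have t0 : 0 < t by rewrite (lt_le_trans ltr01).
set c := cdist p in c1 c3 sV rV st *; set s := sinh_arcosh c in sV st *.
have s0 : 0 < s by exact: sinh_arcosh_gt0.
have [w hpr] := @profile_bound R n t c (arcosh c) s 0 t1 (arcosh_gt0 c1) s0
  (introT andP (conj (ltW c1) c3)) sV rV.
rewrite -/A -/H in w hpr.
have yV : `|p.2^-1| <= 6.
  by rewrite ger0_norm ?invr_ge0 ?(ltW p0)// -[leRHS]invrK lef_pV2// posrE ?invr_gt0.
pose G := \sum_i dcdist i p ^+ 2.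
(* |grad c|^2 = s^2 / y^2, with s^2 t^2 <= 9 and y >= 1/6, whence 324 = 9 * 36. Its square root 18
   bounds the vertical derivative. *)
have GE : G * t ^+ 2 <= 324.
  rewrite /G sum_dcdist_sq// -/c -sqr_sinh_arcosh// -/s mulrAC.
  have : `|(s ^+ 2 * t ^+ 2) * (p.2^-1 * p.2^-1)| <= 9 * (6 * 6).
    apply: norm_mul_le; last exact: norm_mul_le.
    by rewrite ger0_norm// mulr_ge0 ?sqr_ge0.
  by move=> /(le_trans (ler_norm _)); rewrite -invfM -expr2; lra.
have G0 : 0 <= G by apply: sumr_ge0 => i _; exact: sqr_ge0.
have gN : `|dcdist None p| <= 18.
  rewrite -(@ler_pXn2r _ 2)// ?nnegrE// real_normK ?num_real//.
  have h : dcdist None p ^+ 2 <= G by rewrite /G big_option/= lerDl sumr_ge0// => j _; exact: sqr_ge0.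
  rewrite (le_trans h)//; have : G * 1 <= G * t ^+ 2 by rewrite ler_wpM2l// exprn_ege1.
  lra.
pose Q := \sum_i partial i v p * dcdist i p.
have hQ : `|Q| * t <= (P + 324) / 2.
  (* The factor t goes to the derivatives of c before the arithmetic-geometric inequality, since it
     is t |grad c| that is bounded. *)
  have : \sum_i `|partial i v p * dcdist i p| * t <=
      \sum_i (1 / 2 * partial i v p ^+ 2 + t ^+ 2 / 2 * dcdist i p ^+ 2).
    apply: ler_sum => i _; rewrite normrM -[partial i v p ^+ 2]real_normK ?num_real//.
    rewrite -[dcdist i p ^+ 2]real_normK ?num_real//.
    set a := `|_|; set b := `|_|.
    have := sqr_ge0 (a - t * b); lra.
  rewrite -mulr_suml big_split /= -!mulr_sumr -/(grad_sq v p) -/G => h.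
  have h1 : `|Q| * t <= (\sum_i `|partial i v p * dcdist i p|) * t.
    by rewrite ler_wpM2r ?(ltW t0)// ler_norm_sum.
  have := le_trans (ler_norm _) (hP p); move: h1 h GE.
  by set x := (\sum_i _); lra.
have hQ' : `|Q| <= (P + 324) / 2.
  by apply: le_trans hQ; rewrite ler_peMr.
have -> : \sum_i dcdist i p * calib v i p =
    v p ^+ 2 * (- (nu - 1) / 2 * (weight_of nu c * p.2^-1) * dcdist None p + profile_of nu c * G)
    - (weight_of nu c + (1 / 2 - nu ^+ 2 / 4)) * (v p * Q).
  rewrite /calib -/c.
  have E i : dcdist i p * (v p ^+ 2 * ((i == None)%:R * (- (nu - 1) / 2) * (weight_of nu c * p.2^-1)
      + profile_of nu c * dcdist i p)
      - (weight_of nu c + (1 / 2 - nu ^+ 2 / 4)) * (v p * partial i v p)) =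
    v p ^+ 2 * (- (nu - 1) / 2) * (weight_of nu c * p.2^-1) * ((i == None)%:R * dcdist i p)
    + v p ^+ 2 * profile_of nu c * dcdist i p ^+ 2
    - (weight_of nu c + (1 / 2 - nu ^+ 2 / 4)) * v p * (partial i v p * dcdist i p) by ring.
  under eq_bigr => i _ do rewrite E.
  rewrite !big_split /= sumrN -!mulr_sumr -/G -/Q.
  have -> : \sum_(i : option 'I_n) (i == None)%:R * dcdist i p = dcdist None p.
    by rewrite big_option/= mul1r big1 ?addr0// => j _; rewrite mul0r.
  by rewrite -[1 - cdist p / p.2]/(dcdist None p); ring.
have tt1 : 1 <= t ^+ 2 by rewrite exprn_ege1.
have hnu : `|- (nu - 1) / 2| <= nu.
  have nu1 : 1 <= nu by rewrite (ler_nat _ 1).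
  rewrite normrM normrN !ger0_norm ?invr_ge0 ?subr_ge0//; lra.
have h1 := norm_mul_le (norm_mul_le hnu (norm_mul_le w yV)) gN.
have h2 : `|profile_of nu c * G| <= H * 324 * t ^+ 2.
  rewrite normrM (ger0_norm G0) (le_trans (ler_wpM2r G0 hpr))//.
  rewrite (_ : t ^+ 4 = t ^+ 2 * t ^+ 2) -?exprD//.
  have := ler_wpM2l (mulr_ge0 H0 (sqr_ge0 t)) GE; rewrite exprD; lra.
have hb : `|1 / 2 - nu ^+ 2 / 4| <= A * t ^+ 2.
  apply: (@le_trans _ _ (1 / 2 + nu ^+ 2 / 4)).
    by apply: norm_sub_le; rewrite ger0_norm// divr_ge0// sqr_ge0.
  apply: (@le_trans _ _ A); last by rewrite ler_peMr.
  by rewrite /A; have := sqr_ge0 nu; lra.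
have v2 : `|v p ^+ 2| <= C ^+ 2 by rewrite !expr2; exact: norm_mul_le.
have h3 := norm_mul_le (norm_add_le w hb) (norm_mul_le (hC p) hQ').
have h4 := norm_sub_le (norm_mul_le v2 (norm_add_le h1 h2)) h3.
have hd : `|dcutoff t p| <= t ^+ 2 * D.
  apply: norm_mul_le; first by rewrite ger0_norm ?sqr_ge0.
  by apply: hD; move: shell; rewrite subr_ge0 lerBlDr => /andP[-> h]; rewrite /=; lra.
apply: le_trans (ler_norm _) _; apply: le_trans (norm_mul_le hd h4) _.
by rewrite le_eqVlt; apply/orP; left; apply/eqP; rewrite /M1; field.
Qed.

Definition cut_potential (t : R) v p : R :=
  cutoff t p * (hr_potential p * (v p ^+ 2 / p.2 ^+ 2)).

Lemma Ck_on_hr_potential k : Ck_on dir k punctured (@hr_potential R n).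
Proof.
have o := @open_punctured R n; have cst b := Ck_on_const dir k (b : R) o.
have rV m : Ck_on dir k punctured (fun p => arcosh (cdist p) ^- m).
  exact: (@Ck_on_cdist_comp R n k (fun c => arcosh c ^- m) (Ck1_arcoshV k m)).
exact: (Ck_on_add o (Ck_on_add o (cst ((nu ^+ 2 - 1) / 16)) (Ck_on_mul o (cst (nu ^+ 2 / 16)) (rV 2)))
  (Ck_on_mul o (cst (9 / 16)) (rV 4))).
Qed.

Lemma Ck_on_sqr_over_height k m v : Ck_on dir k half_space v ->
  Ck_on dir k half_space (fun p => v p ^+ 2 / p.2 ^+ m).
Proof.
move=> cv; have o := @open_half_space R n.
apply: (@Ck_on_eq _ _ _ _ _ _ (fun p => v p ^+ 2 * (p.2^-1) ^+ m)) => //.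
  by move=> p _; rewrite exprVn.
exact: (Ck_on_mul o (Ck_on_exp 2 o cv) (Ck_on_exp m o (Ck_on_sndV k))).
Qed.

Lemma Cc_cutoff_weight t (phi : 'rV[R]_n * R -> R) v m : Ckc 2 v -> Ck_on dir 0 punctured phi ->
  Cc (fun p => cutoff t p * (phi p * (v p ^+ 2 / p.2 ^+ m))).
Proof.
move=> [[K K0 hv] cv] cphi; apply: (@Cc_mul_cutoff _ _ K t v (fun p => phi p * (v p ^+ 2 / p.2 ^+ m)) K0 hv).
  by move=> p ->; rewrite expr0n !mul0r mulr0.
apply: (Ck_on_mul (@open_punctured R n) cphi).
apply: (@Ck_on_subset _ _ _ _ _ half_space); first by move=> p [].
exact: (Ck_on_sqr_over_height m (Ck_on_pred (Ck_on_pred cv))).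
Qed.

(** The error, at most M t^4, lives in a box of side 10/t in dimension n + 1. Its integral is of
    order t^(3 - n), hence O(1/t) for n >= 4. *)
Lemma hint_cut_potential_le v : (3 < n)%N -> Ckc 2 v ->
  exists M, forall t, 1 <= t -> hint (cut_potential t v) <= hint (hr_energy v) + M / t.
Proof.
move=> n3 Cv; have [_ cv] := Cv.
have [M M0 hM] := cutoff_error_le (ltn_trans (isT : (0 < 3)%N) n3) Cv.
exists (10 ^+ n.+1 * M) => t t1; have t0 : 0 < t by rewrite (lt_le_trans ltr01).
have CP : Cc (cut_potential t v) by apply: Cc_cutoff_weight => //; exact: Ck_on_hr_potential.
have [CD D0] := Cc_cut_divergence t Cv.
have CE := Cc_hr_energy Cv.
pose F := (cut_potential t v \+ cut_divergence t v) \+ (fun p => -1 * hr_energy v p).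
have CF : Cc F by apply: CcD; [exact: CcD|exact: CcZ].
have -> : hint (cut_potential t v) = hint F + hint (hr_energy v).
  rewrite /F hintD; [|exact: CcD|exact: CcZ].
  by rewrite hintD// D0 addr0 hintZ// mulN1r subrK.
rewrite addrC lerD2l.
have e0 : 0 < 5 / t by rewrite divr_gt0.
apply: (@le_trans _ _ ((5 / t - - (5 / t)) ^+ n *
    (M * t ^+ 4 * (1 + 5 / t) - M * t ^+ 4 * (1 - 5 / t)))).
  apply: (@hint_le_box _ _ F _ _ _ _ (fun=> M * t ^+ 4) (fun y => M * t ^+ 4 * y)) => //.
  - by rewrite lerNl (le_trans _ (ltW e0))// oppr_le0 ltW.
  - by rewrite ltrD2l (lt_trans _ e0)// oppr_lt0.
  - move=> y _; split; last exact: cvg_cst.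
    apply: (is_derive_eq (is_derive_mul (is_derive_const y 1 (M * t ^+ 4)) (is_derive_id y 1))).
    by rewrite mul0r add0r mulr1.
  - move=> x y; have R0 : 0 <= (if `[< (forall i, - (5 / t) <= x ord0 i <= 5 / t) /\
        1 - 5 / t <= y <= 1 + 5 / t >] then M * t ^+ 4 else 0).
      by case: ifP => // _; rewrite mulr_ge0 ?exprn_ge0 ?(ltW t0).
    have [p0|pN] := pselect (half_space (x, y)); last first.
      have [[K K0 hF] _] := CF.
      by rewrite (nbhs_singleton (supported_near0N K0 hF pN)).
    have := cut_divergence_le t n3 cv p0; rewrite -mulrA => h.
    rewrite /F /= mulN1r lerBlDl (le_trans h)// lerD2l.
    case: ifP => // hs; apply: (le_trans (hM _ _ t1 p0 hs)).
    have [_ _ hx hy] := ball_geometry t1 p0 (andP hs).2.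
    case: asboolP => // -[]; split; first by move=> i; have := hx i; rewrite ler_norml.
    by move: hy; rewrite ler_distl.
rewrite opprK (_ : 5 / t + 5 / t = 10 / t); last by field; rewrite gt_eqF.
rewrite (_ : M * t ^+ 4 * (1 + 5 / t) - M * t ^+ 4 * (1 - 5 / t) = 10 * M * t ^+ 4 / t); last first.
  by field; rewrite gt_eqF.
rewrite expr_div_n.
rewrite (_ : 10 ^+ n / t ^+ n * _ = 10 ^+ n.+1 * M / t * (t ^+ 4 / t ^+ n)); last first.
  have tn0 : t != 0 by rewrite gt_eqF.
  by rewrite [10 ^+ n.+1]exprS; field; rewrite tn0 expf_neq0.
rewrite ler_piMr ?mulr_ge0 ?exprn_ge0 ?invr_ge0 ?(ltW t0)//.
by rewrite ler_pdivrMr ?exprn_gt0// mul1r ler_weXn2l.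
Qed.

End cutoff_inequality.

(** * Inequality (A) *)

Section hardy_rellich.
Context {R : realType} {n : nat}.
Implicit Types (p : 'rV[R]_n * R) (v f : 'rV[R]_n * R -> R).
Local Notation dir := (@basis_dir R n).
Local Notation nu := (n%:R : R).

Lemma Cc_sqr_over_height m v : Ckc 1 v -> Cc (fun p => v p ^+ 2 / p.2 ^+ m).
Proof.
move=> [[K K0 hv] cv]; split; last exact: (Ck_on_sqr_over_height m (Ck_on_pred cv)).
exists K => //; apply: supported_sub hv _ => p; apply: contraNN => /eqP ->.
by rewrite expr0n mul0r.
Qed.

(** A bounded function, of which the cutoff removes only the part in a box of side 10/t. *)
Lemma hint_near_pole f : Cc f -> (forall p, 0 <= f p) -> (0 < n)%N ->
  exists M, forall t, 1 <= t ->
    hint f <= hint (fun p => cutoff t p * f p) + M / t.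
Proof.
move=> cf f0 n0; have [M M0 hM] := Cc_bounded cf.
exists (10 ^+ n.+1 * M) => t t1; have t0 : 0 < t by rewrite (lt_le_trans ltr01).
have cft : Cc (fun p => cutoff t p * f p).
  apply: (Cc_sub cf); first by move=> p; apply: contraNN => /eqP ->; rewrite mulr0.
  move=> p p0; apply: cvgM; last exact: cf.2.
  exact: (Ck_on_continuous (Ck_on_cutoff 0 t) p0).
have cg : Cc (f \+ (fun p => -1 * (cutoff t p * f p))) by apply: CcD => //; exact: CcZ.
have -> : hint f = hint (f \+ (fun p => -1 * (cutoff t p * f p))) + hint (fun p => cutoff t p * f p).
  by rewrite hintD//; [rewrite hintZ// mulN1r subrK|exact: CcZ].
rewrite addrC lerD2l.
have e0 : 0 < 5 / t by rewrite divr_gt0.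
apply: (@le_trans _ _ ((5 / t - - (5 / t)) ^+ n * (M * (1 + 5 / t) - M * (1 - 5 / t)))).
  apply: (@hint_le_box _ _ _ _ _ _ _ (fun=> M) (fun y => M * y)) => //.
  - by rewrite lerNl (le_trans _ (ltW e0))// oppr_le0 ltW.
  - by rewrite ltrD2l (lt_trans _ e0)// oppr_lt0.
  - move=> y _; split; last exact: cvg_cst.
    apply: (is_derive_eq (is_derive_mul (is_derive_const y 1 M) (is_derive_id y 1))).
    by rewrite mul0r add0r mulr1.
  - move=> x y; have R0 : 0 <= (if `[< (forall i, - (5 / t) <= x ord0 i <= 5 / t) /\
        1 - 5 / t <= y <= 1 + 5 / t >] then M else 0) by case: ifP.
    have [p0|pN] := pselect (half_space (x, y)); last first.
      have [[K K0 hF] _] := cg.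
      by rewrite (nbhs_singleton (supported_near0N K0 hF pN)).
    have [hs|hs] := leP (t ^+ 2 * (cdist (x, y) - 1)) 2; last first.
      rewrite /= /cutoff plateau_ge1; last by rewrite lerBrDr -mulr2n ltW.
      by rewrite mul1r mulN1r subrr.
    have [_ _ hx hy] := ball_geometry t1 p0 hs.
    case: asboolP => [_|[]]; last first.
      by split; [move=> i; have := hx i; rewrite ler_norml|move: hy; rewrite ler_distl].
    rewrite /= mulN1r (le_trans _ (le_trans (ler_norm _) (hM (x, y))))// lerBlDr lerDl.
    by rewrite mulr_ge0 ?cutoff_ge0.
rewrite opprK (_ : 5 / t + 5 / t = 10 / t); last by field; rewrite gt_eqF.
rewrite (_ : M * (1 + 5 / t) - M * (1 - 5 / t) = 10 * M / t); last first.
  by field; rewrite gt_eqF.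
rewrite expr_div_n.
have tn0 : t != 0 by rewrite gt_eqF.
rewrite (_ : 10 ^+ n / t ^+ n * _ = 10 ^+ n.+1 * M / t * (t ^+ n)^-1); last first.
  by rewrite [10 ^+ n.+1]exprS; field; rewrite tn0 expf_neq0.
rewrite ler_piMr ?mulr_ge0 ?exprn_ge0 ?invr_ge0 ?(ltW t0)//.
by rewrite invf_le1 ?exprn_gt0// exprn_ege1.
Qed.

Lemma cutoff_weight_cvg v m : (0 < m)%N -> Ckc 2 v ->
  (hint (fun p => cutoff k.+1%:R p * (arcosh (cdist p) ^- m * (v p ^+ 2 / p.2 ^+ 2))))%:E
    @[k --> \oo] -->
  (\iint_(x, y) (v (x, y) ^+ 2 / (y ^+ 2 * hyp_dist x y ^+ m)))%E.
Proof.
move=> m0 Cv; apply: hint_monotone_cvg.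
- move=> k; apply: Cc_cutoff_weight => //.
  exact: (@Ck_on_cdist_comp R n 0 (fun c => arcosh c ^- m) (Ck1_arcoshV 0 m)).
- move=> k p; have [p0|pN] := pselect (half_space p); last first.
    have [[K K0 hv] _] := Cv.
    by rewrite (nbhs_singleton (supported_near0N K0 hv pN)) expr0n !mul0r !mulr0.
  rewrite mulr_ge0 ?cutoff_ge0// mulr_ge0// ?divr_ge0 ?sqr_ge0//.
  rewrite invr_ge0 exprn_ge0// arcosh_ge0// cdist_ge1//.
- move=> p k l kl; have [p0|pN] := pselect (half_space p); last first.
    have [[K K0 hv] _] := Cv.
    by rewrite (nbhs_singleton (supported_near0N K0 hv pN)) expr0n !mul0r !mulr0.
  have c1 := cdist_ge1 p0.
  rewrite ler_wpM2r//.
    by rewrite mulr_ge0// ?divr_ge0 ?sqr_ge0// invr_ge0 exprn_ge0// arcosh_ge0.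
  rewrite le_plateau// lerD2r ler_wpM2r ?subr_ge0//.
  by rewrite lerXn2r ?nnegrE// ler_nat.
- move=> x y y0; have p0 : half_space (x, y) by [].
  rewrite hyp_distE//; have := cdist_ge1 p0; rewrite le_eqVlt => /predU1P[c1|c1].
    (* At the pole both sides are 0: the distance vanishes, m > 0, and the inverse of 0 is 0. *)
    rewrite /= -c1 arcosh1 expr0n gtn_eqF//= !mulr0 invr0 mulr0.
    by under eq_fun do rewrite mul0r mulr0; exact: cvg_cst.
  set w := arcosh (cdist (x, y)) ^- m * (v (x, y) ^+ 2 / y ^+ 2).
  rewrite (_ : v (x, y) ^+ 2 / _ = 1 * w); last by rewrite mul1r /w invfM mulrA mulrC.
  apply: (@cvgM R _ _ _ (fun k => cutoff k.+1%:R (x, y)) (fun=> w)); last exact: cvg_cst.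
  apply: (@cvg_near_cst _ _ (1 : R)).
  have [N hN] : exists N, forall k, (N <= k)%N -> 2 <= (k.+1%:R : R) ^+ 2 * (cdist (x, y) - 1).
    pose e := (cdist (x, y) - 1); have e0 : 0 < e by rewrite subr_gt0.
    have [N _ hN] := near_infty_natSinv_lt (PosNum (divr_gt0 e0 (ltr0n R 2))).
    exists N => k /hN /=; rewrite -/e => h.
    have k0 : (0 : R) < k.+1%:R by [].
    have : 2 <= k.+1%:R * e.
      by move: h; rewrite -[X in X < _]mulr1 ltr_pdivrMl//; lra.
    move=> h2; rewrite (le_trans h2)// ler_wpM2r// ?(ltW e0)// expr2 ler_peMr//.
    by rewrite (ler_nat _ 1).
  exists N => // k /= /hN h; rewrite /cutoff plateau_ge1// lerBrDr -mulr2n.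
  exact: h.
Qed.

Lemma half_space_integral_ge0 (f : 'rV[R]_n -> R -> R) :
  (forall x y, 0 < y -> 0 <= f x y) -> (0 <= half_space_integral f)%E.
Proof.
move=> f0; apply: integral_ge0 => y; rewrite /= in_itv/= andbT => y0.
by apply: integral_ge0 => t _; rewrite lee_fin f0.
Qed.

(** The integrals with d in the denominator are not known to be finite beforehand. The inequality is
    therefore proved for their cut-off versions, which are real ([key]), and the limit is taken in
    the extended reals. The term without d is finite and is restored by [hint_near_pole]. *)
Lemma hardy_rellich v : (3 < n)%N -> Ckc 2 v ->
  (((nu ^+ 2 - 1) / 16)%:E * \iint_(x, y) (v (x, y) ^+ 2 / y ^+ 2) +
   (nu ^+ 2 / 16)%:E * \iint_(x, y) (v (x, y) ^+ 2 / (y ^+ 2 * hyp_dist x y ^+ 2)) +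
   (9 / 16)%:E * \iint_(x, y) (v (x, y) ^+ 2 / (y ^+ 2 * hyp_dist x y ^+ 4))
   <= (hint (hr_energy v))%:E)%E.
Proof.
move=> n3 Cv; have [[K K0 hv] cv] := Cv.
have nu4 : 4 <= nu by rewrite (ler_nat _ 4).
have Cv1 : Ckc 1 v by split; [exists K|exact: (Ck_on_pred cv)].
pose w p := v p ^+ 2 / p.2 ^+ 2.
have Cw : Cc w by exact: Cc_sqr_over_height.
rewrite (half_space_integralE Cw).
set J2 := half_space_integral _; set J4 := half_space_integral _.
pose u m k p := cutoff k.+1%:R p * (arcosh (cdist p) ^- m * w p).
have Cu m k : Cc (u m k).
  by apply: Cc_cutoff_weight => //; exact: (@Ck_on_cdist_comp R n 0 (fun c => arcosh c ^- m) (Ck1_arcoshV 0 m)).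
have h2 : (hint (u 2 k))%:E @[k --> \oo] --> J2 by exact: cutoff_weight_cvg.
have h4 : (hint (u 4 k))%:E @[k --> \oo] --> J4 by exact: cutoff_weight_cvg.
have J20 : (0 <= J2)%E.
  by apply: half_space_integral_ge0 => x y y0; rewrite divr_ge0 ?sqr_ge0// mulr_ge0 ?sqr_ge0.
have J40 : (0 <= J4)%E.
  apply: half_space_integral_ge0 => x y y0; rewrite divr_ge0 ?sqr_ge0// mulr_ge0 ?sqr_ge0//.
  by rewrite exprn_even_ge0.
have w0 : 0 <= hint w.
  rewrite -lee_fin -(half_space_integralE Cw).
  by apply: half_space_integral_ge0 => x y y0; rewrite divr_ge0 ?sqr_ge0.
have c0 : 0 <= (nu ^+ 2 - 1) / 16 by rewrite divr_ge0// subr_ge0; nra.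
have [M1 hM1] : exists M, forall t, 1 <= t -> hint w <= hint (fun p => cutoff t p * w p) + M / t.
  apply: hint_near_pole => //; first by move=> p; rewrite divr_ge0 ?sqr_ge0.
  exact: ltn_trans n3.
have [M2 hM2] := hint_cut_potential_le n3 Cv.
pose M := (nu ^+ 2 - 1) / 16 * M1 + M2.
have key k : (nu ^+ 2 - 1) / 16 * hint w + nu ^+ 2 / 16 * hint (u 2 k) + 9 / 16 * hint (u 4 k)
    <= hint (hr_energy v) + M / k.+1%:R.
  have t1 : 1 <= k.+1%:R :> R by rewrite (ler_nat _ 1).
  have := hM1 _ t1; have := hM2 _ t1.
  have Cc0 : Cc (fun p => cutoff k.+1%:R p * w p).
    apply: (Cc_sub Cw); first by move=> p; apply: contraNN => /eqP ->; rewrite mulr0.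
    by move=> p p0; apply: cvgM; [exact: (Ck_on_continuous (Ck_on_cutoff 0 _) p0)|exact: Cw.2].
  have -> : cut_potential k.+1%:R v =
     ((fun p => (nu ^+ 2 - 1) / 16 * (cutoff k.+1%:R p * w p)) \+
     (fun p => nu ^+ 2 / 16 * u 2 k p)) \+ (fun p => 9 / 16 * u 4 k p).
    by apply/funext => p; rewrite /cut_potential /hr_potential /u /= -/(w p); ring.
  rewrite hintD; [|by apply: CcD; exact: CcZ|exact: CcZ].
  rewrite hintD; [|exact: CcZ|exact: CcZ].
  rewrite !hintZ// => hE hW.
  have {}hE : (nu ^+ 2 - 1) / 16 * hint (fun p => cutoff k.+1%:R p * w p) +
    nu ^+ 2 / 16 * hint (u 2 k) + 9 / 16 * hint (u 4 k) <=
    hint (hr_energy v) + M2 / k.+1%:R := hE.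
  have := ler_wpM2l c0 hW; rewrite /M; move: hE.
  set X := hint (fun p => _); set W := hint w; set U2 := hint (u 2 k).
  set U4 := hint (u 4 k); set E := hint (hr_energy v).
  generalize ((nu ^+ 2 - 1) / 16) => c.
  rewrite [(c * M1 + M2) / _]mulrDl mulrDr mulrA; set x : R := M2 / _; set z : R := c * M1 / _ => hx hz.
  rewrite -addrA; apply: le_trans (lerD hz (lexx _)) _.
  by rewrite addrAC [z + x]addrC [leRHS]addrA lerD2r addrA.
apply: (@cvge_to_le _ \oo _ _ (fun k => (((nu ^+ 2 - 1) / 16)%:E * (hint w)%:E +
   (nu ^+ 2 / 16)%:E * (hint (u 2 k))%:E + (9 / 16)%:E * (hint (u 4 k))%:E -
   (M / k.+1%:R)%:E)%E)); last first.
  by apply: nearW => k; rewrite -!EFinM -!EFinD lee_fin lerBlDr.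
rewrite -[X in _ --> X]sube0.
have c2 : 0 <= nu ^+ 2 / 16 by rewrite divr_ge0 ?sqr_ge0.
apply: cvgeB; [by rewrite fin_num_adde_defl| |]; last first.
  apply: cvg_EFin; first exact: nearW.
  rewrite -[X in _ --> X](mulr0 M).
  by apply: cvgM; [exact: cvg_cst|exact: cvg_harmonic].
apply: cvgeD.
- apply: ge0_adde_def; rewrite inE; last by apply: mule_ge0 => //; rewrite lee_fin.
  by apply: adde_ge0; [rewrite -EFinM lee_fin; exact: mulr_ge0|apply: mule_ge0; rewrite ?lee_fin].
- apply: cvgeD; [|exact: cvg_cst|exact: cvgeZl].
  by rewrite -EFinM; apply: fin_num_adde_defr.
- exact: cvgeZl.
Qed.

End hardy_rellich.

(** * Integral identities *)

Section symmetry_of_second_derivatives.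
Context {R : realType} {V : normedModType R} {I : Type}.
Variable dir : I -> V.
Implicit Types (f : V -> R) (U : set V).

(** The mean value theorem twice: along i for the increment in direction j, then along j for the
    derivative in direction i. The second difference becomes h^2 times the mixed derivative at an
    intermediate point, and continuity at p concludes. *)
Let second_difference U f i j p (e : R) : open U -> Ck_on dir 2 U f -> U p -> 0 < e ->
  exists2 d : R, 0 < d & forall h : R, 0 < h < d ->
    `|f (p + h *: dir i + h *: dir j) - f (p + h *: dir i) - f (p + h *: dir j) + f p
      - h ^+ 2 * 'D_(dir j) (fun q => 'D_(dir i) f q) p| <= e * h ^+ 2.
Proof.
move=> oU cf Up e0; set g := fun q => 'D_(dir i) f q; set k := fun q => 'D_(dir j) g q.
have cg : Ck_on dir 1 U g by exact: (Ck_on_derive i cf).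
have ck : {for p, continuous k} by exact: (Ck_on_continuous (Ck_on_derive j cg) Up).
have : \forall q \near p, U q /\ `|k p - k q| < e.
  apply: filterI; first exact: open_nbhs_nbhs (conj oU Up).
  by move/cvgrPdist_lt : ck; apply.
move=> /nbhs_ballP[r /= r0 hr].
pose L := `|dir i| + `|dir j| + 1.
have L0 : 0 < L by rewrite ltr_wpDl// addr_ge0.
exists (r / L); first exact: divr_gt0.
move=> h /andP[h0 hrL].
have inU s t : 0 <= s <= h -> 0 <= t <= h ->
    U (p + s *: dir i + t *: dir j) /\ `|k p - k (p + s *: dir i + t *: dir j)| < e.
  move=> /andP[s0 sh] /andP[t0 th]; apply: hr; rewrite -ball_normE /ball_/=.
  rewrite -addrA opprD addrA subrr add0r normrN.
  rewrite (le_lt_trans (ler_normD _ _))// !normrZ (ger0_norm s0) (ger0_norm t0).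
  rewrite (@le_lt_trans _ _ (h * L))// -?ltr_pdivlMr//.
  rewrite /L !mulrDr mulr1 (@le_trans _ _ (h * `|dir i| + h * `|dir j|)) ?lerDl ?(ltW h0)//.
  by rewrite lerD// ler_wpM2r.
have h00 : 0 <= h <= h by rewrite (ltW h0) lexx.
have z0 : (0 : R) <= 0 <= h by rewrite lexx (ltW h0).
pose phi s := f (p + s *: dir i + h *: dir j) - f (p + s *: dir i).
have dphi s : 0 <= s <= h -> is_derive s 1 phi
    (g (p + s *: dir i + h *: dir j) - g (p + s *: dir i)).
  move=> hs; apply: is_derive_sub.
    apply: (@is_derive_affine _ R V R f (fun s => p + s *: dir i + h *: dir j) s 1 (dir i)).
      by move=> z; rewrite [z *: 1]mulr1 scalerDl [p + (_ + _)]addrCA -!addrA.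
    exact: (Ck_on_is_derive i cf (inU s h hs h00).1).
  apply: (@is_derive_affine _ R V R f (fun s => p + s *: dir i) s 1 (dir i)).
    by move=> z; rewrite [z *: 1]mulr1 scalerDl addrCA.
  have := (inU s 0 hs z0).1; rewrite scale0r addr0 => Us.
  exact: (Ck_on_is_derive i cf Us).
have [||s hs phiE] := @MVT R phi (fun s => g (p + s *: dir i + h *: dir j) - g (p + s *: dir i)) 0 h h0.
- by move=> s; rewrite in_itv/= => /andP[/ltW s0 /ltW sh]; apply: dphi; rewrite s0.
- apply: continuous_in_subspaceT => s; rewrite inE/= in_itv/= => hs.
  by apply: differentiable_continuous; apply/derivable1_diffP; case: (dphi s hs).
have {}hs : 0 <= s <= h by move: hs; rewrite in_itv/= => /andP[/ltW -> /ltW ->].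
pose psi t := g (p + s *: dir i + t *: dir j).
have dpsi t : 0 <= t <= h -> is_derive t 1 psi (k (p + s *: dir i + t *: dir j)).
  move=> ht; apply: (@is_derive_affine _ R V R g (fun t => p + s *: dir i + t *: dir j) t 1 (dir j)).
    by move=> z; rewrite [z *: 1]mulr1 scalerDl addrCA.
  exact: (Ck_on_is_derive j cg (inU s t hs ht).1).
have [||t ht psiE] := @MVT R psi (fun t => k (p + s *: dir i + t *: dir j)) 0 h h0.
- by move=> t; rewrite in_itv/= => /andP[/ltW t0 /ltW th]; apply: dpsi; rewrite t0.
- apply: continuous_in_subspaceT => t; rewrite inE/= in_itv/= => ht.
  by apply: differentiable_continuous; apply/derivable1_diffP; case: (dpsi t ht).
have {}ht : 0 <= t <= h by move: ht; rewrite in_itv/= => /andP[/ltW -> /ltW ->].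
move: psiE phiE; rewrite /psi /phi !scale0r !addr0 subr0 => -> phiE.
have -> : f (p + h *: dir i + h *: dir j) - f (p + h *: dir i) - f (p + h *: dir j) + f p =
    h ^+ 2 * k (p + s *: dir i + t *: dir j).
  by rewrite -addrA [- _ + f p]addrC -[f p - _]opprB phiE; ring.
rewrite -mulrBr normrM ger0_norm ?sqr_ge0// mulrC ler_wpM2r ?sqr_ge0//.
by rewrite distrC ltW// (inU s t hs ht).2.
Qed.

(** The second difference is symmetric in i and j. If the mixed derivatives A and B differed,
    precision |A - B| / 4 on each would give |A - B| <= |A - B| / 2. *)
Lemma derive_comm U f i j p : open U -> Ck_on dir 2 U f -> U p ->
  'D_(dir j) (fun q => 'D_(dir i) f q) p = 'D_(dir i) (fun q => 'D_(dir j) f q) p.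
Proof.
have quarter (z : R) : 0 < z / 4 -> z <= z / 4 + z / 4 -> False by lra.
move=> oU cf Up; set A := LHS; set B := RHS; apply/eqP/negPn/negP => AB.
have e0 : 0 < `|A - B| / 4 by rewrite divr_gt0// normr_gt0 subr_eq0.
have [d d0 hd] := second_difference i j oU cf Up e0.
have [d' d'0 hd'] := second_difference j i oU cf Up e0.
pose h := Num.min d d' / 2.
have m0 : 0 < Num.min d d' by rewrite lt_min d0.
have h0 : 0 < h by rewrite divr_gt0.
have hm : h < Num.min d d' by rewrite /h ltr_pdivrMr// ltr_pMr// ltr1n.
have h1 := hd h; rewrite h0 (lt_le_trans hm) ?ge_min ?lexx// in h1.
have h2 := hd' h; rewrite h0 (lt_le_trans hm) ?ge_min ?lexx ?orbT// in h2.
have {h1} := h1 isT; have {h2} := h2 isT; rewrite -/A -/B.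
rewrite (_ : p + h *: dir j + h *: dir i = p + h *: dir i + h *: dir j); last by rewrite addrAC.
set a := f (_ + _ + _); set b := f (p + _ *: dir j); set c := f (p + _) => h2 h1.
have hh : 0 < h ^+ 2 by rewrite exprn_gt0.
have : `|h ^+ 2 * (A - B)| <= `|A - B| / 4 * h ^+ 2 + `|A - B| / 4 * h ^+ 2.
  move: h1 h2; move: (`|A - B| / 4 * h ^+ 2) => E.
  clearbody A B a b c; move: (h ^+ 2) (f p) => H fp h1 h2.
  have -> : H * (A - B) = (a - b - c + fp - H * B) - (a - c - b + fp - H * A) by ring.
  exact: (le_trans (ler_normB _ _) (lerD h2 h1)).
rewrite normrM (gtr0_norm hh) -mulrDl mulrC ler_pM2r//.
exact: quarter.
Qed.

End symmetry_of_second_derivatives.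

Section integral_identities.
Context {R : realType} {n : nat}.
Implicit Types (p : 'rV[R]_n * R) (v w f : 'rV[R]_n * R -> R).
Local Notation dir := (@basis_dir R n).
Local Notation nu := (n%:R : R).
Local Notation o := (@open_half_space R n).

Lemma hint_derive_eq0 i f : Ckc 1 f ->
  Cc (fun p => 'D_(dir i) f p) /\ hint (fun p => 'D_(dir i) f p) = 0.
Proof.
move=> Cf; have [[K K0 hf] cf] := Cf.
have C0 : Cc f by split; [exists K|exact: (Ck_on_pred cf)].
have Cd : Cc (fun p => 'D_(dir i) f p).
  by split; [exists K => //; exact: (supported_partial (i := i) K0 hf)|exact: (Ck_on_derive i cf)].
split=> //; apply: (hint_partial_eq0 C0 Cd) => p p0.
exact: (Ck_on_is_derive i cf p0).
Qed.

Lemma hint_sum_derive_eq0 (F : option 'I_n -> 'rV[R]_n * R -> R) :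
  (forall i, Ckc 1 (F i)) ->
  Cc (fun p => \sum_i 'D_(dir i) (F i) p) /\ hint (fun p => \sum_i 'D_(dir i) (F i) p) = 0.
Proof.
move=> CF; elim: (index_enum _) => [|i s [IH1 IH2]].
  split; under eq_fun do rewrite big_nil.
    split; last by move=> p _; exact: cvg_cst.
    by exists 1 => // p /eqP.
  by rewrite /hint Rintegral_cst//= mul0r.
have [C1 H1] := hint_derive_eq0 i (CF i).
have E : (fun p => \sum_(j <- i :: s) 'D_(dir j) (F j) p) =
  (fun p => 'D_(dir i) (F i) p) \+ (fun p => \sum_(j <- s) 'D_(dir j) (F j) p).
  by apply/funext => p; rewrite big_cons.
by rewrite E hintD// H1 IH2 addr0; split=> //; exact: CcD.
Qed.

Lemma hint_eq f g : Cc f -> Cc g -> (forall p, half_space p -> f p = g p) -> hint f = hint g.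
Proof.
move=> cf cg fg; apply/eqP; rewrite eq_le; apply/andP; split; apply: le_hint => // p /fg ->//.
Qed.

Definition energy (c : R) v p : R := p.2 ^+ 2 * laplacian v p ^+ 2 + c * grad_sq v p.

Lemma Cc_energy c v : Ckc 2 v -> Cc (energy c v).
Proof.
move=> [[K K0 hv] cv]; split.
  exists K => //; apply: (supported_combination (supported_laplacian K0 hv) (supported_grad_sq K0 hv)).
  by move=> p; rewrite /energy => -> ->; rewrite expr0n !mulr0 addr0.
have cst b := Ck_on_const dir 0 (b : R) o.
exact: (Ck_on_add o (Ck_on_mul o (Ck_on_exp 2 o (Ck_on_snd 0 o)) (Ck_on_exp 2 o (laplacian_Ck cv)))
  (Ck_on_mul o (cst c) (grad_sq_Ck (Ck_on_pred cv)))).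
Qed.

Lemma Cc_grad_sq v : Ckc 1 v -> Cc (grad_sq v).
Proof.
move=> [[K K0 hv] cv]; split; last exact: (grad_sq_Ck cv).
by exists K => //; exact: supported_grad_sq.
Qed.

(* w_y^2 - w^2 / (4 y^2) = (w_y - w / (2 y))^2 + d/dy (w^2 / (2 y)). *)
Lemma vertical_hardy w : Ckc 1 w ->
  1 / 4 * hint (fun p => w p ^+ 2 / p.2 ^+ 2) <= hint (grad_sq w).
Proof.
move=> Cw; have [[K K0 hw] cw] := Cw.
pose f p := w p ^+ 2 / p.2 ^+ 1.
have Cf : Ckc 1 f.
  split; last exact: Ck_on_sqr_over_height.
  exists K => //; apply: supported_sub hw _ => p; apply: contraNN => /eqP w0.
  by rewrite /f w0 expr0n mul0r.
have [Cd D0] := hint_derive_eq0 None Cf.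
have CW : Cc (fun p => w p ^+ 2 / p.2 ^+ 2) by exact: Cc_sqr_over_height.
have -> : 1 / 4 * hint (fun p => w p ^+ 2 / p.2 ^+ 2) =
   hint ((fun p => 1 / 4 * (w p ^+ 2 / p.2 ^+ 2)) \+ (fun p => 1 / 2 * 'D_(dir None) f p)).
  by rewrite hintD ?hintZ// ?D0 ?mulr0 ?addr0//; exact: CcZ.
apply: le_hint; [by apply: CcD; exact: CcZ|exact: Cc_grad_sq|].
move=> p p0; have y0 : p.2 != 0 by rewrite gt_eqF.
have d := is_derive_mul (is_derive_exp 2 (Ck_on_is_derive None cw p0)) (is_derive_sndV None p0).
rewrite [leLHS]/=.
have -> : 'D_(dir None) f p = 2 * w p * partial None w p / p.2 - w p ^+ 2 / p.2 ^+ 2.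
  rewrite -[f]/(fun q => w q ^+ 2 * q.2^-1) (@derive_val _ _ _ _ _ _ _ d).
  by rewrite -/(partial None w p) /=; field.
apply: (@le_trans _ _ (partial None w p ^+ 2)).
  rewrite -subr_ge0 (_ : _ - _ = (partial None w p - w p / p.2 / 2) ^+ 2) ?sqr_ge0//.
  by rewrite /=; field.
by rewrite /grad_sq big_option/= lerDl sumr_ge0// => j _; exact: sqr_ge0.
Qed.

(* y^2 (Lap w)^2 + (nu^2 - 2) / 4 |grad w|^2 - (nu^2 - 1) / 16 w^2 / y^2 up to a
   divergence: a quadratic form in w / y and y Lap w + w / (4 y), the latter being
   small on the optimizers. *)
Definition normal_energy w p : R :=
  (p.2 * laplacian w p + w p / (4 * p.2)) ^+ 2
  - nu ^+ 2 / 4 * (w p / p.2 * (p.2 * laplacian w p + w p / (4 * p.2))).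

Lemma Cc_normal_energy w : Ckc 2 w -> Cc (normal_energy w).
Proof.
move=> [[K K0 hw] cw]; split.
  exists K => //; apply: (supported_combination (supported_laplacian K0 hw) hw).
  by move=> p h1 h2; rewrite /normal_energy h1 h2 !(mul0r, mulr0, addr0) expr0n subrr.
have cst b := Ck_on_const dir 0 (b : R) o.
have cw0 := Ck_on_pred (Ck_on_pred cw).
have c1 : Ck_on dir 0 half_space (fun p => p.2 * laplacian w p + w p * (4^-1 * p.2^-1)).
  exact: (Ck_on_add o (Ck_on_mul o (Ck_on_snd 0 o) (laplacian_Ck cw))
    (Ck_on_mul o cw0 (Ck_on_mul o (cst 4^-1) (Ck_on_sndV 0)))).
apply: (@Ck_on_eq _ _ _ dir 0 _ _ _ o _ (Ck_on_sub o (Ck_on_exp 2 o c1)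
  (Ck_on_mul o (cst (nu ^+ 2 / 4)) (Ck_on_mul o (Ck_on_mul o cw0 (Ck_on_sndV 0)) c1)))) => p p0.
by rewrite /normal_energy invfM.
Qed.

(** The divergence of w grad w replaces |grad w|^2 by - w Lap w under the integral; what remains is
    a pointwise identity. *)
Lemma hint_normal_energy w : Ckc 2 w ->
  hint (energy ((nu ^+ 2 - 2) / 4) w) =
  hint (normal_energy w) + (nu ^+ 2 - 1) / 16 * hint (fun p => w p ^+ 2 / p.2 ^+ 2).
Proof.
move=> Cw; have [[K K0 hw] cw] := Cw.
have Cw1 : Ckc 1 w by split; [exists K|exact: Ck_on_pred].
have CF i : Ckc 1 (fun p => w p * partial i w p).
  split; last exact: (Ck_on_mul o (Ck_on_pred cw) (Ck_on_derive i cw)).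
  exists K => //; apply: supported_sub hw _ => p; apply: contraNN => /eqP ->.
  by rewrite mul0r.
have [CD D0] := hint_sum_derive_eq0 CF.
have CW : Cc (fun p => w p ^+ 2 / p.2 ^+ 2) by exact: Cc_sqr_over_height.
have CN := Cc_normal_energy Cw.
rewrite -[X in _ = _ + X]hintZ// -hintD//; last exact: CcZ.
set D := (fun p => \sum_i _) in CD D0.
rewrite -[RHS]addr0 -[X in _ = _ + X](mulr0 ((nu ^+ 2 - 2) / 4)) -D0 -hintZ// -hintD; last 2 first.
- by apply: CcD => //; exact: CcZ.
- exact: CcZ.
apply: hint_eq; [exact: Cc_energy|by apply: CcD; [apply: CcD => //|]; exact: CcZ|].
move=> p p0; have y0 : p.2 != 0 by rewrite gt_eqF.
rewrite [RHS]/=.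
have -> : D p = grad_sq w p + w p * laplacian w p.
  rewrite /D /grad_sq /laplacian mulr_sumr -big_split; apply: eq_bigr => i _.
  have d := is_derive_mul (Ck_on_is_derive i (Ck_on_pred cw) p0)
    (Ck_on_is_derive i (Ck_on_derive i cw) p0).
  by rewrite (@derive_val _ _ _ _ _ _ _ d) /= expr2.
by rewrite /energy /normal_energy /=; field.
Qed.

End integral_identities.

(** * The substitution v = y w *)

Section height_transform.
Context {R : realType} {n : nat}.
Implicit Types (p : 'rV[R]_n * R) (v w f : 'rV[R]_n * R -> R).
Local Notation dir := (@basis_dir R n).
Local Notation o := (@open_half_space R n).

Definition height_mul w p : R := p.2 * w p.

Lemma partial_height_mul w i p : Ck_on dir 1 half_space w -> half_space p ->
  partial i (height_mul w) p = (i == None)%:R * w p + p.2 * partial i w p.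
Proof.
move=> cw p0.
have d := is_derive_mul (is_derive_snd p i) (Ck_on_is_derive i cw p0).
exact: (@derive_val _ _ _ _ _ _ _ d).
Qed.

Lemma partial2_height_mul w i p : Ck_on dir 2 half_space w -> half_space p ->
  partial i (partial i (height_mul w)) p =
  2 * ((i == None)%:R * partial i w p) + p.2 * partial i (partial i w) p.
Proof.
move=> cw p0; have cw1 := Ck_on_pred cw.
have nE : \forall q \near p, (i == None)%:R * w q + q.2 * partial i w q =
    partial i (height_mul w) q.
  by apply: filterS (open_nbhs_nbhs (conj o p0)) => q q0; rewrite partial_height_mul.
rewrite {1}/partial -(near_eq_derive _ nE).
have d := is_derive_add
  (is_derive_mul (is_derive_const p (dir i) ((i == None)%:R : R)) (Ck_on_is_derive i cw1 p0))
  (is_derive_mul (is_derive_snd p i) (Ck_on_is_derive i (Ck_on_derive i cw) p0)).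
rewrite (@derive_val _ _ _ _ _ _ _ d) mul0r add0r addrA; congr (_ + _).
by rewrite [RHS]mulr_natl mulr2n.
Qed.

Lemma laplacian_height_mul w p : Ck_on dir 2 half_space w -> half_space p ->
  laplacian (height_mul w) p = 2 * partial None w p + p.2 * laplacian w p.
Proof.
move=> cw p0; rewrite /laplacian.
rewrite (eq_bigr _ (fun i _ => partial2_height_mul i cw p0)).
rewrite big_split /= -!mulr_sumr; congr (2 * _ + _).
by rewrite big_option/= mul1r big1 ?addr0// => j _; rewrite mul0r.
Qed.

Lemma grad_sq_height_mul w p : Ck_on dir 1 half_space w -> half_space p ->
  grad_sq (height_mul w) p =
  w p ^+ 2 + 2 * p.2 * w p * partial None w p + p.2 ^+ 2 * grad_sq w p.
Proof.
move=> cw p0; rewrite /grad_sq.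
have E i : partial i (height_mul w) p ^+ 2 = (w p ^+ 2) * (i == None)%:R
    + (2 * p.2 * w p) * ((i == None)%:R * partial i w p) + p.2 ^+ 2 * partial i w p ^+ 2.
  by rewrite partial_height_mul//; case: (i == None); rewrite ?mulr0n ?mulr1n; ring.
under eq_bigr => i _ do rewrite E.
rewrite !big_split /= -!mulr_sumr -/(grad_sq w p).
have -> : \sum_(i : option 'I_n) (i == None)%:R = 1 :> R.
  by rewrite big_option/= big1 ?addr0.
have -> : \sum_(i : option 'I_n) (i == None)%:R * partial i w p = partial None w p.
  by rewrite big_option/= mul1r big1 ?addr0// => j _; rewrite mul0r.
by rewrite mulr1.
Qed.

Definition weighted_energy (c : R) v p : R :=
  laplacian v p ^+ 2 + c * (grad_sq v p / p.2 ^+ 2).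

Lemma Cc_weighted_energy c v : Ckc 2 v -> Cc (weighted_energy c v).
Proof.
move=> [[K K0 hv] cv]; split.
  exists K => //; apply: (supported_combination (supported_laplacian K0 hv) (supported_grad_sq K0 hv)).
  by move=> p; rewrite /weighted_energy => -> ->; rewrite expr0n mul0r mulr0 addr0.
have cst b := Ck_on_const dir 0 (b : R) o.
apply: (@Ck_on_eq _ _ _ dir 0 _ _ _ o _ (Ck_on_add o (Ck_on_exp 2 o (laplacian_Ck cv))
  (Ck_on_mul o (cst c) (Ck_on_mul o (grad_sq_Ck (Ck_on_pred cv)) (Ck_on_exp 2 o (Ck_on_sndV 0)))))).
by move=> p p0; rewrite /weighted_energy exprVn.
Qed.

Lemma Ckc_height_mul k w : Ckc k w -> Ckc k (height_mul w).
Proof.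
move=> [[K K0 hw] cw]; split; last exact: (Ck_on_mul o (Ck_on_snd k o) cw).
exists K => //; apply: supported_sub hw _ => p; apply: contraNN => /eqP w0.
by rewrite /height_mul w0 mulr0.
Qed.

(** With v = y w, (Lap v)^2 contains 4 w_y^2 + 4 y w_y Lap w. The divergence of y w_y grad w and the
    vertical derivative of y |grad w|^2 turn this sum into 2 |grad w|^2, hence the 2 in [2 + c]. The
    vertical derivative of w^2 / y turns the cross term of |grad v|^2 / y^2 into a second copy of
    w^2 / y^2, hence the factor 2 c. *)
Lemma hint_weighted_energy c w : Ckc 2 w ->
  hint (weighted_energy c (height_mul w)) =
  hint (energy (2 + c) w) + 2 * c * hint (fun p => w p ^+ 2 / p.2 ^+ 2).
Proof.
move=> Cw; have [[K K0 hw] cw] := Cw; have cw1 := Ck_on_pred cw.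
have Cw1 : Ckc 1 w by split; [exists K|].
pose F i p := p.2 * partial None w p * partial i w p.
have cF i : Ckc 1 (F i).
  split.
    exists K => //; apply: supported_sub (supported_partial (i := i) K0 hw) _ => p.
    by apply: contraNN => /eqP h; rewrite /F h mulr0.
  exact: (Ck_on_mul o (Ck_on_mul o (Ck_on_snd 1 o) (Ck_on_derive None cw)) (Ck_on_derive i cw)).
pose G p := p.2 * grad_sq w p.
have cG : Ckc 1 G.
  split; last exact: (Ck_on_mul o (Ck_on_snd 1 o) (grad_sq_Ck cw)).
  exists K => //; apply: supported_sub (supported_grad_sq K0 hw) _ => p.
  by apply: contraNN => /eqP h; rewrite /G h mulr0.
pose H p := w p ^+ 2 / p.2 ^+ 1.
have cH : Ckc 1 H.
  split; last exact: Ck_on_sqr_over_height.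
  exists K => //; apply: supported_sub hw _ => p; apply: contraNN => /eqP h.
  by rewrite /H h expr0n mul0r.
have [CF F0] := hint_sum_derive_eq0 cF.
have [CG G0] := hint_derive_eq0 None cG.
have [CH H0] := hint_derive_eq0 None cH.
have CE := Cc_energy (2 + c) Cw.
have CW : Cc (fun p => w p ^+ 2 / p.2 ^+ 2) by exact: Cc_sqr_over_height.
set dF := (fun p => \sum_i _) in CF F0.
set dG := (fun p => 'D_ _ G p) in CG G0.
set dH := (fun p => 'D_ _ H p) in CH H0.
(* The coefficients 4 and -2 make the sums [M] of mixed second derivatives in [dF] and [dG]
   cancel. *)
pose T := (((energy (2 + c) w \+ (fun p => 2 * c * (w p ^+ 2 / p.2 ^+ 2))) \+
  (fun p => 4 * dF p)) \+ (fun p => -2 * dG p)) \+ (fun p => c * dH p).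
have C1 := CcZ (2 * c) CW; have C2 := CcZ 4 CF; have C3 := CcZ (-2) CG; have C4 := CcZ c CH.
have CT : Cc T := CcD (CcD (CcD (CcD CE C1) C2) C3) C4.
transitivity (hint T); last first.
  rewrite /T (hintD (CcD (CcD (CcD CE C1) C2) C3) C4) (hintD (CcD (CcD CE C1) C2) C3).
  rewrite (hintD (CcD CE C1) C2) (hintD CE C1) (hintZ _ CW) (hintZ _ CF) (hintZ _ CG) (hintZ _ CH).
  by rewrite F0 G0 H0 !mulr0 !addr0.
apply: hint_eq => //; first by apply: Cc_weighted_energy; exact: Ckc_height_mul.
move=> p p0; have y0 : p.2 != 0 by rewrite gt_eqF.
have dV := is_derive_sndV None p0; have dy := is_derive_snd p None.
have dw i := Ck_on_is_derive i cw1 p0.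
have ddw i j := Ck_on_is_derive j (Ck_on_derive i cw) p0.
pose M := \sum_i partial i w p * 'D_(dir None) (partial i w) p.
have FE : dF p = partial None w p ^+ 2 + p.2 * M + p.2 * partial None w p * laplacian w p.
  rewrite /dF /laplacian /M !mulr_sumr.
  rewrite (_ : partial None w p ^+ 2 = \sum_i (i == None)%:R * (partial None w p * partial i w p)); last first.
    by rewrite big_option/= mul1r big1 ?addr0// => j _; rewrite mul0r.
  rewrite -!big_split; apply: eq_bigr => i _.
  (* Symmetry of second derivatives identifies the mixed terms of [dF] with those of [dG]. *)
  have dc : 'D_(dir i) (partial None w) p = 'D_(dir None) (partial i w) p.
    exact: (derive_comm None i o cw p0).
  have E2 : 'D_(dir i) (F i) p = ((i == None)%:R * partial None w p
      + p.2 * 'D_(dir None) (partial i w) p) * partial i w p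
      + p.2 * partial None w p * partial i (partial i w) p.
    rewrite -dc.
    have [_ d] := is_derive_mul (is_derive_mul (is_derive_snd p i) (ddw None i)) (ddw i i).
    exact: d.
  rewrite E2; move: ('D_(dir None) _ p) (partial i (partial i w) p) => B L.
  move: (partial None w p) (partial i w p) (p.2) ((i == None)%:R) => A C y z /=.
  by ring.
have GE : dG p = grad_sq w p + 2 * p.2 * M.
  have d := is_derive_mul dy (is_derive_bigsum (fun i => is_derive_exp 2 (ddw i None))).
  rewrite /dG -[G]/(fun q => q.2 * \sum_i partial i w q ^+ 2) (@derive_val _ _ _ _ _ _ _ d) /=.
  rewrite mul1r -/(grad_sq w p) /M; congr (_ + _); rewrite !mulr_sumr.
  by apply: eq_bigr => i _; rewrite expr1 -/(partial _ w _); ring.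
have HE : dH p = 2 * w p * partial None w p / p.2 - w p ^+ 2 / p.2 ^+ 2.
  have d := is_derive_mul (is_derive_exp 2 (dw None)) dV.
  rewrite /dH -[H]/(fun q => w q ^+ 2 * q.2^-1) (@derive_val _ _ _ _ _ _ _ d).
  by rewrite -/(partial None w p) /=; field.
rewrite /T /= FE GE HE /weighted_energy /energy laplacian_height_mul// grad_sq_height_mul//.
by field.
Qed.

End height_transform.

(** * Near optimizers *)

Section optimizer_profile.
Context {R : realType}.
Implicit Types (x y z : R).

Definition dbump x : R := 'D_1 flat_bump x.
Definition ddbump x : R := 'D_1 dbump x.

Lemma is_derive_bump x : is_derive x 1 flat_bump (dbump x).
Proof. exact: (@Ck_on_is_derive _ _ _ _ 0 _ _ tt x (@Ck1_bump R 1) I). Qed.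

Lemma is_derive_dbump x : is_derive x 1 dbump (ddbump x).
Proof.
exact: (@Ck_on_is_derive _ _ _ _ 0 _ _ tt x
  (@Ck_on_derive _ _ _ _ 1 _ _ tt (@Ck1_bump R 2)) I).
Qed.

Lemma bump_eq0 x : ~~ (0 < x < 1) -> flat_bump x = 0.
Proof. by move=> h; apply/eqP; apply: contraNT h; exact: bump_neq0. Qed.

Let derive_eq0_outside (f : R -> R) x : (forall z, ~~ (0 <= z <= 1) -> f z = 0) ->
  ~~ (0 <= x <= 1) -> 'D_1 f x = 0.
Proof.
move=> f0 hx.
have h : \forall z \near x, ~~ (0 <= z <= 1).
  move: hx; rewrite negb_and -!ltNge => /orP[x0|x1].
    by near=> z; rewrite negb_and -!ltNge; apply/orP; left; near: z; exact: lt_nbhsl.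
  by near=> z; rewrite negb_and -!ltNge; apply/orP; right; near: z; exact: lt_nbhsr.
have : \forall z \near x, cst 0 z = f z by apply: filterS h => z /f0 ->.
by move=> /near_eq_derive <-; rewrite derive_cst.
Unshelve. all: by end_near. Qed.

Lemma bump_outside z : ~~ (0 <= z <= 1) -> flat_bump z = 0.
Proof. by move=> h; apply: bump_eq0; apply: contraNN h => /andP[/ltW -> /ltW ->]. Qed.

Lemma dbump_outside z : ~~ (0 <= z <= 1) -> dbump z = 0.
Proof. exact: derive_eq0_outside bump_outside. Qed.

Lemma ddbump_outside z : ~~ (0 <= z <= 1) -> ddbump z = 0.
Proof. exact: derive_eq0_outside dbump_outside. Qed.

Let bounded_of_outside (f : R -> R) : continuous f ->
  (forall z, ~~ (0 <= z <= 1) -> f z = 0) -> exists2 b, 0 <= b & forall z, `|f z| <= b.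
Proof.
move=> cf f0; have : compact (f @` `[0, 1]%classic).
  by apply: continuous_compact; [exact: continuous_subspaceT|exact: segment_compact].
move=> /compact_bounded[M [_ hM]]; exists (`|M| + 1) => // z.
have [z01|/f0 ->] := boolP (0 <= z <= 1); last by rewrite normr0.
apply: (hM (`|M| + 1)); first by rewrite (le_lt_trans (ler_norm M))// ltrDl.
by exists z => //=; rewrite in_itv.
Qed.

Lemma bump_bounded : exists2 b : R, 1 <= b &
  forall z, [/\ `|flat_bump z| <= b, `|dbump z| <= b & `|ddbump z| <= b].
Proof.
have c0 : continuous (@flat_bump R) by move=> z; exact: (Ck_on_continuous (Ck1_bump 0) I).
have c1 : continuous dbump.
  by move=> z; exact: (Ck_on_continuous (@Ck_on_derive _ _ _ _ 0 _ _ tt (@Ck1_bump R 1)) I).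
have c2 : continuous ddbump.
  move=> z; exact: (Ck_on_continuous (@Ck_on_derive _ _ _ _ 0 _ _ tt
    (@Ck_on_derive _ _ _ _ 1 _ _ tt (@Ck1_bump R 2))) I).
have [a a0 ha] := bounded_of_outside c0 bump_outside.
have [b b0 hb] := bounded_of_outside c1 dbump_outside.
have [c c0' hc] := bounded_of_outside c2 ddbump_outside.
exists (1 + a + b + c); first by rewrite -!addrA lerDl !addr_ge0.
by move=> z; split; [rewrite (le_trans (ha z))//|rewrite (le_trans (hb z))//|rewrite (le_trans (hc z))//]; lra.
Qed.

Variables (eps M : R).
Hypotheses (eps0 : 0 < eps) (M1 : 1 < M).

Definition depth y : R := - ln y.
(** As [ln] is 0 on nonpositive reals, the value for y >= 1 is - eps ln M < 0. The bump vanishes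
    there, which extends the profile by zero without a case distinction. *)
Definition scale_pos y : R := eps * (ln (depth y) - ln M).
(* sqrt (y * |ln y|), written so as to be smooth where depth y > 0. *)
Definition amplitude y : R := expR (2^-1 * (ln y + ln (depth y))).
Definition profile y : R := amplitude y * flat_bump (scale_pos y).

Lemma scale_pos_gt0 y : 0 < scale_pos y -> M < depth y.
Proof.
rewrite pmulr_rgt0// subr_gt0 => h.
have M0 : 0 < M by rewrite (lt_trans ltr01).
have d0 : 0 < depth y.
  rewrite ltNge; apply/negP => d0; move: h; rewrite (ln0 d0) ltNge ln_ge0//.
  exact: ltW.
by move: h; rewrite ltr_ln ?posrE.
Qed.

Lemma depth_gt0 y : 0 < depth y -> 0 < y < 1.
Proof.
rewrite /depth oppr_gt0 => h; have y0 : 0 < y.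
  by rewrite ltNge; apply/negP => y0; move: h; rewrite ln0// ltxx.
rewrite y0 ltNge; apply/negP => y1; move: h; rewrite ltNge ln_ge0//.
Qed.

Lemma profile_neq0 y : profile y != 0 -> 0 < scale_pos y < 1 /\ 0 < y < expR (- M).
Proof.
rewrite /profile mulf_eq0 negb_or => /andP[_ /bump_neq0/andP[s0 s1]].
rewrite s0 s1; split=> //; have hM := scale_pos_gt0 s0.
have /andP[y0 y1] : 0 < y < 1 by apply: depth_gt0; rewrite (lt_trans _ hM)// (lt_trans ltr01).
by rewrite y0 -[ltLHS]lnK ?posrE// ltr_expR ltrNr.
Qed.

Lemma scale_pos_lt0 y : expR (- M) < y -> scale_pos y < 0.
Proof.
move=> hy; have M0 : 0 < M by rewrite (lt_trans ltr01).
rewrite pmulr_rlt0// subr_lt0; have [d0|d0] := ltP 0 (depth y); last first.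
  by rewrite (ln0 d0) ln_gt0.
have /andP[y0 _] := depth_gt0 d0.
by rewrite ltr_ln ?posrE// /depth ltrNl -ltr_expR lnK.
Qed.

Let outside_lt0 z : z < 0 -> ~~ (0 <= z <= 1).
Proof. by move=> z0; rewrite negb_and -ltNge z0. Qed.

Lemma amplitude_sqr y : 0 < y < 1 -> amplitude y ^+ 2 = y * depth y.
Proof.
move=> /andP[y0 y1]; have d0 : 0 < depth y by rewrite oppr_gt0 ln_lt0// y0.
by rewrite /amplitude -expRM_natl mulrA divff ?pnatr_eq0// mul1r expRD !lnK.
Qed.

Lemma is_derive_depth y : 0 < y -> is_derive y 1 depth (- y^-1).
Proof. by move=> y0; apply: is_derive_opp; exact: is_derive1_ln. Qed.

Lemma is_derive_ln_depth y : 0 < y < 1 ->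
  is_derive y 1 (fun y => ln (depth y)) (- (y * depth y)^-1).
Proof.
move=> /andP[y0 y1]; have d0 : 0 < depth y by rewrite oppr_gt0 ln_lt0// y0.
apply: (is_derive_eq (is_derive_chain (f := depth) (is_derive1_ln d0) (is_derive_depth y0))).
by rewrite invfM mulrN mulrC.
Qed.

Let is_derive_amplitude y : 0 < y < 1 ->
  is_derive y 1 amplitude (amplitude y * (2^-1 * (y^-1 - (y * depth y)^-1))).
Proof.
move=> hy; have /andP[y0 y1] := hy.
have d := is_derive_mul (is_derive_const y 1 (2^-1 : R))
  (is_derive_add (is_derive1_ln y0) (is_derive_ln_depth hy)).
apply: (is_derive_eq (is_derive_chain (f := fun y => 2^-1 * (ln y + ln (depth y))) (is_derive_expR _) d)).
by rewrite mul0r add0r.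
Qed.

Let is_derive_scale_pos y : 0 < y < 1 ->
  is_derive y 1 scale_pos (- eps * (y * depth y)^-1).
Proof.
move=> hy; have d := is_derive_mul (is_derive_const y 1 eps)
  (is_derive_sub (is_derive_ln_depth hy) (is_derive_const y 1 (ln M))).
by apply: (is_derive_eq d); rewrite mul0r add0r subr0 mulrN mulNr.
Qed.

Definition dprofile y : R := amplitude y *
  (2^-1 * (y^-1 - (y * depth y)^-1) * flat_bump (scale_pos y)
   - eps * (y * depth y)^-1 * dbump (scale_pos y)).

Lemma profile_above y : expR (- M) < y -> profile y = 0.
Proof.
move=> hy; apply/eqP/negPn/negP => /profile_neq0[_ /andP[_]].
by rewrite ltNge ltW.
Qed.

Lemma dprofile_above y : expR (- M) < y -> dprofile y = 0.
Proof.
move=> /scale_pos_lt0/outside_lt0 h.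
by rewrite /dprofile bump_outside// dbump_outside// !mulr0 subrr mulr0.
Qed.

Let derive_above (f : R -> R) y : (forall z, expR (- M) < z -> f z = 0) -> 1 <= y ->
  is_derive y 1 f 0.
Proof.
move=> f0 y1; apply: (@near_eq_is_derive _ _ _ (fun=> 0)).
have : expR (- M) < y.
  by rewrite (lt_le_trans _ y1)// -expR0 ltr_expR oppr_lt0 (lt_trans ltr01).
by move=> /lt_nbhsr; apply: filterS => z /f0.
Qed.

Let lt_above y : 1 <= y -> expR (- M) < y.
Proof.
by move=> y1; rewrite (lt_le_trans _ y1)// -expR0 ltr_expR oppr_lt0 (lt_trans ltr01).
Qed.

Lemma is_derive_profile y : 0 < y -> is_derive y 1 profile (dprofile y).
Proof.
move=> y0; have [y1|y1] := ltP y 1; last first.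
  by rewrite dprofile_above ?lt_above//; exact: derive_above profile_above y1.
have hy : 0 < y < 1 by rewrite y0.
 have d := is_derive_mul (is_derive_amplitude hy)
  (is_derive_chain (is_derive_bump (scale_pos y)) (is_derive_scale_pos hy)).
by apply: (is_derive_eq d); rewrite /dprofile; ring.
Qed.

(** With t = [depth y], the profile is sqrt y g(t), where g(t) = sqrt t psi(eps (ln t - ln M)), and
    y^2 times its second derivative plus a quarter of it is sqrt y g''(t). The factor sqrt t makes
    the first derivative of psi disappear from g''. *)
Definition ddprofile y : R := amplitude y * (y ^- 2 *
  (depth y ^- 2 * (eps ^+ 2 * ddbump (scale_pos y) - flat_bump (scale_pos y) / 4)
   - flat_bump (scale_pos y) / 4)).

Lemma is_derive_dprofile y : 0 < y -> is_derive y 1 dprofile (ddprofile y).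
Proof.
move=> y0; have [y1|y1] := ltP y 1; last first.
  rewrite [ddprofile y](_ : _ = 0); first exact: derive_above dprofile_above y1.
  have h := outside_lt0 (scale_pos_lt0 (lt_above y1)).
  by rewrite /ddprofile bump_outside// ddbump_outside// !(mul0r, mulr0, subrr).
have hy : 0 < y < 1 by rewrite y0.
have d0 : 0 < depth y by rewrite oppr_gt0 ln_lt0// y0.
have yn : y != 0 by rewrite gt_eqF.
have dn : depth y != 0 by rewrite gt_eqF.
have cst a := is_derive_const y 1 (a : R).
have dV := is_derive_inv (f := id) yn (is_derive_id y 1).
have dyd := is_derive_inv (f := fun y => y * depth y) (mulf_neq0 yn dn)
  (is_derive_mul (is_derive_id y 1) (is_derive_depth y0)).
have db := is_derive_chain (is_derive_bump (scale_pos y)) (is_derive_scale_pos hy).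
have ddb := is_derive_chain (is_derive_dbump (scale_pos y)) (is_derive_scale_pos hy).
have d := is_derive_mul (is_derive_amplitude hy)
  (is_derive_sub (is_derive_mul (is_derive_mul (cst 2^-1) (is_derive_sub dV dyd)) db)
    (is_derive_mul (is_derive_mul (cst eps) dyd) ddb)).
apply: (is_derive_eq d); rewrite /ddprofile.
move: dn yn; move: (amplitude y) (flat_bump _) (dbump _) (ddbump _) (depth y) => a b0 b1 b2 t dn yn.
by field; rewrite yn dn.
Qed.

Lemma Ck1_profile k : Ck1 k [set y | 0 < y] profile.
Proof.
apply: (@Ck_on_subset _ _ _ _ _ ([set y | 0 < y < 1] `|` [set y | expR (- M) < y])).
  move=> y /= y0; have [y1|y1] := ltP y 1; first by left; rewrite /= y0.
  right; rewrite /= (lt_le_trans _ y1)// -expR0 ltr_expR oppr_lt0.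
  exact: lt_trans M1.
apply: Ck_on_union; last first.
  have o : open [set y | expR (- M) < y] by exact: open_gt.
  apply: (@Ck_on_eq _ _ _ _ _ _ (fun=> 0) _ o); last exact: Ck_on_const.
  by move=> y /= /profile_above ->.
have o : open [set y : R | 0 < y < 1].
  rewrite (_ : [set y | _] = `]0, 1[%classic); first exact: interval_open.
  by apply/seteqP; split=> y /=; rewrite in_itv.
have cst a := Ck_on_const (fun _ : unit => (1 : R)) k (a : R) o.
have cl : Ck1 k [set y : R | 0 < y < 1] (@ln R).
  by apply: Ck_on_subset (Ck1_ln k) => y /= /andP[].
have cd : Ck1 k [set y : R | 0 < y < 1] depth by exact: (Ck_on_opp o cl).
have cld : Ck1 k [set y : R | 0 < y < 1] (fun y => ln (depth y)).
  apply: (Ck_on_comp (W := [set x | 0 < x]) o _ (Ck1_ln k) cd).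
  by move=> y /= /andP[y0 y1]; rewrite oppr_gt0 ln_lt0// y0.
apply: (Ck_on_mul o).
  apply: (Ck_on_comp (W := setT) (f := fun y => 2^-1 * (ln y + ln (depth y))) o _ (Ck1_expR k)) => //.
  exact: (Ck_on_mul o (cst 2^-1) (Ck_on_add o cl cld)).
apply: (Ck_on_comp (W := setT) (f := scale_pos) o _ (Ck1_bump k)) => //.
exact: (Ck_on_mul o (cst eps) (Ck_on_sub o cld (cst (ln M)))).
Qed.

End optimizer_profile.

(** * The optimizers on the half space *)

Section optimizer.
Context {R : realType} {n : nat}.
Variables (eps M : R).
Hypotheses (eps0 : 0 < eps) (M1 : 1 < M).
Implicit Types (p : 'rV[R]_n * R) (f : 'rV[R]_n * R -> R).
Local Notation dir := (@basis_dir R n).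
Local Notation nu := (n%:R : R).
Local Notation o := (@open_half_space R n).

Definition optimizer p : R := flat_bump (norm2 p) * profile eps M p.2.

Lemma optimizer_neq0 p : optimizer p != 0 ->
  [/\ 0 < norm2 p < 1, 0 < scale_pos eps M p.2 < 1 & 0 < p.2 < expR (- M)].
Proof.
by rewrite /optimizer mulf_eq0 negb_or => /andP[/bump_neq0 h /(profile_neq0 eps0 M1)[]].
Qed.

Lemma coord_le_norm2 p (t : R) : 0 <= t -> norm2 p <= t ^+ 2 -> forall i, `|p.1 ord0 i| <= t.
Proof.
move=> t0 h i; rewrite -(@ler_pXn2r _ 2)// ?nnegrE// real_normK ?num_real//.
apply: le_trans h; rewrite /norm2 (bigD1 i)//= lerDl.
by apply: sumr_ge0 => j _; exact: sqr_ge0.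
Qed.

Lemma scale_pos_range y (a b : R) : 0 < depth y -> a <= scale_pos eps M y <= b ->
  M * expR (a / eps) <= depth y <= M * expR (b / eps).
Proof.
move=> d0; have M0 : 0 < M by rewrite (lt_trans ltr01).
have E c : M * expR (c / eps) = expR (ln M + c / eps) by rewrite expRD lnK.
rewrite !E -[depth y]lnK ?posrE// !ler_expR /scale_pos => /andP[h1 h2].
rewrite -lerBrDl ler_pdivrMr// mulrC h1 /=.
by rewrite -lerBlDl ler_pdivlMr// mulrC.
Qed.

Lemma height_range y (a b : R) : 0 < depth y -> a <= scale_pos eps M y <= b ->
  expR (- (M * expR (b / eps))) <= y <= expR (- (M * expR (a / eps))).
Proof.
move=> d0 /(scale_pos_range d0)/andP[h1 h2].
have /andP[y0 y1] := depth_gt0 d0.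
have -> : y = expR (- depth y) by rewrite opprK lnK.
by rewrite !ler_expR !lerN2 h1 h2.
Qed.

Lemma height_rangeV y (a b : R) :
  expR (- (M * expR (b / eps))) <= y <= expR (- (M * expR (a / eps))) ->
  0 < depth y /\ a <= scale_pos eps M y <= b.
Proof.
move=> /andP[h1 h2]; have M0 : 0 < M by rewrite (lt_trans ltr01).
have y0 : 0 < y by rewrite (lt_le_trans _ h1)// expR_gt0.
have t1 : depth y <= M * expR (b / eps) by rewrite /depth lerNl -ler_expR lnK.
have t2 : M * expR (a / eps) <= depth y by rewrite /depth lerNr -ler_expR lnK.
have d0 : 0 < depth y by rewrite (lt_le_trans _ t2)// mulr_gt0// expR_gt0.
split=> //; rewrite /scale_pos.
have E c : M * expR (c / eps) = expR (ln M + c / eps) by rewrite expRD lnK.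
move: t1 t2; rewrite !E -[depth y]lnK ?posrE// !ler_expR expRK => t1 t2.
apply/andP; split.
  by rewrite mulrC -ler_pdivrMr// lerBrDl.
by rewrite mulrC -ler_pdivlMr// lerBlDl.
Qed.

Lemma Ckc_optimizer k : Ckc k optimizer.
Proof.
have M0 : 0 < M by rewrite (lt_trans ltr01).
split; last first.
  apply: (Ck_on_mul o).
    exact: (Ck_on_comp (W := setT) o (fun _ _ => I) (Ck1_bump k) (Ck_on_norm2 k o)).
  by apply: (Ck_on_comp o _ (Ck1_profile eps0 M1 k) (Ck_on_snd k o)) => p.
(* On the support [scale_pos] is below 1, so the depth is below M exp(1/eps); this constant bounds
   the inverse of the height. *)
exists (expR (M * expR (1 / eps))); first exact: expR_gt0.
move=> p /optimizer_neq0[/andP[_ r1] /andP[/ltW s0 /ltW s1] /andP[y0 y1]].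
have M1' : 1 <= expR (M * expR (1 / eps)).
  by rewrite -expR0 ler_expR mulr_ge0 ?expR_ge0// ltW.
split.
  by apply: coord_le_norm2 (ltW (lt_le_trans ltr01 M1')) _; rewrite (le_trans (ltW r1))// exprn_ege1.
have y11 : p.2 < 1 by rewrite (lt_trans y1)// -expR0 ltr_expR oppr_lt0.
have d0 : 0 < depth p.2 by rewrite oppr_gt0 ln_lt0// y0.
have := @height_range p.2 0 1 d0; rewrite s0 s1 => /(_ isT)/andP[h1 h2].
by rewrite -expRN h1 /= (le_trans (ltW y11)).
Qed.

(** The Laplacian in x of the bump evaluated at |x|^2. *)
Definition bump_laplacian p : R :=
  4 * norm2 p * ddbump (norm2 p) + 2 * nu * dbump (norm2 p).

Lemma laplacian_optimizer p : half_space p ->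
  laplacian optimizer p = bump_laplacian p * profile eps M p.2
    + flat_bump (norm2 p) * ddprofile eps M p.2.
Proof.
move=> p0.
have dB (q : 'rV[R]_n * R) i := is_derive_chain (is_derive_bump (norm2 q)) (is_derive_norm2 q i).
have ddB (q : 'rV[R]_n * R) i := is_derive_chain (is_derive_dbump (norm2 q)) (is_derive_norm2 q i).
have dP (q : 'rV[R]_n * R) i (q0 : half_space q) := is_derive_chain (is_derive_profile eps0 M1 q0) (is_derive_snd q i).
have ddP (q : 'rV[R]_n * R) i (q0 : half_space q) := is_derive_chain (is_derive_dprofile eps0 M1 q0) (is_derive_snd q i).
have nh : \forall q \near p, half_space q by exact: open_nbhs_nbhs (conj o p0).
have pN : partial None (partial None optimizer) p = flat_bump (norm2 p) * ddprofile eps M p.2.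
  have E : \forall q \near p, flat_bump (norm2 q) * dprofile eps M q.2 = partial None optimizer q.
    apply: filterS nh => q q0; have [_ d] := is_derive_mul (dB q None) (dP q None q0).
    by rewrite [RHS]d mulr0 mul0r add0r mulr1.
  rewrite [LHS]/partial -(near_eq_derive _ E).
  have [_ ->] := is_derive_mul (dB p None) (ddP p None p0).
  by rewrite mulr0 mul0r add0r mulr1.
have pS j : partial (Some j) (partial (Some j) optimizer) p =
    (4 * ddbump (norm2 p) * p.1 ord0 j ^+ 2 + 2 * dbump (norm2 p)) * profile eps M p.2.
  have E : \forall q \near p, 2 * (dbump (norm2 q) * q.1 ord0 j * profile eps M q.2)
      = partial (Some j) optimizer q.
    apply: filterS nh => q q0; have [_ d] := is_derive_mul (dB q (Some j)) (dP q (Some j) q0).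
    by rewrite [RHS]d !mulr0 addr0 mulrA mulrA [2 * _]mulrC -!mulrA.
  rewrite [LHS]/partial -(near_eq_derive _ E).
  have [_ ->] := is_derive_mul (is_derive_const p (dir (Some j)) (2 : R))
    (is_derive_mul (is_derive_mul (ddB p (Some j)) (is_derive_coord p (Some j) j)) (dP p (Some j) p0)).
  rewrite eqxx /=; move: (profile _ _ _) (dprofile _ _ _) (dbump _) (ddbump _) (p.1 ord0 j) => a b c d e.
  by rewrite ?mulr0n ?mulr1n; ring.
rewrite /laplacian big_option /= pN addrC; congr (_ + _).
under eq_bigr => j _ do rewrite pS.
rewrite -mulr_suml; congr (_ * _); rewrite big_split /= -mulr_sumr -/(norm2 p).
by rewrite sumr_const card_ord /bump_laplacian -[_ *+ n]mulr_natr; ring.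
Qed.

End optimizer.

(** * Pointwise bound on the defect *)

Section optimizer_estimate.
Context {R : realType}.

(** The defect density times y t. Here F and h are the values of the bumps in x and in the scale, h2
    the second derivative of the latter, L the Laplacian of the former, e = eps^2, k = y^2 t^2, and
    d the distance. The leading part nu^2/16 F^2 h^2 of - nu^2/4 F h Y combines with the terms in c
    and delta into c F^2 h^2 (1 - t^2/d^2), which is O(1/t) because d <= t + 2. All other terms
    carry a factor e, k or t^-2, hence are O(1/M). *)
Let bracket_le (M nu c delta b b' e t k d F h h2 L : R) :
  1 <= M -> M <= t -> 1 <= b -> 1 <= b' -> 0 <= e <= M^-1 -> 0 <= k <= 4 / t ->
  0 < d <= t + 2 -> c = nu ^+ 2 / 16 + delta -> 0 <= c ->
  `|F| <= b -> `|h| <= b -> `|h2| <= b -> `|L| <= b' ->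
  let Y := F * (e * h2 - h / 4) + k * (h * L) in
  Y ^+ 2 / t ^+ 2 - nu ^+ 2 / 4 * (F * h * Y) - c * (F ^+ 2 * h ^+ 2 * (t ^+ 2 / d ^+ 2))
   + delta * (F ^+ 2 * h ^+ 2)
  <= ((b * (b + b) + 4 * (b * b')) ^+ 2 + nu ^+ 2 / 4 * (b * b * (b * b) + 4 * (b * (b * b) * b'))
      + 4 * c * (b * b * (b * b))) / M.
Proof.
move=> M1 Mt b1 b'1 /andP[e0 eM] /andP[k0 kt] /andP[d0 dt] cE c0 hF hh hh2 hL; lazy zeta.
set Y := F * (e * h2 - h / 4) + k * (h * L).
have M0 : 0 < M by rewrite (lt_le_trans ltr01).
have t0 : 0 < t by rewrite (lt_le_trans M0).
have t1 : 1 <= t by rewrite (le_trans M1).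
have b0 : 0 <= b by rewrite (le_trans ler01).
have b'0 : 0 <= b' by rewrite (le_trans ler01).
have MV1 : M^-1 <= 1 by rewrite invf_le1.
have tV : t^-1 <= M^-1 by rewrite lef_pV2.
have k4M : k <= 4 * M^-1 by rewrite (le_trans kt)// ler_wpM2l.
have ke : `|e| <= 1 by rewrite ger0_norm// (le_trans eM).
have kk : `|k| <= 4 by rewrite ger0_norm// (le_trans k4M)// ler_piMr.
have h4 : `|h / 4| <= b.
  by rewrite normrM [`|4^-1|]ger0_norm ?invr_ge0// ler_pdivrMr// (le_trans hh)// ler_peMr// ler1n.
have Yb : `|Y| <= b * (b + b) + 4 * (b * b').
  apply: norm_add_le; last by do 2 (apply: norm_mul_le => //).
  apply: norm_mul_le => //; apply: norm_sub_le => //.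
  by rewrite -[leRHS]mul1r; exact: norm_mul_le.
have F2 : `|F ^+ 2 * h ^+ 2| <= b * b * (b * b).
  by rewrite !expr2; apply: norm_mul_le; exact: norm_mul_le.
have A1 : Y ^+ 2 / t ^+ 2 <= (b * (b + b) + 4 * (b * b')) ^+ 2 * M^-1.
  apply: ler_pM; rewrite ?sqr_ge0 ?invr_ge0 ?sqr_ge0//.
    by rewrite -[Y ^+ 2]real_normK ?num_real// lerXn2r ?nnegrE ?(le_trans _ Yb).
  by rewrite lef_pV2 ?posrE ?exprn_gt0// (le_trans Mt)// expr2 ler_peMr// ltW.
have A2 : - (F * F * (h * h2) * e) <= b * b * (b * b) * M^-1.
  apply: le_trans (ler_norm _) _; rewrite normrN; apply: norm_mul_le.
    by apply: norm_mul_le; exact: norm_mul_le.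
  by rewrite ger0_norm.
have A3 : - (F * (h * h) * L * k) <= b * (b * b) * b' * (4 * M^-1).
  apply: le_trans (ler_norm _) _; rewrite normrN; apply: norm_mul_le.
    by apply: norm_mul_le => //; apply: norm_mul_le => //; exact: norm_mul_le.
  by rewrite ger0_norm.
have A4 : F ^+ 2 * h ^+ 2 * (1 - t ^+ 2 / d ^+ 2) <= b * b * (b * b) * (4 * M^-1).
  have FF : 0 <= F ^+ 2 * h ^+ 2 by rewrite mulr_ge0 ?sqr_ge0.
  have td : 1 - t ^+ 2 / d ^+ 2 <= 4 * M^-1.
    apply: (@le_trans _ _ (4 / t)); last by rewrite ler_wpM2l.
    have dt2 : d ^+ 2 <= (t + 2) ^+ 2 by rewrite lerXn2r ?nnegrE ?addr_ge0 ?(ltW d0) ?(ltW t0).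
    have t20 : 0 < t + 2 by rewrite addr_gt0.
    have : t ^+ 2 / (t + 2) ^+ 2 <= t ^+ 2 / d ^+ 2.
      by rewrite ler_wpM2l ?sqr_ge0// lef_pV2 ?posrE ?exprn_gt0.
    have : 1 - 4 / t <= t ^+ 2 / (t + 2) ^+ 2.
      rewrite ler_pdivlMr ?exprn_gt0// -(ler_pM2l t0).
      rewrite (_ : t * ((1 - 4 / t) * (t + 2) ^+ 2) = t ^+ 3 - 12 * t - 16); last by field; rewrite gt_eqF.
      by rewrite -exprS; have := t0; lra.
    by clear; lra.
  have [z0|z0] := leP 0 (1 - t ^+ 2 / d ^+ 2).
    by apply: ler_pM => //; apply: le_trans (ler_norm _) F2.
  apply: (@le_trans _ _ 0); first by rewrite mulr_ge0_le0// ltW.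
  by rewrite !mulr_ge0// invr_ge0 ltW.
have q0 : 0 <= nu ^+ 2 / 4 by rewrite divr_ge0 ?sqr_ge0.
have B2 := ler_wpM2l q0 (lerD A2 A3); have B4 := ler_wpM2l c0 A4.
move: (lerD (lerD A1 B2) B4); clear -cE t0 d0 M0.
have [tn dn Mn] : [/\ t != 0, d != 0 & M != 0] by rewrite !lt0r_neq0.
rewrite cE /Y.
by move=> H; apply: le_trans (le_trans _ H) _; rewrite le_eqVlt; apply/orP; left; apply/eqP; field; rewrite ?tn ?dn ?Mn.
Qed.

(** By A^2 = y t the density is (y t)^-1 times the expression of [bracket_le]. The factor (y t)^-1
    is the derivative of - ln t in y, so that it integrates to 1/eps over a unit range of
    [scale_pos]. *)
Lemma optimizer_density_le (M nu c delta b b' e t y d A F h h2 L : R) :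
  1 <= M -> M <= t -> 1 <= b -> 1 <= b' -> 0 <= e <= M^-1 -> 0 < y -> y ^+ 2 * t ^+ 2 <= 4 / t ->
  0 < d <= t + 2 -> c = nu ^+ 2 / 16 + delta -> 0 <= c -> A ^+ 2 = y * t ->
  `|F| <= b -> `|h| <= b -> `|h2| <= b -> `|L| <= b' ->
  let w := F * (A * h) in
  let lap := L * (A * h) + F * (A * (y ^- 2 * (t ^- 2 * (e * h2 - h / 4) - h / 4))) in
  (y * lap + w / (4 * y)) ^+ 2 - nu ^+ 2 / 4 * (w / y * (y * lap + w / (4 * y)))
  - c * (w ^+ 2 / (y ^+ 2 * d ^+ 2)) + delta * (w ^+ 2 / (y * t) ^+ 2)
  <= ((b * (b + b) + 4 * (b * b')) ^+ 2 + nu ^+ 2 / 4 * (b * b * (b * b) + 4 * (b * (b * b) * b'))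
      + 4 * c * (b * b * (b * b))) / M * (y * t)^-1.
Proof.
move=> M1 Mt b1 b'1 he y0 yt hd cE c0 A2 hF hh hh2 hL; lazy zeta.
set lap := L * (A * h) + _; set w := F * (A * h).
have t0 : 0 < t by rewrite (lt_le_trans _ Mt)// (lt_le_trans ltr01).
have k0 : 0 <= y ^+ 2 * t ^+ 2 <= 4 / t by rewrite mulr_ge0 ?sqr_ge0.
have := bracket_le M1 Mt b1 b'1 he k0 hd cE c0 hF hh hh2 hL; lazy zeta.
have yt0 : 0 <= (y * t)^-1 by rewrite invr_ge0 mulr_ge0 ?ltW.
move=> /(ler_wpM2r yt0); apply: le_trans.
have /andP[d0 _] := hd.
have [yn tn dn] : [/\ y != 0, t != 0 & d != 0] by rewrite !lt0r_neq0.
rewrite le_eqVlt; apply/orP; left; apply/eqP.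
pose Z := F * t ^- 2 * (e * h2 - h / 4) + y ^+ 2 * (h * L).
have E : y * lap + w / (4 * y) = A / y * Z.
  by rewrite /lap /w /Z; clear -yn tn; field; rewrite yn tn.
rewrite E (_ : (A / y * Z) ^+ 2 = A ^+ 2 / y ^+ 2 * Z ^+ 2); last by clear -yn; field.
rewrite (_ : w / y * (A / y * Z) = A ^+ 2 / y ^+ 2 * (F * h * Z)); last first.
  by rewrite /w; clear -yn; field.
rewrite (_ : w ^+ 2 = A ^+ 2 * (F ^+ 2 * h ^+ 2)); last by rewrite /w; clear; ring.
rewrite A2 /Z; clear -yn tn dn; field.
by rewrite yn tn dn.
Qed.

End optimizer_estimate.

Section near_optimality.
Context {R : realType} {n : nat}.
Implicit Types (p : 'rV[R]_n * R) (f w : 'rV[R]_n * R -> R).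
Local Notation dir := (@basis_dir R n).
Local Notation nu := (n%:R : R).
Local Notation o := (@open_half_space R n).

Definition low_region : set ('rV[R]_n * R) := [set p | 0 < p.2 < 1].

Lemma open_low_region : open low_region.
Proof.
rewrite (_ : low_region = snd @^-1` `]0, 1[%classic).
  by apply: open_comp => [p _|]; [exact: cvg_snd|exact: interval_open].
by apply/seteqP; split=> p /=; rewrite in_itv.
Qed.

Lemma low_region_punctured : low_region `<=` punctured.
Proof.
move=> p /andP[y0 y1]; split=> //; rewrite -subr_gt0 cdist_sub1//.
rewrite divr_gt0 ?mulr_gt0// ltr_wpDl ?norm2_ge0//.
by rewrite exprn_even_gt0//= subr_eq0 lt_eqF.
Qed.

(** Here c lies between 1/(2y) and 3/(2y), and d = ln(c + s) between ln c and ln(2c). The constants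
    1 and 2 bound ln 2 and ln 3. *)
Lemma arcosh_cdist_bounds p : 0 < p.2 < 1 -> norm2 p <= 1 ->
  depth p.2 - 1 <= arcosh (cdist p) /\ 0 < arcosh (cdist p) <= depth p.2 + 2.
Proof.
move=> hp r1; have /andP[y0 y1] := hp; have [_ c1] := low_region_punctured hp.
have c0 : 0 < cdist p by rewrite (lt_trans ltr01).
have hc : 1 / (2 * p.2) <= cdist p <= 3 / (2 * p.2).
  rewrite /cdist !ler_pM2r ?invr_gt0 ?mulr_gt0// -addrA lerDl addr_ge0 ?norm2_ge0 ?sqr_ge0//=.
  have : p.2 ^+ 2 <= 1 by rewrite expr_le1// ltW.
  by lra.
have /andP[h1 h2] := hc.
rewrite arcosh_gt0//=; split.
  apply: (@le_trans _ _ (ln (cdist p))).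
    apply: (@le_trans _ _ (ln (1 / (2 * p.2)))); last by rewrite ler_ln ?posrE// divr_gt0// mulr_gt0.
    rewrite div1r lnV ?posrE ?mulr_gt0// lnM ?posrE// /depth.
    have : ln (1 + 1) <= (1 : R) by apply: le_ln1Dx; rewrite (lt_trans _ ltr01)// ltrN10.
    by rewrite (_ : 1 + 1 = 2)//; lra.
  by rewrite ler_ln ?posrE// ?lerDl ?sqrtr_ge0// ltr_wpDr ?sqrtr_ge0.
apply: (@le_trans _ _ (ln (3 / p.2))).
  rewrite ler_ln ?posrE ?divr_gt0// ?ltr_wpDr ?sqrtr_ge0//.
  apply: (@le_trans _ _ (cdist p + cdist p)).
    rewrite lerD2l -[leRHS]ger0_norm ?(ltW c0)// -sqrtr_sqr ler_sqrt ?sqr_ge0//.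
    by rewrite lerBlDr lerDl.
  by move: h2; rewrite invfM => h2; lra.
rewrite lnM ?posrE ?invr_gt0// lnV ?posrE// addrC lerD2l.
have : ln (1 + 2) <= (2 : R) by apply: le_ln1Dx; rewrite (lt_trans (ltrN10 _)).
by rewrite (_ : 1 + 2 = 3)// -natrD.
Qed.

(** With y = exp(-t), both y t <= 1 and y t^2 <= 4 are cases of [expr_expRN_le]; multiply them. *)
Lemma sqr_exp_decay (y : R) : 0 < y < 1 ->
  y ^+ 2 * depth y ^+ 2 <= 4 / depth y.
Proof.
move=> /andP[y0 y1]; have d0 : 0 < depth y by rewrite oppr_gt0 ln_lt0// y0.
have yE : expR (- depth y) = y by rewrite opprK lnK.
have h1 : depth y * y <= 1.
  by have := @expr_expRN_le R 1 (depth y) isT (ltW d0); rewrite yE !expr1.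
have h2 : depth y ^+ 2 * y <= 4.
  by have := @expr_expRN_le R 2 (depth y) isT (ltW d0); rewrite yE; lra.
rewrite ler_pdivlMr//.
rewrite (_ : _ * depth y = (depth y ^+ 2 * y) * (depth y * y)); last by ring.
rewrite -[leRHS]mulr1; apply: ler_pM => //; rewrite mulr_ge0 ?exprn_ge0// ltW//.
Qed.

Lemma is_derive_lnln (K y : R) : 0 < y < 1 ->
  is_derive y 1 (fun y => K * - ln (depth y)) (K * (y * depth y)^-1) /\
  {for y, continuous (fun z : R => K * (z * depth z)^-1)}.
Proof.
move=> hy; have /andP[y0 y1] := hy.
have d0 : 0 < depth y by rewrite oppr_gt0 ln_lt0// y0.
split.
  have d := is_derive_mul (is_derive_const y 1 K) (is_derive_opp (is_derive_ln_depth hy)).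
  by apply: (is_derive_eq d); rewrite mul0r add0r opprK.
have yd0 : y * depth y != 0 by rewrite mulf_neq0// gt_eqF.
have [d _] := is_derive_mul (is_derive_const y 1 K) (is_derive_inv
  (f := fun z : R => z * depth z) yd0 (is_derive_mul (is_derive_id y 1) (is_derive_depth y0))).
by apply: differentiable_continuous; exact/derivable1_diffP.
Qed.

Variables (eps M : R).
Hypotheses (eps0 : 0 < eps) (M1 : 1 < M).
Local Notation w := (@optimizer R n eps M).

(** The optimizer vanishes above the height exp(-M) < 1, so continuity is to be checked in the low
    region, which avoids the pole: functions of d are smooth there. *)
Lemma Cc_low f : (forall p, w p = 0 -> f p = 0) -> Ck_on dir 0 low_region f -> Cc f.
Proof.
move=> wf cf; have [[K K0 hw] _] := @Ckc_optimizer R n eps M eps0 M1 0.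
split; first by exists K => //; apply: supported_sub hw _ => p; apply: contraNN => /eqP/wf ->.
move=> p p0; have [y1|y1] := ltP p.2 1; first by apply: cf; rewrite /low_region/= p0.
apply: (@near_cst_continuous _ _ (0 : R)).
have : expR (- M) < p.2.
  by rewrite (lt_le_trans _ y1)// -expR0 ltr_expR oppr_lt0 (lt_trans ltr01).
have c2 : (fun q : 'rV[R]_n * R => q.2) @ p --> p.2 by exact: cvg_snd.
move=> /(cvgr_gt _ c2); apply: filterS => q hq; apply: wf.
by rewrite /optimizer profile_above// mulr0.
Qed.

Definition optimizer_distance p : R := w p ^+ 2 / (p.2 ^+ 2 * arcosh (cdist p) ^+ 2).
Definition optimizer_depth p : R := w p ^+ 2 / (p.2 * depth p.2) ^+ 2.

Let Ck_optimizer_low k : Ck_on dir k low_region w.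
Proof.
have [_ cw] := @Ckc_optimizer R n eps M eps0 M1 k.
by apply: Ck_on_subset cw => p /andP[].
Qed.

Lemma Cc_optimizer_distance : Cc optimizer_distance.
Proof.
apply: Cc_low; first by move=> p h; rewrite /optimizer_distance h expr0n mul0r.
have ol := open_low_region.
have cV : Ck_on dir 0 low_region (fun p => p.2^-1).
  by apply: (Ck_on_subset _ (Ck_on_sndV 0)) => p /andP[].
have cr : Ck_on dir 0 low_region (fun p => arcosh (cdist p) ^- 2).
  apply: (Ck_on_subset low_region_punctured).
  exact: (@Ck_on_cdist_comp R n 0 (fun c => arcosh c ^- 2) (Ck1_arcoshV 0 2)).
apply: (@Ck_on_eq _ _ _ dir 0 _ _ _ ol _ (Ck_on_mul ol (Ck_on_exp 2 ol (Ck_optimizer_low 0))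
  (Ck_on_mul ol (Ck_on_exp 2 ol cV) cr))) => p _.
by rewrite /optimizer_distance exprVn -invfM.
Qed.

Lemma Cc_optimizer_depth : Cc optimizer_depth.
Proof.
apply: Cc_low; first by move=> p h; rewrite /optimizer_depth h expr0n mul0r.
have ol := open_low_region => p hp.
have /andP[y0 y1] := hp; have d0 : 0 < depth p.2 by rewrite oppr_gt0 ln_lt0// y0.
apply: cvgM; first by apply: (Ck_on_exp 2 ol (Ck_optimizer_low 0)).
have cd : {for p, continuous (fun q : 'rV[R]_n * R => depth q.2)}.
  apply: cvgN; apply: (@continuous_comp _ _ _ snd (@ln R)); first exact: cvg_snd.
  exact: continuous_ln.
apply: cvgV; first by rewrite expf_neq0// mulf_neq0// gt_eqF.
have cyd : {for p, continuous (fun q : 'rV[R]_n * R => q.2 * depth q.2)}.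
  by apply: cvgM => //; exact: cvg_snd.
apply: (@continuous_comp _ _ _ (fun q : 'rV[R]_n * R => q.2 * depth q.2) (fun x => x ^+ 2)) => //.
exact: exprn_continuous.
Qed.

End near_optimality.

(** * Integrated defect of the optimizers *)

Section defect_of_optimizers.
Context {R : realType} {n : nat}.
Implicit Types (p : 'rV[R]_n * R) (f w : 'rV[R]_n * R -> R).
Local Notation nu := (n%:R : R).

(** [optimizer_density_le] is integrated over the cube of side 2 in x, whence 2^n, and over a unit
    range of [scale_pos], whence 1/eps. For eps = 1/M the factors 1/M and 1/eps compensate and the
    bound is independent of M. *)
Lemma normal_energy_defect (b c delta eps M : R) :
  1 <= b -> (forall z : R, [/\ `|flat_bump z| <= b, `|dbump z| <= b & `|ddbump z| <= b]) ->
  0 < eps -> eps ^+ 2 <= M^-1 -> 1 < M -> c = nu ^+ 2 / 16 + delta -> 0 <= c -> 0 <= delta ->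
  let b' := (4 + 2 * nu) * b in
  let C0 := (b * (b + b) + 4 * (b * b')) ^+ 2
      + nu ^+ 2 / 4 * (b * b * (b * b) + 4 * (b * (b * b) * b')) + 4 * c * (b * b * (b * b)) in
  hint (normal_energy (@optimizer R n eps M)) - c * hint (optimizer_distance eps M : 'rV[R]_n * R -> R)
    + delta * hint (optimizer_depth eps M : 'rV[R]_n * R -> R) <= 2 ^+ n * (C0 / M / eps).
Proof.
move=> b1 hb eps0 eM M1 cE c0 delta0; lazy zeta.
set b' := (4 + 2 * nu) * b; set C0 := _ + 4 * c * _.
have M0 : 0 < M by rewrite (lt_trans ltr01).
have nu0 : 0 <= nu by [].
have b0 : 0 <= b by rewrite (le_trans ler01).
have b'1 : 1 <= b'.
  by rewrite -[leLHS]mulr1 ler_pM//; lra.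
have C00 : 0 <= C0.
  by rewrite /C0 !addr_ge0 ?sqr_ge0 ?mulr_ge0 ?addr_ge0 ?mulr_ge0 ?(le_trans ler01 b'1) ?invr_ge0.
set w := optimizer eps M.
have Cw := @Ckc_optimizer R n eps M eps0 M1 2.
have CN := Cc_normal_energy Cw.
have CT := @Cc_optimizer_distance R n eps M eps0 M1.
have CP := @Cc_optimizer_depth R n eps M eps0 M1.
have CT' := CcZ (- c) CT; have CP' := CcZ delta CP.
rewrite -mulNr -(hintZ _ CT) -(hintZ _ CP) -(hintD CN CT') -(hintD (CcD CN CT') CP').
set E := (_ \+ _) \+ _; have CE : Cc E := CcD (CcD CN CT') CP'.
pose ya := expR (- (M * expR (1 / eps))); pose yb := expR (- (M * expR (0 / eps))).
pose K := C0 / M.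
have K0 : 0 <= K by rewrite divr_ge0// ltW.
have GE : K * - ln (depth yb) - K * - ln (depth ya) = K / eps.
  rewrite /depth /ya /yb !expRK !opprK !lnM ?posrE ?expR_gt0// !expRK mul0r div1r.
  by ring.
rewrite -GE (_ : 2 = 1 - -1); last by rewrite opprK.
have low y : ya <= y <= yb -> 0 < depth y /\ 0 <= scale_pos eps M y <= 1.
  by move=> h; exact: (@height_rangeV R eps M eps0 M1 y 0 1 h).
apply: (@hint_le_box _ _ E (-1) 1 ya yb (fun y => K * (y * depth y)^-1) (fun y => K * - ln (depth y))).
- exact: CE.
- exact: (le_trans (lerN10 R) ler01).
- rewrite ltr_expR ltrN2 ltr_pM2l// ltr_expR ltr_pM2r ?invr_gt0//.
- by move=> y /low[/depth_gt0 hy _]; exact: is_derive_lnln.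
move=> x y.
have R0 : 0 <= (if `[< (forall i, -1 <= x ord0 i <= 1) /\ ya <= y <= yb >]
    then K * (y * depth y)^-1 else 0).
  case: asboolP => // -[_ /low[d0 _]]; have /andP[y0 _] := depth_gt0 d0.
  by rewrite mulr_ge0// invr_ge0 mulr_ge0// ltW.
have [p0|pN] := pselect (half_space (x, y)); last first.
  have [[L L0 hF] _] := CE.
  by rewrite (nbhs_singleton (supported_near0N L0 hF pN)).
have EE : E (x, y) = normal_energy w (x, y) + - c * optimizer_distance eps M (x, y)
    + delta * optimizer_depth eps M (x, y) by [].
have lapE := laplacian_optimizer eps0 M1 p0.
have zero : w (x, y) = 0 -> laplacian w (x, y) = 0 -> E (x, y) = 0.
  move=> w0 l0; rewrite EE /normal_energy /optimizer_distance /optimizer_depth -/w w0 l0.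
  by rewrite !(mul0r, mulr0, addr0, expr0n, subr0, oppr0).
have [/andP[r0 r1]|rN] := boolP (0 <= norm2 (x, y) <= 1); last first.
  rewrite zero//; first by rewrite /w /optimizer (bump_outside rN) mul0r.
  by rewrite lapE (bump_outside rN) /bump_laplacian (ddbump_outside rN) (dbump_outside rN) !(mul0r, mulr0, addr0).
have [sr|sN] := boolP (0 <= scale_pos eps M y <= 1); last first.
  rewrite zero//; first by rewrite /w /optimizer /profile/= (bump_outside sN) !(mul0r, mulr0).
  by rewrite lapE /profile /ddprofile/= (bump_outside sN) (ddbump_outside sN) !(mul0r, mulr0, addr0, subr0).
have /andP[s0 s1] := sr.
have y0 : 0 < y by [].
have y1 : y < 1.
  rewrite ltNge; apply/negP => y1; move: s0; rewrite leNgt => /negP; apply.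
  apply: scale_pos_lt0 => //.
  by rewrite (lt_le_trans _ y1)// -expR0 ltr_expR oppr_lt0.
have hy : 0 < y < 1 by rewrite y0.
have d0 : 0 < depth y by rewrite oppr_gt0 ln_lt0.
have Mt : M <= depth y.
  by have /andP[+ _] := @scale_pos_range R eps M eps0 M1 y 0 1 d0 sr; rewrite mul0r expR0 mulr1.
have [_ /andP[a0 a2]] := @arcosh_cdist_bounds R n (x, y) hy r1.
case: asboolP => [_|[]]; last first.
  split; last exact: (@height_range R eps M eps0 M1 y 0 1 d0 sr).
  move=> i; rewrite -ler_norml.
  by apply: (@coord_le_norm2 R n (x, y)) => //; rewrite expr1n.
have hL : `|@bump_laplacian R n (x, y)| <= b'.
  have [_ h1 h2] := hb (norm2 (x, y)).
  rewrite /bump_laplacian /b' (mulrDl 4 (2 * nu)); apply: norm_add_le.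
    apply: norm_mul_le => //; rewrite normrM ger0_norm// ger0_norm//.
    by rewrite ler_piMr.
  by apply: norm_mul_le => //; rewrite ger0_norm// mulr_ge0.
have [hF _ _] := hb (norm2 (x, y)); have [hh _ hh2] := hb (scale_pos eps M y).
have he : 0 <= eps ^+ 2 <= M^-1 by rewrite sqr_ge0.
have := optimizer_density_le (ltW M1) Mt b1 b'1 he y0 (sqr_exp_decay hy)
  (introT andP (conj a0 a2)) cE c0 (amplitude_sqr hy) hF hh hh2 hL.
lazy zeta; apply: le_trans.
rewrite EE /normal_energy /optimizer_distance /optimizer_depth lapE mulNr.
by rewrite /w /optimizer /profile /ddprofile /=.
Qed.

(** Restrict to a box where both bumps are bounded below: 1/(2 nu) <= x_i <= 1/nu puts |x|^2 between
    1/(4 nu) and 1/nu <= 1/4, and [scale_pos] ranges over [1/4, 3/4], of length 1/2. The lower bound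
    grows like 1/eps. *)
Lemma optimizer_depth_ge (eps M : R) : (3 < n)%N -> 0 < eps -> 1 < M ->
  let m := flat (4 * nu)^-1 * flat (1 - 1 / 4) * (flat (1 / 4) * flat (1 - 3 / 4)) in
  (2 * nu)^-1 ^+ n * (m ^+ 2 / 2 / eps) <= hint (optimizer_depth eps M : 'rV[R]_n * R -> R).
Proof.
move=> n3 eps0 M1; lazy zeta; set m := flat _ * flat _ * (flat _ * flat _).
have M0 : 0 < M by rewrite (lt_trans ltr01).
have nu4 : 4 <= nu by rewrite (ler_nat _ 4).
have CP := @Cc_optimizer_depth R n eps M eps0 M1.
have m0 : 0 <= m by rewrite !mulr_ge0 ?flat_ge0.
pose ya := expR (- (M * expR ((3 / 4) / eps))); pose yb := expR (- (M * expR ((1 / 4) / eps))).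
have GE : m ^+ 2 * - ln (depth yb) - m ^+ 2 * - ln (depth ya) = m ^+ 2 / 2 / eps.
  rewrite /depth /ya /yb !expRK !opprK !lnM ?posrE ?expR_gt0// !expRK.
  by field; rewrite gt_eqF.
rewrite -GE (_ : (2 * nu)^-1 = nu^-1 - (2 * nu)^-1); last first.
  by field; rewrite gt_eqF// (lt_le_trans _ nu4).
have low y : ya <= y <= yb -> 0 < depth y /\ 1 / 4 <= scale_pos eps M y <= 3 / 4.
  by move=> h; exact: (@height_rangeV R eps M eps0 M1 y (1 / 4) (3 / 4) h).
apply: (@hint_ge_box _ _ _ (2 * nu)^-1 nu^-1 ya yb (fun y => m ^+ 2 * (y * depth y)^-1)
  (fun y => m ^+ 2 * - ln (depth y))).
- exact: CP.
- by rewrite lef_pV2 ?posrE ?mulr_gt0// ?(lt_le_trans _ nu4)// ler_peMl// ler1n.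
- rewrite ltr_expR ltrN2 ltr_pM2l// ltr_expR ltr_pM2r ?invr_gt0// ltr_pM2r ?invr_gt0//.
  by clear; lra.
- by move=> y /low[/depth_gt0 hy _]; exact: is_derive_lnln.
move=> x y; case: asboolP => [[hx /low[d0 hs]]|_]; last first.
  by rewrite /optimizer_depth divr_ge0 ?sqr_ge0.
have hy := depth_gt0 d0; have /andP[y0 y1] := hy.
have hr : (4 * nu)^-1 <= norm2 (x, y) <= 1 / 4.
  rewrite /norm2 /=; apply/andP; split.
    apply: (@le_trans _ _ (\sum_(j < n) (2 * nu)^-1 ^+ 2)).
      rewrite sumr_const card_ord -[_ *+ n]mulr_natr le_eqVlt; apply/orP; left; apply/eqP.
      by field; rewrite gt_eqF// (lt_le_trans _ nu4).
    apply: ler_sum => j _; rewrite lerXn2r ?nnegrE ?invr_ge0 ?mulr_ge0//.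
      by have /andP[h _] := hx j; rewrite (le_trans _ h)// invr_ge0 mulr_ge0.
    by have /andP[] := hx j.
  apply: (@le_trans _ _ (\sum_(j < n) nu^-1 ^+ 2)).
    apply: ler_sum => j _; have /andP[h1 h2] := hx j.
    by rewrite lerXn2r ?nnegrE ?invr_ge0// (le_trans _ h1)// invr_ge0 mulr_ge0.
  rewrite sumr_const card_ord -[_ *+ n]mulr_natr expr2 -mulrA mulVf ?mulr1 ?gt_eqF ?(lt_le_trans _ nu4)//.
  by rewrite div1r lef_pV2 ?posrE// (lt_le_trans _ nu4).
have hB := ler_pM (mulr_ge0 (flat_ge0 _) (flat_ge0 _)) (mulr_ge0 (flat_ge0 _) (flat_ge0 _))
  (bump_ge hr) (bump_ge hs).
rewrite -/m in hB.
have -> : optimizer_depth eps M (x, y) =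
    (flat_bump (norm2 (x, y)) * flat_bump (scale_pos eps M y)) ^+ 2 * (y * depth y)^-1.
  rewrite /optimizer_depth /optimizer /profile /= mulrCA exprMn (amplitude_sqr hy).
  rewrite -[(y * depth y) ^+ 2]/(y * depth y * (y * depth y)) invfM mulrACA divff ?mul1r 1?mulrC//.
  by rewrite mulf_neq0// gt_eqF.
by rewrite ler_wpM2r ?invr_ge0 ?mulr_ge0 ?(ltW y0) ?(ltW d0)// lerXn2r ?nnegrE// (le_trans m0).
Qed.


End defect_of_optimizers.

Section near_optimizers.
Context {R : realType} {n : nat}.
Implicit Types (p : 'rV[R]_n * R) (f w : 'rV[R]_n * R -> R).
Local Notation nu := (n%:R : R).

Definition distance_density w p : R := w p ^+ 2 / (p.2 ^+ 2 * arcosh (cdist p) ^+ 2).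

Lemma near_optimizer (c D : R) : (3 < n)%N -> nu ^+ 2 / 16 < c ->
  exists w, [/\ forall k, Ckc k w,
    forall p, w p != 0 -> D <= arcosh (cdist p),
    Cc (distance_density w) &
    hint (normal_energy w) < c * hint (distance_density w)].
Proof.
move=> n3 hc; have [b b1 hb] := @bump_bounded R.
have c0 : 0 <= c by rewrite (le_trans _ (ltW hc))// mulr_ge0 ?sqr_ge0.
have nu4 : 4 <= nu by rewrite (ler_nat _ 4).
have nu0 : 0 < nu by rewrite (lt_le_trans _ nu4).
pose delta := c - nu ^+ 2 / 16; have delta0 : 0 < delta by rewrite subr_gt0.
pose b' := (4 + 2 * nu) * b.
pose C0 := (b * (b + b) + 4 * (b * b')) ^+ 2
      + nu ^+ 2 / 4 * (b * b * (b * b) + 4 * (b * (b * b) * b')) + 4 * c * (b * b * (b * b)).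
have b0 : 0 <= b by rewrite (le_trans ler01).
have b'0 : 0 <= b' by rewrite mulr_ge0// addr_ge0// mulr_ge0.
have C00 : 0 <= C0.
  by rewrite /C0 !addr_ge0 ?sqr_ge0 ?mulr_ge0 ?addr_ge0 ?mulr_ge0 ?invr_ge0.
pose m : R := flat (4 * nu)^-1 * flat (1 - 1 / 4) * (flat (1 / 4) * flat (1 - 3 / 4)).
have m0 : 0 < m.
  have [f1 f2 f3] : [/\ 0 < 1 - 1 / 4 :> R, 0 < 1 / 4 :> R & 0 < 1 - 3 / 4 :> R].
    by clear; split; lra.
  by rewrite /m !mulr_gt0 ?flat_gt0// invr_gt0 mulr_gt0.
pose kappa := delta * ((2 * nu)^-1 ^+ n * (m ^+ 2 / 2)).
have kappa0 : 0 < kappa.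
  have nV : 0 < (2 * nu)^-1 by rewrite invr_gt0 mulr_gt0.
  by rewrite /kappa (mulr_gt0 delta0)// (mulr_gt0 (exprn_gt0 n nV))// divr_gt0// exprn_gt0.
(* With eps = 1/M the defect is at most 2^n C0, whereas delta times the depth integral is at least
   kappa M; the last summand lets the latter win. The others give M > 1 and d >= M - 1 >= D on the
   support. *)
pose M := 2 + `|D| + 2 ^+ n * C0 / kappa.
have q0 : 0 <= 2 ^+ n * C0 / kappa.
  by rewrite (divr_ge0 _ (ltW kappa0))// (mulr_ge0 (exprn_ge0 n _) C00).
have M2 : 2 <= M by rewrite /M -addrA lerDl addr_ge0.
have M1 : 1 < M by rewrite (lt_le_trans _ M2)// ltr1n.
have M0 : 0 < M by rewrite (lt_trans ltr01).
have eps0 : 0 < M^-1 by rewrite invr_gt0.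
have eM : M^-1 ^+ 2 <= M^-1 by rewrite expr2 ler_piMl ?invf_le1 ?ltW.
exists (optimizer M^-1 M); split.
- by move=> k; exact: Ckc_optimizer.
- move=> p /(optimizer_neq0 eps0 M1)[/andP[_ r1] /andP[s0 _] /andP[y0 _]].
  have dM := scale_pos_gt0 eps0 M1 s0.
  have hy := depth_gt0 (lt_trans M0 dM).
  have [h _] := arcosh_cdist_bounds hy (ltW r1).
  apply: le_trans h; rewrite lerBrDr (le_trans _ (ltW dM))//.
  rewrite (le_trans (lerD (ler_norm D) (lexx _)))// /M addrC.
  by rewrite (le_trans (lerD (ler1n R 2) (lexx `|D|)))// lerDl.
- exact: (Cc_optimizer_distance eps0 M1).
have cE : c = nu ^+ 2 / 16 + delta by rewrite /delta addrC subrK.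
have h1 := @normal_energy_defect R n b c delta M^-1 M b1 hb eps0 eM M1 cE c0 (ltW delta0).
have h2 := @optimizer_depth_ge R n M^-1 M n3 eps0 M1.
move: h1 h2; lazy zeta; rewrite -/b' -/C0 -/m => h1 h2.
have h3 : kappa * M <= delta * hint (optimizer_depth M^-1 M : 'rV[R]_n * R -> R).
  by rewrite /kappa -mulrA ler_pM2l// (le_trans _ h2)// invrK -[leLHS]mulrA.
have h4 : 2 ^+ n * (C0 / M / M^-1) < kappa * M.
  rewrite invrK divfK ?gt_eqF// -ltr_pdivrMl// mulrC /M -[ltLHS]add0r ltr_leD//.
rewrite -subr_lt0.
have h5 := le_lt_trans h1 h4.
have h6 := lt_le_trans h5 h3.
by rewrite -(gtrDl (delta * hint (optimizer_depth M^-1 M : 'rV[R]_n * R -> R))) addrC.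
Qed.

End near_optimizers.

Section smooth_compactly_supported.
Context {R : realType} {n : nat}.
Implicit Types (v : 'rV[R]_n * R -> R).
Local Notation o := (@open_half_space R n).

(** Near each point outside the closed box v is zero, so the box also contains the closed support.
    For the same reason v is smooth across the boundary of the half space. *)
Lemma Ckc_test_function v : (forall k, Ckc k v) -> test_function v.
Proof.
move=> Cv; have [[K K0 hv] _] := Cv 0%N.
have sub p : tsupport v p -> (forall i, `|p.1 ord0 i| <= K) /\ K^-1 <= p.2 <= K.
  move=> vp; apply: contrapT => /(supported_near0 K0 hv)/vp[q [/eqP q0 q1]].
  exact: q0.
split.
- move=> k; apply/CkP.
  apply: (@Ck_on_subset _ _ _ _ _ (half_space `|` [set q | v q = 0]°)).
    move=> p _; have [p0|pN] := pselect (half_space p); first by left.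
    by right; exact: supported_near0N K0 hv pN.
  apply: Ck_on_union; first exact: (Cv k).2.
  apply: (@Ck_on_eq _ _ _ _ _ _ (fun=> 0)).
  - exact: open_interior.
  - by move=> p /interior_subset.
  - by apply: Ck_on_const; exact: open_interior.
- apply: (@subclosed_compact _ _
      ([set x : 'rV[R]_n | forall i, `[- K, K]%classic (x ord0 i)] `*` `[K^-1, K]%classic)).
  + exact: closed_closure.
  + apply: compact_setX; last exact: segment_compact.
    apply: (@rV_compact R n (fun=> `[- K, K]%classic)) => i; exact: segment_compact.
  + by move=> p /sub[h1 h2]; split=> /= [i|]; rewrite in_itv//= -ler_norml.
- by move=> p /sub[_ /andP[+ _]]; apply: lt_le_trans; rewrite invr_gt0.
Qed.

End smooth_compactly_supported.

(** * The inequalities and their sharpness *)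

Section sharpness.
Context {R : realType} {n : nat} (n3 : (3 < n)%N).
Implicit Types (p : 'rV[R]_n * R) (w : 'rV[R]_n * R -> R).
Local Notation nu := (n%:R : R).
Local Notation mass w := (hint (fun p => w p ^+ 2 / p.2 ^+ 2)).

Lemma mass_ge0 w : Ckc 1 w -> 0 <= mass w.
Proof.
move=> /(Cc_sqr_over_height 2) Cw; rewrite -lee_fin -(half_space_integralE Cw).
by apply: half_space_integral_ge0 => x y y0; rewrite divr_ge0 ?sqr_ge0.
Qed.

Lemma energy_lt_distance c D : nu ^+ 2 / 16 < c -> exists w, [/\ forall k, Ckc k w,
    forall p, w p != 0 -> D <= arcosh (cdist p), Cc (distance_density w) &
    hint (energy ((nu ^+ 2 - 2) / 4) w) <
    (nu ^+ 2 - 1) / 16 * mass w + c * hint (distance_density w)].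
Proof.
move=> /(near_optimizer D n3)[w [Cw hw Cd lt]]; exists w; split=> //.
by rewrite hint_normal_energy// addrC ltrD2l.
Qed.

Lemma energy_lt_mass eps : 0 < eps -> exists2 w, forall k, Ckc k w &
  hint (energy ((nu ^+ 2 - 2) / 4) w) < ((nu ^+ 2 - 1) / 16 + eps) * mass w.
Proof.
(* Any admissible c will do. D is such that c <= eps D^2, so that at distance at least D the term
   c/d^2 is absorbed by eps. *)
move=> eps0; pose c := nu ^+ 2 / 16 + 1; pose D := 1 + c / eps.
have c0 : 0 <= c by rewrite addr_ge0// divr_ge0 ?sqr_ge0.
have D1 : 1 <= D by rewrite lerDl divr_ge0// ltW.
have D0 : 0 < D by rewrite (lt_le_trans ltr01).
have cD : c <= eps * D ^+ 2.
  rewrite -ler_pdivrMl// mulrC (le_trans (_ : _ <= D))//; first by rewrite lerDr.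
  by rewrite expr2 ler_peMr// ltW.
have hc : nu ^+ 2 / 16 < c by rewrite ltrDl.
have [w [Cw hw Cd lt]] := energy_lt_distance D hc.
exists w => //; apply: lt_le_trans lt _; rewrite (mulrDl _ eps) lerD2l.
have CQ := Cc_sqr_over_height 2 (Cw 1%N).
rewrite -(hintZ _ Cd) -(hintZ _ CQ); apply: le_hint; [exact: CcZ|exact: CcZ|].
move=> p p0; have [w0|w0] := eqVneq (w p) 0.
  by rewrite /distance_density w0 expr0n !(mul0r, mulr0).
have d0 : 0 < arcosh (cdist p) by rewrite (lt_le_trans D0)// hw.
have E (a q s : R) : c * (a / (q * s)) = a / q * (c / s) by rewrite invfM; ring.
rewrite /distance_density E [leRHS]mulrC ler_wpM2l ?divr_ge0 ?sqr_ge0//.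
rewrite ler_pdivrMr ?exprn_gt0// (le_trans cD)// ler_wpM2l ?(ltW eps0)//.
by rewrite lerXn2r ?nnegrE ?(ltW D0) ?(ltW d0)// hw.
Qed.

(** Lowering the coefficient from c0 to c removes (c0 - c) |grad w|^2, whose integral is at least
    (c0 - c) / 4 times the mass by [vertical_hardy]. Hence an optimizer with a mass excess of (c0 -
    c) / 4 is good enough. *)
Lemma energy_lt_coefficient c : c < (nu ^+ 2 - 2) / 4 -> exists2 w, forall k, Ckc k w &
  hint (energy c w) < (nu ^+ 2 - 1) / 16 * mass w.
Proof.
set c0 := (_ / 4) => hc; have d0 : 0 < (c0 - c) / 4 by rewrite divr_gt0// subr_gt0.
have [w Cw lt] := energy_lt_mass d0; exists w => //.
have CG := Cc_grad_sq (Cw 1%N); have CE := Cc_energy c (Cw 2%N).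
have hE : hint (energy c0 w) = hint (energy c w) + (c0 - c) * hint (grad_sq w).
  rewrite -(hintZ _ CG) -(hintD CE (CcZ _ CG)); congr hint.
  by apply/funext => p; rewrite /energy /=; ring.
have hV := vertical_hardy (Cw 1%N).
have hV' : (c0 - c) * (1 / 4 * mass w) <= (c0 - c) * hint (grad_sq w).
  by rewrite ler_wpM2l// subr_ge0 ltW.
move: lt hV'; rewrite hE; clear -c0.
move: (hint _) (hint _) (hint _) ((nu ^+ 2 - 1) / 16) => E G Q K lt hV'.
rewrite (mulrDl K) in lt; rewrite div1r mulrA in hV'.
by rewrite -(ltrD2r ((c0 - c) * G)) (lt_le_trans lt)// lerD2l.
Qed.

End sharpness.

Section half_space_inequalities.
Context {R : realType} {n : nat} (n3 : (3 < n)%N).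
Implicit Types (p : 'rV[R]_n * R) (v w : 'rV[R]_n * R -> R).
Local Notation nu := (n%:R : R).
Local Notation o := (@open_half_space R n).
Local Notation mass w := (hint (fun p => w p ^+ 2 / p.2 ^+ 2)).

Lemma eq_half_space_integral (f g : 'rV[R]_n -> R -> R) :
  (forall x y, 0 < y -> f x y = g x y) -> half_space_integral f = half_space_integral g.
Proof.
move=> fg; apply: eq_integral => y; rewrite inE /= in_itv/= andbT => y0.
by apply: eq_integral => t _; rewrite fg.
Qed.

Lemma iint_distance w : Cc (distance_density w) ->
  (\iint_(x, y) (w (x, y) ^+ 2 / (y ^+ 2 * hyp_dist x y ^+ 2)) =
   (hint (distance_density w))%:E)%E.
Proof.
move=> Cw; rewrite -(half_space_integralE Cw); apply: eq_half_space_integral => x y y0.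
by rewrite hyp_distE.
Qed.

Lemma iint_height_mul w (g : 'rV[R]_n -> R -> R) :
  (\iint_(x, y) (height_mul w (x, y) ^+ 2 / (y ^+ 4 * g x y)) =
   \iint_(x, y) (w (x, y) ^+ 2 / (y ^+ 2 * g x y)))%E.
Proof.
apply: eq_half_space_integral => x y y0; rewrite /height_mul /= exprMn.
by rewrite -[4%N]/(2 + 2)%N exprD -mulrA -mulf_div divff ?mul1r// expf_neq0// gt_eqF.
Qed.

Lemma iint_height_mul4 w : Ckc 1 w ->
  (\iint_(x, y) (height_mul w (x, y) ^+ 2 / y ^+ 4) = (mass w)%:E)%E.
Proof.
move=> Cw; rewrite -(half_space_integralE (Cc_sqr_over_height 2 Cw)).
have := iint_height_mul w (fun _ _ => 1).
by under eq_half_space_integral do rewrite mulr1; under [X in _ = X -> _]eq_half_space_integral do rewrite mulr1.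
Qed.

Lemma iint_weighted_energy c w : Ckc 2 w ->
  (\iint_(x, y) (laplacian (height_mul w) (x, y) ^+ 2 +
     c * (grad_sq (height_mul w) (x, y) / y ^+ 2)) =
   (hint (energy (2 + c) w) + 2 * c * mass w)%:E)%E.
Proof.
move=> Cw; rewrite -hint_weighted_energy//.
exact: (half_space_integralE (Cc_weighted_energy c (Ckc_height_mul Cw))).
Qed.

Lemma height_div k v : Ckc k v -> exists2 w, Ckc k w & height_mul w = v.
Proof.
move=> [[K K0 hv] cv]; exists (fun p => v p * p.2^-1).
  split; last exact: (Ck_on_mul o cv (Ck_on_sndV k)).
  exists K => //; apply: supported_sub hv _ => p; apply: contraNN => /eqP ->.
  by rewrite mul0r.
apply/funext => p; rewrite /height_mul; have [-> |/hv[_ /andP[Kp _]]] := eqVneq (v p) 0.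
  by rewrite mul0r mulr0.
by rewrite mulrC divfK// gt_eqF// (lt_le_trans _ Kp)// invr_gt0.
Qed.

End half_space_inequalities.

Unset Implicit Arguments.
Set Strict Implicit.
Theorem corollary2p2 (R : realType) (N : nat) (hN : (4 < N)%N) :
  (forall v : 'rV[R]_N.-1 * R -> R, test_function v ->
       \iint_(x, y) (y ^+ 2 * laplacian v (x, y) ^+ 2 +
                     (N%:R ^+ 2 - 2 * N%:R - 1) / 4 * grad_sq v (x, y)) >=
       (N%:R * (N%:R - 2) / 16)%:E * \iint_(x, y) (v (x, y) ^+ 2 / y ^+ 2) +
       ((N%:R - 1) ^+ 2 / 16)%:E *
         \iint_(x, y) (v (x, y) ^+ 2 / (y ^+ 2 * hyp_dist x y ^+ 2)) +
       (9 / 16)%:E * \iint_(x, y) (v (x, y) ^+ 2 / (y ^+ 2 * hyp_dist x y ^+ 4)))%E /\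
  (forall v : 'rV[R]_N.-1 * R -> R, test_function v ->
       \iint_(x, y) (laplacian v (x, y) ^+ 2 +
                     (N%:R ^+ 2 - 2 * N%:R - 9) / 4 * (grad_sq v (x, y) / y ^+ 2)) >=
       (9 / 16 * (N%:R + 2) * (N%:R - 4))%:E *
         \iint_(x, y) (v (x, y) ^+ 2 / y ^+ 4) +
       ((N%:R - 1) ^+ 2 / 16)%:E *
         \iint_(x, y) (v (x, y) ^+ 2 / (y ^+ 4 * hyp_dist x y ^+ 2)) +
       (9 / 16)%:E * \iint_(x, y) (v (x, y) ^+ 2 / (y ^+ 4 * hyp_dist x y ^+ 4)))%E /\
  (forall c : R, (c < (N%:R ^+ 2 - 2 * N%:R - 1) / 4)%R ->
     ~ forall v : 'rV[R]_N.-1 * R -> R, test_function v ->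
       \iint_(x, y) (y ^+ 2 * laplacian v (x, y) ^+ 2 +
                     c * grad_sq v (x, y)) >=
       (N%:R * (N%:R - 2) / 16)%:E * \iint_(x, y) (v (x, y) ^+ 2 / y ^+ 2))%E /\
  (forall c : R, (c > N%:R * (N%:R - 2) / 16)%R ->
     ~ forall v : 'rV[R]_N.-1 * R -> R, test_function v ->
       \iint_(x, y) (y ^+ 2 * laplacian v (x, y) ^+ 2 +
                     (N%:R ^+ 2 - 2 * N%:R - 1) / 4 * grad_sq v (x, y)) >=
       c%:E * \iint_(x, y) (v (x, y) ^+ 2 / y ^+ 2))%E /\
  (forall c : R, (c > (N%:R - 1) ^+ 2 / 16)%R ->
     ~ forall v : 'rV[R]_N.-1 * R -> R, test_function v ->
       \iint_(x, y) (y ^+ 2 * laplacian v (x, y) ^+ 2 +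
                     (N%:R ^+ 2 - 2 * N%:R - 1) / 4 * grad_sq v (x, y)) >=
       (N%:R * (N%:R - 2) / 16)%:E * \iint_(x, y) (v (x, y) ^+ 2 / y ^+ 2) +
       c%:E * \iint_(x, y) (v (x, y) ^+ 2 / (y ^+ 2 * hyp_dist x y ^+ 2)))%E /\
  (forall c : R, (c < (N%:R ^+ 2 - 2 * N%:R - 9) / 4)%R ->
     ~ forall v : 'rV[R]_N.-1 * R -> R, test_function v ->
       \iint_(x, y) (laplacian v (x, y) ^+ 2 +
                     c * (grad_sq v (x, y) / y ^+ 2)) >=
       (9 / 16 * (N%:R + 2) * (N%:R - 4))%:E *
         \iint_(x, y) (v (x, y) ^+ 2 / y ^+ 4))%E /\
  (forall c : R, (c > 9 / 16 * (N%:R + 2) * (N%:R - 4))%R ->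
     ~ forall v : 'rV[R]_N.-1 * R -> R, test_function v ->
       \iint_(x, y) (laplacian v (x, y) ^+ 2 +
                     (N%:R ^+ 2 - 2 * N%:R - 9) / 4 * (grad_sq v (x, y) / y ^+ 2)) >=
       c%:E * \iint_(x, y) (v (x, y) ^+ 2 / y ^+ 4))%E /\
  (forall c : R, (c > (N%:R - 1) ^+ 2 / 16)%R ->
     ~ forall v : 'rV[R]_N.-1 * R -> R, test_function v ->
       \iint_(x, y) (laplacian v (x, y) ^+ 2 +
                     (N%:R ^+ 2 - 2 * N%:R - 9) / 4 * (grad_sq v (x, y) / y ^+ 2)) >=
       (9 / 16 * (N%:R + 2) * (N%:R - 4))%:E *
         \iint_(x, y) (v (x, y) ^+ 2 / y ^+ 4) +
       c%:E * \iint_(x, y) (v (x, y) ^+ 2 / (y ^+ 4 * hyp_dist x y ^+ 2)))%E.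
Proof.
move: hN; case: N => [//|n] n3 /=.
have En : n.+1%:R = n%:R + 1 :> R by rewrite natr1.
have E1 : n.+1%:R * (n.+1%:R - 2) / 16 = (n%:R ^+ 2 - 1) / 16 :> R by rewrite En; field.
have E2 : (n.+1%:R - 1) ^+ 2 / 16 = n%:R ^+ 2 / 16 :> R by rewrite En; field.
have E3 : (n.+1%:R ^+ 2 - 2 * n.+1%:R - 1) / 4 = (n%:R ^+ 2 - 2) / 4 :> R by rewrite En; field.
(* The constants of (B) come from those of (A): the gradient coefficient drops by 2, and the
   constant of the mass gains twice the new coefficient, as in [hint_weighted_energy]. *)
have E4 : (n.+1%:R ^+ 2 - 2 * n.+1%:R - 9) / 4 = (n%:R ^+ 2 - 2) / 4 - 2 :> R by rewrite En; field.
have E5 : 9 / 16 * (n.+1%:R + 2) * (n.+1%:R - 4) =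
    (n%:R ^+ 2 - 1) / 16 + 2 * ((n%:R ^+ 2 - 2) / 4 - 2) :> R by rewrite En; field.
rewrite E1 E2 E3 E4 E5; clear E1 E2 E3 E4 E5 En.
have CE c w : Ckc 2 w -> (\iint_(x, y) (y ^+ 2 * laplacian w (x, y) ^+ 2 +
    c * grad_sq w (x, y)) = (hint (energy c w))%:E)%E.
  by move=> Cw; exact: (half_space_integralE (Cc_energy c Cw)).
have CM w : Ckc 1 w -> (\iint_(x, y) (w (x, y) ^+ 2 / y ^+ 2) =
    (hint (fun p => w p ^+ 2 / p.2 ^+ 2))%:E)%E.
  by move=> Cw; exact: (half_space_integralE (Cc_sqr_over_height 2 Cw)).
have two c : 2 + (c - 2) = c :> R by rewrite subrKC.
have tf := @Ckc_test_function R n.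
have tfh (w : 'rV[R]_n * R -> R) (Cw : forall k, Ckc k w) := tf _ (fun k => Ckc_height_mul (Cw k)).
split; [|split; [|split; [|split; [|split; [|split; [|split]]]]]].
- by move=> v /(test_function_Ckc 2) Cv; rewrite CE//; exact: (hardy_rellich n3 Cv).
- move=> v /(test_function_Ckc 2)/height_div[w Cw <-].
  have Cw1 : Ckc 1 w by have [[K K0 hw] cw] := Cw; split; [exists K|exact: Ck_on_pred].
  rewrite iint_weighted_energy// iint_height_mul4// !iint_height_mul two.
  have := hardy_rellich n3 Cw; rewrite CM// => h.
  (* The integrals x and y with the distance may be infinite; only the finite term b is added on
     both sides. *)
  have shift (a b : R) (x y z : \bar R) :
      (a%:E + x + y <= z -> a%:E + b%:E + x + y <= z + b%:E)%E.
    by move=> le_z; rewrite (addeAC a%:E) (addeAC (a%:E + x)%E); exact: leeD2r.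
  by rewrite -EFinM (mulrDl ((n%:R ^+ 2 - 1) / 16)) [in leRHS]EFinD EFinD shift// EFinM.
- move=> c /(energy_lt_coefficient n3)[w Cw lt] /(_ w (tf w Cw)).
  by rewrite CE// CM// -EFinM lee_fin leNgt lt.
- move=> c; rewrite -subr_gt0 => /(energy_lt_mass n3)[w Cw lt] /(_ w (tf w Cw)).
  by rewrite CE// CM// -EFinM lee_fin leNgt; move: lt; rewrite subrKC => ->.
- move=> c /(energy_lt_distance n3 0)[w [Cw _ Cd lt]] /(_ w (tf w Cw)).
  by rewrite CE// CM// iint_distance// -!EFinM -EFinD lee_fin leNgt lt.
- move=> c hc; have hc' : 2 + c < (n%:R ^+ 2 - 2) / 4 by rewrite addrC -ltrBrDr.
  have [w Cw lt] := energy_lt_coefficient n3 hc'; move=> /(_ _ (tfh w Cw)).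
  rewrite iint_weighted_energy// iint_height_mul4// -EFinM lee_fin leNgt => /negP; apply.
  (* The mass term left by the substitution has the factor 2 c, smaller than the one on the other
     side, and the mass is nonnegative. *)
  rewrite (mulrDl ((n%:R ^+ 2 - 1) / 16)) ltr_leD// ler_wpM2r ?mass_ge0// ler_pM2l// ltW//.
- move=> c; rewrite -subr_gt0 => /(energy_lt_mass n3)[w Cw lt] /(_ _ (tfh w Cw)).
  rewrite iint_weighted_energy// iint_height_mul4// two -EFinM lee_fin leNgt => /negP; apply.
  move: lt; set Q := hint (fun p => w p ^+ 2 / _).
  set K := (_ - 1) / 16; set B := 2 * _; move: K B Q => K B Q lt.
  (* The gap c - (K + B) is the eps given to [energy_lt_mass]; B Q is the mass term created by the
     substitution. *)
  rewrite (_ : c * Q = (K + (c - (K + B))) * Q + B * Q); first by rewrite ltrD2r.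
  by ring.
- move=> c /(energy_lt_distance n3 0)[w [Cw _ Cd lt]] /(_ _ (tfh w Cw)).
  rewrite iint_weighted_energy// iint_height_mul4// iint_height_mul iint_distance// two.
  rewrite -!EFinM -EFinD lee_fin leNgt => /negP; apply.
  by rewrite (mulrDl ((n%:R ^+ 2 - 1) / 16)) addrAC ltrD2r.
Qed.
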